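(* Let $E$ be a separable symmetric Banach space on $(0,1)$. Suppose that there are constants depending only on $E$ such that for every finite von Neumann algebra $\mathcal{M}$ (with faithful normal trace $\tau$, $\tau(1)=1$) and for an arbitrary sequence $(x_k)_{k\geq 0}\subset E(\mathcal{M})$ of martingale differences we have $$\Big\|\sum_{k\geq 0}x_k\Big\|_{E(\mathcal{M})}\approx_E\Big\|\sum_{k\geq 0}x_k\otimes e_k\Big\|_{Z_E^2(\mathcal{M}\bar\otimes\ell_\infty)},$$ where $e_k$ are the standard unit vectors of $\ell_\infty$. Then $E=L_2(0,1)$ (equality of sets, with equivalent norms).
   Context: $A\approx_E B$ means $A\le C_EB$ and $B\le C_E'A$ with constants depending only on $E$. Singular values: for a semifinite von Neumann algebra $\mathcal{N}$ with faithful normal semifinite trace $\nu$, $L_0(\mathcal N)$ is the space of $\nu$-measurable operators and $\mu(t,x)=\inf\{s>0:\nu(e_{(s,\infty)}(|x|))\le t\}$, $t>0$; for functions, $\mu(f)$ is the decreasing rearrangement of $|f|$. The algebra $\mathcal M\bar\otimes\ell_\infty$ carries the trace $\tau\otimes\#$, $\#$ being counting measure on $\mathbb Z_+$. Symmetric spaces: a (quasi-)Banach function space $E$ on $(0,\alpha)$ is symmetric if $g\in E$, $f$ measurable and $\mu(f)\le\mu(g)$ imply $f\in E$ and $\|f\|_E\le\|g\|_E$. $E(\mathcal N)=\{x\in L_0(\mathcal N):\mu(x)\in E\}$ with $\|x\|_{E(\mathcal N)}=\|\mu(x)\|_E$. The space $Z_E^2$: for $E$ symmetric on $(0,1)$,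 $Z_E^2$ is the space of all measurable $f\in L_1(0,\infty)+L_\infty(0,\infty)$ with $\|f\|_{Z_E^2}:=\|\mu(f)\chi_{(0,1)}\|_E+\|f\|_{L_1+L_2}<\infty$; $Z_E^2(\mathcal N)=\{x:\mu(x)\in Z_E^2\}$ with $\|x\|_{Z_E^2(\mathcal N)}=\|\mu(x)\|_{Z_E^2}$. Martingale differences: $(\mathcal M_k)_{k\ge0}$ is an increasing sequence of von Neumann subalgebras of $\mathcal M$ with weak$^*$-dense union (arbitrary), $\mathcal E_k$ is the trace preserving conditional expectation onto $\mathcal M_k$ (extended to $L_1(\mathcal M)$). A sequence $(x_k)_{k\ge0}$ in $L_1(\mathcal M)$ is a sequence of martingale differences if $x_k\in L_1(\mathcal M_k)$ for $k\ge0$ and $\mathcal E_{k-1}(x_k)=0$ for $k\ge1$. Sums: $\sum_k x_k$ is understood as a series converging in $L_1(\mathcal M)$ (finite sequences included); $\sum_k x_k\otimes e_k$ is the element of the direct sum with coordinates $x_k$. Norms are $+\infty$ for elements outside the space. *)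

(* Defs.v *)
From HB Require Import structures.
From mathcomp Require Import all_boot all_order all_algebra.
From mathcomp Require Import all_classical all_reals all_analysis.
From mathcomp Require Import sesquilinear complex ring lra.

Set Implicit Arguments.
Unset Strict Implicit.
Unset Printing Implicit Defensive.

Import Order.TTheory GRing.Theory Num.Theory.
Import numFieldNormedType.Exports.

Local Open Scope classical_set_scope.
Local Open Scope ring_scope.
Local Open Scope complex_scope.

(** * Function spaces on (0,1) and on (0,oo) *)

Section FunctionSpaces.
Variable R : realType.
Local Notation leb := (@lebesgue_measure R).
Implicit Types (D : set R) (f g h : R -> R).

Definition unit_itv : set R := `]0, 1[.
Definition half_line : set R := `]0, +oo[.

(* Decreasing rearrangement of |f|, for f considered on D only. *)
Definition rearr D f (t : R) : \bar R :=
  ereal_inf [set s%:E | s in [set s : R | 0 < s /\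
    (leb (D `&` [set u | (s < `|f u|)%R]) <= t%:E)%E]].

(* Elements of E are functions on (0,1) modulo a.e. equality; they are
   represented by functions R -> R whose values outside (0,1) are irrelevant
   (invariance of E and of its norm under a.e. modifications on (0,1) is a
   consequence of [sb_symmetric]). As usual, E is not the zero space. *)
Record symmetric_banach (E : set (R -> R)) (nE : (R -> R) -> R) : Prop := {
  sb_measurable : forall f, E f -> measurable_fun unit_itv f ;
  sb_zero : E (fun=> 0) ;
  sb_lin : forall a f g, E f -> E g -> E (fun u => a * f u + g u) ;
  sb_ge0 : forall f, E f -> 0 <= nE f ;
  sb_definite : forall f, E f -> nE f = 0 ->
    {ae leb, forall u, unit_itv u -> f u = 0} ;
  sb_scale : forall a f, E f -> nE (fun u => a * f u) = `|a| * nE f ;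
  sb_triangle : forall f g, E f -> E g ->
    nE (fun u => f u + g u) <= nE f + nE g ;
  sb_complete : forall F : nat -> R -> R, (forall n, E (F n)) ->
    (forall e, 0 < e -> exists N, forall m n, (N <= m)%N -> (N <= n)%N ->
      nE (fun u => F m u - F n u) < e) ->
    exists2 f, E f & (fun n => nE (fun u => F n u - f u)) @ \oo --> (0 : R) ;
  sb_symmetric : forall f g, E g -> measurable_fun unit_itv f ->
    (forall t, 0 < t -> (rearr unit_itv f t <= rearr unit_itv g t)%E) ->
    E f /\ nE f <= nE g ;
  sb_nonzero : exists2 f, E f & nE f != 0 }.

Definition separable_space (E : set (R -> R)) (nE : (R -> R) -> R) : Prop :=
  exists2 F : nat -> R -> R, (forall n, E (F n)) &
    forall f, E f -> forall e, 0 < e ->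
      exists n, nE (fun u => f u - F n u) < e.

(* The norm of E, extended by +oo outside of E. *)
Definition ext_norm (E : set (R -> R)) (nE : (R -> R) -> R) f : \bar R :=
  if `[< E f >] then (nE f)%:E else +oo%E.

Definition Lp_norm D (p : \bar R) f : \bar R := 'N[leb]_p [EFin \o (f \_ D)]%E.

Definition L2_unit : set (R -> R) :=
  [set f | measurable_fun unit_itv f /\ (Lp_norm unit_itv 2%:E f < +oo)%E].

Definition sum_decomposition f g h : Prop :=
  [/\ measurable_fun half_line g, measurable_fun half_line h &
      forall u, half_line u -> f u = g u + h u].

Definition in_L1_plus_Linfty f : Prop := exists g h,
  [/\ sum_decomposition f g h, (Lp_norm half_line 1 g < +oo)%E &
      (Lp_norm half_line +oo h < +oo)%E].

Definition L1_plus_L2_norm f : \bar R :=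
  ereal_inf [set r : \bar R | exists g h, sum_decomposition f g h /\
    r = (Lp_norm half_line 1 g + Lp_norm half_line 2%:E h)%E].

(* The norm of Z_E^2, extended by +oo outside of the space. *)
Definition Z2_norm (E : set (R -> R)) (nE : (R -> R) -> R) f : \bar R :=
  if `[< measurable_fun half_line f /\ in_L1_plus_Linfty f >]
  then (ext_norm E nE (fine \o rearr half_line f) + L1_plus_L2_norm f)%E
  else +oo%E.

End FunctionSpaces.

(** * Operators on an inner product space *)

(* Inner products are linear in the first argument. Completeness is a separate
   predicate. Bounded operators are functions H -> H; unbounded operators
   are given by their graphs, which are subsets of H * H. *)

Section Operators.
Variables (R : realType) (H : lmodType R[i]) (ip : {dot H for @conjc R}).
Local Notation leb := (@lebesgue_measure R).
Implicit Types (S T U P : H -> H) (x y a : set (H * H)) (M : set (H -> H)).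

Definition sqnorm (u : H) : R := complex.Re (ip u u).
Definition hnorm (u : H) : R := Num.sqrt (sqnorm u).

Definition hilbert : Prop := forall u : nat -> H,
  (forall e, 0 < e -> exists N, forall m n, (N <= m)%N -> (N <= n)%N ->
    hnorm (u m - u n) < e) ->
  exists l, (fun n => hnorm (u n - l)) @ \oo --> (0 : R).

Definition bounded_op T : Prop :=
  (forall c u v, T (c *: u + v) = c *: T u + T v) /\
  exists K : R, forall u, hnorm (T u) <= K * hnorm u.

Definition adjoint S T : Prop := forall u v, ip (S u) v = ip u (T v).
Definition op_le S T : Prop := forall u, ip (S u) u <= ip (T u) u.
Definition op_pos T : Prop := forall u, 0 <= ip (T u) u.
Definition projection P : Prop := [/\ bounded_op P, adjoint P P & P \o P = P].

Definition commutant M : set (H -> H) :=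
  [set S | bounded_op S /\ forall T, M T -> S \o T = T \o S].

Record von_neumann M : Prop := {
  vn_bounded : forall T, M T -> bounded_op T ;
  vn_star : forall T, M T -> exists2 S, M S & adjoint T S ;
  vn_bicommutant : commutant (commutant M) = M }.

Definition pos_part M : set (H -> H) := [set T | M T /\ op_pos T].

Definition directed (D : set (H -> H)) : Prop :=
  D !=set0 /\ forall S T, D S -> D T -> exists U, [/\ D U, op_le S U & op_le T U].

Definition op_sup M (D : set (H -> H)) S : Prop :=
  [/\ pos_part M S, (forall T, D T -> op_le T S) &
      forall S', pos_part M S' -> (forall T, D T -> op_le T S') -> op_le S S'].

Record trace_state M (tau : (H -> H) -> R[i]) : Prop := {
  tr_linear : forall c S T, M S -> M T ->
    tau (fun u => c *: S u + T u) = c * tau S + tau T ;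
  tr_pos : forall T, pos_part M T -> 0 <= tau T ;
  tr_tracial : forall S T, M S -> M T -> tau (S \o T) = tau (T \o S) ;
  tr_faithful : forall T, pos_part M T -> tau T = 0 -> T = (fun=> 0) ;
  tr_normal : forall D S, D `<=` pos_part M -> directed D -> op_sup M D S ->
    (complex.Re (tau S))%:E =
      ereal_sup [set (complex.Re (tau T))%:E | T in D] ;
  tr_unit : tau id = 1 }.

(* The trace as a [0,oo]-valued weight on the positive operators. *)
Definition trace_weight (tau : (H -> H) -> R[i]) T : \bar R :=
  (complex.Re (tau T))%:E.

(* Trace preserving conditional expectation of M onto N; only the values of
   Ex on M matter. *)
Record cond_exp M (tau : (H -> H) -> R[i]) (N : set (H -> H))
    (Ex : (H -> H) -> H -> H) : Prop := {
  ce_in : forall T, M T -> N (Ex T) ;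
  ce_linear : forall c S T, M S -> M T ->
    Ex (fun u => c *: S u + T u) = (fun u => c *: Ex S u + Ex T u) ;
  ce_pos : forall T, pos_part M T -> op_pos (Ex T) ;
  ce_id : forall T, N T -> Ex T = T ;
  ce_bimodule : forall A T B, N A -> M T -> N B ->
    Ex (A \o T \o B) = A \o Ex T \o B ;
  ce_trace : forall T, M T -> tau (Ex T) = tau T }.

Definition graph T : set (H * H) := [set p | p.2 = T p.1].
Definition gdom x : set H := [set u | exists v, x (u, v)].
Definition gclosure x : set (H * H) := [set p | forall e : R, 0 < e ->
  exists q, [/\ x q, hnorm (p.1 - q.1) < e & hnorm (p.2 - q.2) < e]].
Definition gadj x : set (H * H) :=
  [set p | forall q, x q -> ip q.2 p.1 = ip q.1 p.2].
Definition gcomp y x : set (H * H) :=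
  [set p | exists2 w, x (p.1, w) & y (w, p.2)].

Record closed_densely_defined x : Prop := {
  cdd_zero : x (0, 0) ;
  cdd_lin : forall c p q, x p -> x q ->
    x (c *: p.1 + q.1, c *: p.2 + q.2) ;
  cdd_functional : forall v, x (0, v) -> v = 0 ;
  cdd_closed : gclosure x `<=` x ;
  cdd_dense : forall u (e : R), 0 < e ->
    exists2 v, gdom x v & hnorm (u - v) < e }.

Definition affiliated M x : Prop :=
  forall U, commutant M U -> forall p, x p -> x (U p.1, U p.2).

(* a = |x|, the positive self-adjoint square root of x^* x. *)
Definition is_abs x a : Prop :=
  [/\ closed_densely_defined a, gadj a = a,
      (forall p, a p -> 0 <= ip p.2 p.1) &
      gcomp a a = gcomp (gadj x) x].

(* Pr is the spectral measure of the self-adjoint operator a: it is a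
   projection-valued measure and a is the integral of l against dPr(l);
   m xi is the scalar measure A |-> <Pr(A) xi, xi>. *)
Record spectral_measure a (Pr : set R -> H -> H)
    (m : H -> {measure set (measurableTypeR R) -> \bar R}) : Prop := {
  sm_projection : forall A : set (measurableTypeR R), measurable A ->
    projection (Pr A) ;
  sm_setT : Pr setT = id ;
  sm_setI : forall A B : set (measurableTypeR R), measurable A ->
    measurable B -> Pr (A `&` B) = Pr A \o Pr B ;
  sm_scalar : forall xi (A : set (measurableTypeR R)), measurable A ->
    m xi A = (complex.Re (ip (Pr A xi) xi))%:E ;
  sm_domain : forall xi,
    gdom a xi <-> (\int[m xi]_l ((l : R) ^+ 2)%:E < +oo)%E ;
  sm_form : forall xi eta, a (xi, eta) ->
    ip eta xi = (\int[m xi]_l (l : R))%:C }.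

(* P is the spectral projection e_(s,oo)(|x|). *)
Definition abs_spectral_proj x (s : R) P : Prop := exists a Pr m,
  [/\ is_abs x a, @spectral_measure a Pr m & P = Pr [set` `]s, +oo[]].

Section Weight.
Variables (N : set (H -> H)) (nu : (H -> H) -> \bar R).

Definition sing_val x (t : R) : \bar R :=
  ereal_inf [set s%:E | s in [set s : R | 0 < s /\
    exists2 P, abs_spectral_proj x s P & (nu P <= t%:E)%E]].

(* nu-measurable operators *)
Definition L0_op x : Prop :=
  [/\ closed_densely_defined x, affiliated N x &
      exists s P, [/\ 0 < s, abs_spectral_proj x s P & (nu P < +oo)%E]].

(* The norm of F(N), where nF is the norm of the function space F, extended
   by +oo outside of F. *)
Definition op_norm (nF : (R -> R) -> \bar R) x : \bar R :=
  if `[< L0_op x >] then nF (fine \o sing_val x) else +oo%E.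

Definition L1_opnorm x : \bar R :=
  (\int[leb]_(t in `]0%R, +oo[) sing_val x t)%E.
Definition L1_op x : Prop := L0_op x /\ (L1_opnorm x < +oo)%E.

(* Strong sum and difference, i.e. closures of the algebraic ones. *)
Definition gadd x y : set (H * H) := gclosure
  [set p | exists v w, [/\ x (p.1, v), y (p.1, w) & p.2 = v + w]].
Definition gsub x y : set (H * H) := gclosure
  [set p | exists v w, [/\ x (p.1, v), y (p.1, w) & p.2 = v - w]].

Fixpoint partial_sum (X : nat -> set (H * H)) (n : nat) : set (H * H) :=
  if n is n'.+1 then gadd (partial_sum X n') (X n') else graph (fun=> 0).

Definition L1_cvg (X : nat -> set (H * H)) x : Prop :=
  (fun n => L1_opnorm (gsub (X n) x)) @ \oo --> (0 : \bar R)%E.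

(* y = Ex(x) for the extension of Ex to L_1 by continuity. *)
Definition cond_exp_L1 (Ex : (H -> H) -> H -> H) x y : Prop :=
  exists T : nat -> H -> H, [/\ forall n, N (T n),
    L1_cvg (fun n => graph (T n)) x & L1_cvg (fun n => graph (Ex (T n))) y].

End Weight.
End Operators.

(** * The l_2-direct sum of countably many copies of H *)

Section L2Sum.
Variables (R : realType) (H : lmodType R[i]) (ip : {dot H for @conjc R}).
Implicit Types f g : nat -> H.

(* The sum over k of <f k, g k>; real and imaginary parts are summed
   separately because R[i] carries no canonical topology. *)
Definition series_dot f g : R[i] :=
  limn (series (fun k => complex.Re (ip (f k) (g k)))) +i*
  limn (series (fun k => complex.Im (ip (f k) (g k)))).

Lemma sqnorm_ge0 (u : H) : 0 <= sqnorm ip u.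
Proof.
rewrite /sqnorm; have [->|u0] := eqVneq u 0.
  by rewrite linear0l.
by have := neq0_dnorm_gt0 (s := ip) u u0; rewrite ltcE => /andP[_ /ltW].
Qed.

Lemma dotC (u v : H) : ip v u = (ip u v)^*.
Proof. by rewrite [LHS]hermitian_subproof expr0 mul1r. Qed.

Lemma dotZr (c : R[i]) (u v : H) : ip u (c *: v) = c^* * ip u v.
Proof. by rewrite linearZr. Qed.

Lemma sqnormD (u v : H) :
  sqnorm ip (u + v) = sqnorm ip u + sqnorm ip v + complex.Re (ip u v) *+ 2.
Proof.
rewrite /sqnorm linearDl /= !linearDr /= (dotC u v).
case: (ip u u) => ? ?; case: (ip u v) => ? ?; case: (ip v v) => ? ? /=.
by ring.
Qed.

Lemma sqnormZ (c : R[i]) (u : H) :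
  sqnorm ip (c *: u) = (complex.Re c ^+ 2 + complex.Im c ^+ 2) * sqnorm ip u.
Proof.
rewrite /sqnorm linearZl_LR /= dotZr.
have := dotC u u; case: (ip u u) => x y [yN]; case: c => a b /=.
have -> : y = 0 by lra.
by ring.
Qed.

Lemma normRe_dot (u v : H) :
  `|complex.Re (ip u v)| <= sqnorm ip u + sqnorm ip v.
Proof.
have := sqnormD u v; have := sqnormD u (- v).
have -> : sqnorm ip (- v) = sqnorm ip v.
  by rewrite -scaleN1r sqnormZ /=; ring.
have -> : complex.Re (ip u (- v)) = - complex.Re (ip u v).
  by rewrite -scaleN1r dotZr; case: (ip u v) => x y /=; ring.
have := sqnorm_ge0 (u + v); have := sqnorm_ge0 (u - v).
have := sqnorm_ge0 u; have := sqnorm_ge0 v.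
rewrite ler_norml => ? ? ? ? ? ?; apply/andP; split; lra.
Qed.


Definition sqsum : {pred nat -> H} :=
  fun f => `[< cvgn (series (fun k => sqnorm ip (f k))) >].

Lemma cvg_series_Re f g : f \in sqsum -> g \in sqsum ->
  cvgn (series (fun k => complex.Re (ip (f k) (g k)))).
Proof.
move=> /asboolP sf /asboolP sg; apply: normed_cvg.
apply: (@series_le_cvg _ _ (fun k => sqnorm ip (f k) + sqnorm ip (g k))) => //=.
- by move=> n; rewrite addr_ge0 ?sqnorm_ge0.
- by move=> n; exact: normRe_dot.
- exact: (is_cvg_seriesD sf sg).
Qed.

Lemma sqsumZ (c : R[i]) f : f \in sqsum -> c *: f \in sqsum.
Proof.
move=> /asboolP sf; apply/asboolP.
have -> : (fun k => sqnorm ip ((c *: f) k)) =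
    (complex.Re c ^+ 2 + complex.Im c ^+ 2) *: (fun k => sqnorm ip (f k)).
  by apply/funext => k; rewrite sqnormZ.
exact: is_cvg_seriesZ.
Qed.

Lemma sqsum_submod : submod_closed sqsum.
Proof.
split=> [|c f g /(sqsumZ c) sf sg]; apply/asboolP.
  have -> : (fun k => sqnorm ip ((0 : nat -> H) k)) = (fun=> 0).
    by apply/funext => k; rewrite /sqnorm linear0l.
  have -> : series (fun=> 0 : R) = (fun=> 0).
    by apply/funext => n; rewrite /series /= big1.
  exact: is_cvg_cst.
have cfg := cvg_series_Re sf sg.
move/asboolP in sf; move/asboolP in sg.
have -> : (fun k => sqnorm ip ((c *: f + g) k)) =
    (fun k => sqnorm ip ((c *: f) k)) + (fun k => sqnorm ip (g k)) +
    ((fun k => complex.Re (ip ((c *: f) k) (g k))) +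
     (fun k => complex.Re (ip ((c *: f) k) (g k)))).
  by apply/funext => k; rewrite sqnormD mulr2n.
by apply: is_cvg_seriesD; apply: is_cvg_seriesD.
Qed.

HB.instance Definition _ := GRing.isSubmodClosed.Build _ _ sqsum
  (GRing.submod_closed_semi sqsum_submod).

Record l2sum := L2sum { l2_val :> nat -> H ; _ : l2_val \in sqsum }.

HB.instance Definition _ := [isSub for l2_val].
HB.instance Definition _ := [Choice of l2sum by <:].
HB.instance Definition _ := [SubChoice_isSubLmodule of l2sum by <:].

Definition l2_dot (f g : l2sum) : R[i] := series_dot f g.

Lemma cvg_series_Im (f g : l2sum) :
  cvgn (series (fun k => complex.Im (ip (f k) (g k)))).
Proof.
have -> : (fun k => complex.Im (ip (f k) (g k))) =
    (fun k => complex.Re (ip (f k) ((('i : R[i]) *: g : l2sum) k))).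
  apply/funext => k; rewrite /= dotZr; case: (ip _ _) => x y /=; ring.
by apply: cvg_series_Re; exact: valP.
Qed.

Lemma l2_dotC (f g : l2sum) : l2_dot f g = (l2_dot g f)^*.
Proof.
rewrite /l2_dot /series_dot /=; congr (_ +i* _).
  by congr (limn (series _)); apply/funext => k; rewrite dotC; case: (ip _ _).
rewrite -lim_seriesN; last exact: cvg_series_Im.
congr (limn (series _)); apply/funext => k; rewrite dotC.
by rewrite -[RHS]/(- complex.Im (ip (g k) (f k))); case: (ip _ _).
Qed.

Lemma lim_series_comb (a b : R) (u v w : nat -> R) :
  cvgn (series u) -> cvgn (series v) -> cvgn (series w) ->
  limn (series (a *: u + b *: v + w)) =
  a * limn (series u) + b * limn (series v) + limn (series w).
Proof.
move=> cu cv cw.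
have cau : cvgn (series (a *: u)) by exact: is_cvg_seriesZ.
have cbv : cvgn (series (b *: v)) by exact: is_cvg_seriesZ.
have cuv : cvgn (series (a *: u + b *: v)) by exact: is_cvg_seriesD.
by rewrite (lim_seriesD cuv cw) (lim_seriesD cau cbv) !lim_seriesZ.
Qed.

Lemma l2_dotP (c : R[i]) (f f' g : l2sum) :
  l2_dot (c *: f + f') g = c * l2_dot f g + l2_dot f' g.
Proof.
have cR h : cvgn (series (fun k => complex.Re (ip ((h : l2sum) k) (g k)))).
  by apply: cvg_series_Re; exact: valP.
have cI h : cvgn (series (fun k => complex.Im (ip ((h : l2sum) k) (g k)))).
  exact: cvg_series_Im.
rewrite /l2_dot /series_dot; case: c => a b.
have -> : (fun k => complex.Re (ip (((a +i* b) *: f + f' : l2sum) k) (g k))) =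
    a *: (fun k => complex.Re (ip (f k) (g k)))
    - b *: (fun k => complex.Im (ip (f k) (g k)))
    + (fun k => complex.Re (ip (f' k) (g k))).
  apply/funext => k; rewrite /= linearDl linearZl_LR /=.
  rewrite -[RHS]/(a * complex.Re (ip (f k) (g k)) -
    b * complex.Im (ip (f k) (g k)) + complex.Re (ip (f' k) (g k))).
  by case: (ip (f k) _) => ? ?; case: (ip (f' k) _).
have -> : (fun k => complex.Im (ip (((a +i* b) *: f + f' : l2sum) k) (g k))) =
    a *: (fun k => complex.Im (ip (f k) (g k)))
    + b *: (fun k => complex.Re (ip (f k) (g k)))
    + (fun k => complex.Im (ip (f' k) (g k))).
  apply/funext => k; rewrite /= linearDl linearZl_LR /=.
  rewrite -[RHS]/(a * complex.Im (ip (f k) (g k)) +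
    b * complex.Re (ip (f k) (g k)) + complex.Im (ip (f' k) (g k))).
  by case: (ip (f k) _) => ? ?; case: (ip (f' k) _).
by rewrite -scaleNr !lim_series_comb //= mulNr.
Qed.

Lemma l2_dot_gt0 (f : l2sum) : f != 0 -> 0 < l2_dot f f.
Proof.
move=> f0; have /asboolP sf := valP f.
have [k fk0] : exists k, l2_val f k != 0.
  apply: contrapT => /forallNP h; move/negP: f0; apply; apply/eqP/val_inj.
  by apply/funext => k; have /negP := h k; rewrite negbK => /eqP.
have fk : 0 < sqnorm ip (f k).
  by have := neq0_dnorm_gt0 (s := ip) _ fk0; rewrite ltcE => /andP[].
rewrite /l2_dot /series_dot ltcE /=; apply/andP; split.
  have -> : (fun j => complex.Im (ip (f j) (f j))) = (fun=> 0).
    apply/funext => j; have := dotC (f j) (f j).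
    by case: (ip _ _) => x y [] /= yN; lra.
  have -> : series (fun=> 0 : R) = (fun=> 0).
    by apply/funext => n; rewrite /series /= big1.
  by rewrite lim_cst.
apply: (lt_le_trans fk).
have ndec : {homo series (fun j => sqnorm ip (f j)) : n m / (n <= m)%N >-> n <= m}.
  by apply: nondecreasing_series => j _ _; exact: sqnorm_ge0.
apply: le_trans (nondecreasing_cvgn_le ndec sf k.+1).
rewrite /series /= big_nat_recr //= lerDr.
by apply: sumr_ge0 => j _; exact: sqnorm_ge0.
Qed.

Lemma l2_dotBl (g : l2sum) : zmod_morphism (l2_dot^~ g).
Proof.
move=> f f'; have := l2_dotP (-1) f' f g.
by rewrite scaleN1r mulN1r addrC => ->; rewrite addrC.
Qed.

Lemma l2_dotZl (g : l2sum) : scalable_for *%R (l2_dot^~ g).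
Proof.
move=> c f; have := l2_dotBl g 0 0; rewrite /= !subrr => l2_dot0.
by have := l2_dotP c f 0 g; rewrite addr0 l2_dot0 addr0.
Qed.

Lemma l2_dotBr (f : l2sum) : zmod_morphism (l2_dot f).
Proof.
move=> g g'; rewrite (l2_dotC f (g - g')) (l2_dotBl f g g').
by rewrite (l2_dotC f g) (l2_dotC f g') -rmorphB.
Qed.

Lemma l2_dotZr (f : l2sum) : scalable_for (@conjc R \; *%R) (l2_dot f).
Proof.
move=> c g; rewrite (l2_dotC f (c *: g)) (l2_dotZl f c g) /=.
by rewrite (l2_dotC f g) -rmorphM.
Qed.

Lemma l2_dot_hermitian (f g : l2sum) :
  l2_dot f g = (-1) ^+ false * (l2_dot g f)^*.
Proof. by rewrite expr0 mul1r; exact: l2_dotC. Qed.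

HB.instance Definition _ := @isBilinear.Build R[i] l2sum l2sum R[i]
  *%R (@conjc R \; *%R) l2_dot l2_dotBl l2_dotBr l2_dotZl l2_dotZr.
HB.instance Definition _ := @isHermitianSesquilinear.Build R[i] l2sum false
  (@conjc R) l2_dot l2_dot_hermitian.
HB.instance Definition _ := @isDotProduct.Build R[i] l2sum l2_dot l2_dot_gt0.

Definition l2_ip : {dot l2sum for @conjc R} := l2_dot.

Lemma sqsum_single (k : nat) (u : H) :
  (fun j => if j == k then u else 0) \in sqsum.
Proof.
apply/asboolP; apply/cvg_ex; exists (sqnorm ip u).
apply: cvg_near_cst; near=> n.
have kn : (k < n)%N by near: n; exact: nbhs_infty_gt.
rewrite /series /= big_mkord (bigD1 (Ordinal kn)) //= eqxx big1 ?addr0 //.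
move=> j; rewrite -val_eqE /= => /negPf ->.
by rewrite /sqnorm linear0l.
Unshelve. all: by end_near. Qed.

Definition l2_single (k : nat) (u : H) : l2sum := L2sum (sqsum_single k u).

(* M (x) l_oo, acting on the l_2-sum as the l_oo-direct sum of copies of M. *)
Definition tensor_linf (M : set (H -> H)) : set (l2sum -> l2sum) :=
  [set y | bounded_op l2_ip y /\ exists2 T : nat -> H -> H,
    (forall k, M (T k)) & forall (f : l2sum) k, y f k = T k (f k)].

(* tau (x) #: the sum over k of tau of the k-th diagonal block. *)
Definition tensor_weight (tau : (H -> H) -> R[i]) (y : l2sum -> l2sum) :
    \bar R :=
  (\sum_(0 <= k <oo) trace_weight tau (fun u => y (l2_single k u) k))%E.

(* The sum over k of x_k (x) e_k. *)
Definition direct_sum_op (x : nat -> set (H * H)) : set (l2sum * l2sum) :=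
  [set p : l2sum * l2sum | forall k, x k (p.1 k, p.2 k)].

End L2Sum.

Arguments tensor_linf {R H} ip M.
Arguments tensor_weight {R H} ip tau y.
Arguments direct_sum_op {R H} ip x.

(** * Filtrations and martingale differences *)

Section Martingales.
Variables (R : realType) (H : lmodType R[i]) (ip : {dot H for @conjc R}).
Implicit Types (M B : set (H -> H)) (Mk : nat -> set (H -> H)).

(* Weak-star (sigma-weak) density of B in M: the weak-star continuous
   functionals on M are T |-> sum_k <T (xi k), eta k>, with xi and eta
   square summable. *)
Definition weak_star_dense M B : Prop :=
  forall S, M S -> forall n (xi eta : 'I_n -> l2sum ip) (e : R), 0 < e ->
    exists2 T, B T & forall j : 'I_n,
      `|series_dot ip (fun k => S (xi j k) - T (xi j k)) (eta j)| < e%:C.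

Record filtration M Mk : Prop := {
  fl_vn : forall k, von_neumann ip (Mk k) ;
  fl_sub : forall k, Mk k `<=` M ;
  fl_incr : forall k, Mk k `<=` Mk k.+1 ;
  fl_dense : weak_star_dense M (\bigcup_k Mk k) }.

(* Ex k is the conditional expectation onto Mk k. *)
Definition martingale_differences M (tau : (H -> H) -> R[i]) Mk
    (Ex : nat -> (H -> H) -> H -> H) (x : nat -> set (H * H)) : Prop :=
  (forall k, L1_op ip (Mk k) (trace_weight tau) (x k)) /\
  (forall k, cond_exp_L1 ip M (trace_weight tau) (Ex k) (x k.+1)
     (graph (fun=> 0))).

Definition is_L1_sum M (tau : (H -> H) -> R[i]) (x : nat -> set (H * H))
    (S : set (H * H)) : Prop :=
  L1_op ip M (trace_weight tau) S /\
  L1_cvg ip (trace_weight tau) (partial_sum ip x) S.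

End Martingales.

(* Main.v *)
Require Import Defs.
From HB Require Import structures.
From mathcomp Require Import all_boot all_order all_algebra all_fingroup.
From mathcomp Require Import all_classical all_reals all_analysis.
From mathcomp Require Import measurable_realfun.
From mathcomp Require Import sesquilinear complex ring lra.

Set Implicit Arguments.
Unset Strict Implicit.
Unset Printing Implicit Defensive.

Import Order.TTheory GRing.Theory Num.Theory.
Import numFieldNormedType.Exports.

Local Open Scope classical_set_scope.
Local Open Scope ring_scope.

(** The hypothesis is tested on rank one matrices. In the algebra of matrices of
    size [n + 1] with the normalized trace, let x_k = a_k e_(k, c k), where the
    column [c k] is smaller than [k]. For the filtration whose k-th algebra has a
    full block on the first [k + 1] coordinates and is diagonal elsewhere, this is
    a sequence of martingale differences whatever the columns are
    ([corner_filtration], [corner_cond_exp], [row_op_martingale]). The direct sum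
    of the x_k does not see the columns: two choices of c give direct sums that
    differ by a self-adjoint unitary of the tensor product algebra, so they have
    the same norm in every space of operators ([op_norm_direct_sum]). The
    hypothesis therefore makes the norms in E of the two sums comparable, with
    constants that depend neither on n nor on a ([column_exchange]).

    If all the columns are equal, the sum has a single nonzero singular value,
    the Euclidean norm of a; if [c k = k - 1], the singular values of the sum are
    the numbers |a_k| ([col_norm_first], [col_norm_prev]). Let f be the step
    function with values |a_k| on n intervals of length 1 / (n + 1), and phi(n)
    the norm in E of the indicator of one such interval. Then the norm of f is
    comparable with phi(n) times the Euclidean norm of a. The choice a = 1 shows
    that phi(n) is comparable with the inverse of the square root of n, so the
    norms of f in E and in L_2 are comparable ([step_L2]).

    Any simple function is caught between step functions of this kind in
    distribution, by repeating its values according to the measure of its level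
    sets ([simple_lower], [simple_upper]). For f in E, the simple functions below
    the square of f have bounded integrals, so f is in L_2
    ([square_integral_le]). For f in L_2, square roots of simple functions
    increasing to the square of f form a Cauchy sequence in E, and Fatou's lemma
    identifies the modulus of f with its limit ([square_integrable_in_E]).

    Singular values are defined through spectral projections of an absolute
    value for which no uniqueness is known beforehand. Explicit diagonal
    projections bound them from above; from below they are bounded by the fact
    that every spectral projection fixes the eigenvectors it has to fix
    ([spectral_proj_eigvec], [nu_spectral_proj_ge]). *)

(** * Inner products, graphs and commutants *)

Section InnerProduct.
Local Open Scope complex_scope.
Variables (R : realType) (H : lmodType R[i]) (ip : {dot H for @conjc R}).
Implicit Types (S T U : H -> H) (u v w : H).

Lemma ipDl u v w : ip (u + v) w = ip u w + ip v w.
Proof. exact: linearDl. Qed.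

Lemma ipDr u v w : ip u (v + w) = ip u v + ip u w.
Proof. exact: linearDr. Qed.

Lemma ipZl c u v : ip (c *: u) v = c * ip u v.
Proof. exact: linearZl_LR. Qed.

Lemma ip0l u : ip 0 u = 0.
Proof. exact: linear0l. Qed.

Lemma ip0r u : ip u 0 = 0.
Proof. exact: linear0r. Qed.

Lemma ipNl u v : ip (- u) v = - ip u v.
Proof. exact: linearNl. Qed.

Lemma ipNr u v : ip u (- v) = - ip u v.
Proof. exact: linearNr. Qed.

Lemma ip_sqnorm u : ip u u = (sqnorm ip u)%:C.
Proof.
rewrite /sqnorm; have := dotC ip u u; case: (ip u u) => a b [] /= b0.
by congr (_ +i* _); lra.
Qed.

Lemma ip_self_eq0 u : ip u u = 0 -> u = 0.
Proof.
move=> uu; apply: contra_eq uu => u0.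
by rewrite gt_eqF // (neq0_dnorm_gt0 (s := ip)).
Qed.

Lemma sqnorm_eq0 u : sqnorm ip u = 0 -> u = 0.
Proof. by move=> u0; apply: ip_self_eq0; rewrite ip_sqnorm u0. Qed.

Lemma ip_inj u v : (forall w, ip u w = ip v w) -> u = v.
Proof.
move=> uv; apply/eqP; rewrite -subr_eq0; apply/eqP/ip_self_eq0.
by rewrite ipDl ipNl uv subrr.
Qed.

Lemma sqnorm0 : sqnorm ip 0 = 0.
Proof. by rewrite /sqnorm ip0l. Qed.

Lemma sqnormN u : sqnorm ip (- u) = sqnorm ip u.
Proof. by rewrite /sqnorm ipNl ipNr opprK. Qed.

Lemma sqnormD_le u v : sqnorm ip (u + v) <= 2 * (sqnorm ip u + sqnorm ip v).
Proof.
have := sqnorm_ge0 ip (u - v); rewrite !sqnormD sqnormN ipNr.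
by case: (ip u v) => a b /=; lra.
Qed.

Lemma hnorm_lt u (e : R) : 0 < e -> (hnorm ip u < e) = (sqnorm ip u < e ^+ 2).
Proof.
move=> e0; rewrite /hnorm -[in RHS](sqr_sqrtr (sqnorm_ge0 ip u)).
by rewrite ltr_pXn2r // nnegrE ?sqrtr_ge0 // ltW.
Qed.

Lemma hnorm0 : hnorm ip 0 = 0.
Proof. by rewrite /hnorm sqnorm0 sqrtr0. Qed.

Definition is_lin T := forall c u v, T (c *: u + v) = c *: T u + T v.

Lemma is_lin0 T : is_lin T -> T 0 = 0.
Proof.
move=> lT; have := lT (-1) 0 0; rewrite scaler0 addr0 scaleN1r.
by rewrite addNr.
Qed.

Lemma is_linD T u v : is_lin T -> T (u + v) = T u + T v.
Proof. by move=> lT; have := lT 1 u v; rewrite !scale1r. Qed.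

Lemma is_linZ T c u : is_lin T -> T (c *: u) = c *: T u.
Proof. by move=> lT; have := lT c u 0; rewrite (is_lin0 lT) !addr0. Qed.

Lemma is_linN T u : is_lin T -> T (- u) = - T u.
Proof. by move=> lT; rewrite -scaleN1r is_linZ // scaleN1r. Qed.

Lemma is_linB T u v : is_lin T -> T (u - v) = T u - T v.
Proof. by move=> lT; rewrite is_linD // is_linN. Qed.

Lemma bounded_opP T : bounded_op ip T <-> is_lin T /\
  exists K, 0 <= K /\ forall u, sqnorm ip (T u) <= K * sqnorm ip u.
Proof.
split=> [[lT [K TK]]|[lT [K [K0 TK]]]]; split=> //.
  exists (K ^+ 2); split; first exact: sqr_ge0.
  move=> u; rewrite -(sqr_sqrtr (sqnorm_ge0 ip (T u))).
  rewrite -[X in _ <= _ * X](sqr_sqrtr (sqnorm_ge0 ip u)) -exprMn.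
  have hu : 0 <= hnorm ip (T u) by exact: sqrtr_ge0.
  by apply: lerXn2r; rewrite ?nnegrE ?(le_trans hu (TK u)) // TK.
exists (Num.sqrt K) => u; rewrite /hnorm -sqrtrM //.
by rewrite ler_sqrt // mulr_ge0 // sqnorm_ge0.
Qed.

Lemma bounded_is_lin T : bounded_op ip T -> is_lin T.
Proof. by case. Qed.

Lemma bounded_comp S T : bounded_op ip S -> bounded_op ip T ->
  bounded_op ip (S \o T).
Proof.
move=> /bounded_opP[lS [K [K0 SK]]] /bounded_opP[lT [L [L0 TL]]].
apply/bounded_opP; split; first by move=> c u v /=; rewrite lT lS.
exists (K * L); split; first exact: mulr_ge0.
by move=> u /=; apply: le_trans (SK _) _; rewrite -mulrA ler_wpM2l.
Qed.

Lemma bounded_comb c S T : bounded_op ip S -> bounded_op ip T ->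
  bounded_op ip (fun u => c *: S u + T u).
Proof.
move=> /bounded_opP[lS [K [K0 SK]]] /bounded_opP[lT [L [L0 TL]]].
apply/bounded_opP; split.
  move=> a u v; rewrite lT lS !scalerDr !scalerA (mulrC c) -!addrA.
  by congr (_ + _); rewrite addrCA.
set d := complex.Re c ^+ 2 + complex.Im c ^+ 2.
have d0 : 0 <= d by rewrite addr_ge0 // sqr_ge0.
exists (2 * (d * K + L)); split; first by rewrite mulr_ge0 // addr_ge0 // mulr_ge0.
move=> u; apply: le_trans (sqnormD_le _ _) _; rewrite -mulrA ler_wpM2l //.
by rewrite mulrDl lerD // sqnormZ -mulrA ler_wpM2l.
Qed.

Lemma sub_gclosure (x : set (H * H)) : x `<=` gclosure ip x.
Proof. by move=> p xp e e0; exists p; split=> //; rewrite subrr hnorm0. Qed.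

(** Bounded everywhere defined operators are closed, so strong sums and
    differences of such operators are the algebraic ones. *)
Lemma gclosure_graph T : bounded_op ip T -> gclosure ip (graph T) = graph T.
Proof.
move=> bT; have /bounded_opP[lT [K [K0 TK]]] := bT.
apply/seteqP; split; last exact: sub_gclosure.
move=> [u v] /= cl; rewrite /graph /=.
apply/eqP; rewrite -subr_eq0; apply/eqP/sqnorm_eq0/eqP.
rewrite eq_le sqnorm_ge0 andbT; apply/ler_addgt0Pl => e e0; rewrite addr0.
have K1 : 0 < 2 * (1 + K) by rewrite mulr_gt0 // ltr_wpDr.
pose d := Num.sqrt (e / (2 * (1 + K))).
have d0 : 0 < d by rewrite sqrtr_gt0 divr_gt0.
have [[w t] [/= + + +]] := cl d d0.
rewrite {1}/graph /= => ->; rewrite !hnorm_lt // sqr_sqrtr ?divr_ge0 ?(ltW e0) ?(ltW K1) // => uw vw.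
have -> : v - T u = (v - T w) + T (w - u) by rewrite is_linB // addrA subrK.
apply: le_trans (sqnormD_le _ _) _.
have := TK (w - u); rewrite -(sqnormN (w - u)) opprB => Twu.
have Ke : K * sqnorm ip (u - w) <= K * (e / (2 * (1 + K))).
  by rewrite ler_wpM2l // ltW.
have -> : e = 2 * (e / (2 * (1 + K)) + K * (e / (2 * (1 + K)))).
  by field; rewrite gt_eqF // ltr_wpDr.
by rewrite ler_pM2l // lerD // ?(ltW vw) // (le_trans Twu).
Qed.

Lemma cdd_graph T : bounded_op ip T -> closed_densely_defined ip (graph T).
Proof.
move=> bT; have lT := bounded_is_lin bT; split.
- by rewrite /graph /= is_lin0.
- by move=> c [u v] [u' v']; rewrite /graph /= => -> ->; rewrite lT.
- by move=> v; rewrite /graph /= => ->; rewrite is_lin0.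
- by rewrite gclosure_graph.
- by move=> u e e0; exists u; [exists (T u)|rewrite subrr hnorm0].
Qed.

Lemma gadd_graph S T : bounded_op ip S -> bounded_op ip T ->
  gadd ip (graph S) (graph T) = graph (fun u => S u + T u).
Proof.
move=> bS bT; rewrite -[RHS]gclosure_graph; last first.
  have := bounded_comb 1 bS bT; congr bounded_op.
  by apply/funext => u; rewrite scale1r.
congr (gclosure ip _); apply/seteqP; split=> -[u v].
  by move=> [a [b [+ + +]]]; rewrite /graph /= => -> -> ->.
by rewrite /graph /= => ->; exists (S u), (T u).
Qed.

Lemma gsub_graph S T : bounded_op ip S -> bounded_op ip T ->
  gsub ip (graph S) (graph T) = graph (fun u => S u - T u).
Proof.
move=> bS bT; rewrite -[RHS]gclosure_graph; last first.
  have := bounded_comb (-1) bT bS; congr bounded_op.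
  by apply/funext => u; rewrite scaleN1r addrC.
congr (gclosure ip _); apply/seteqP; split=> -[u v].
  by move=> [a [b [+ + +]]]; rewrite /graph /= => -> -> ->.
by rewrite /graph /= => ->; exists (S u), (T u).
Qed.

Lemma gadj_graph S T : adjoint ip T S -> gadj ip (graph T) = graph S.
Proof.
move=> TS; apply/seteqP; split=> -[u v] /= huv.
  rewrite /graph /=; apply: ip_inj => w.
  have := huv (w, T w) erefl; rewrite /= TS => /esym wv.
  by rewrite (dotC ip w v) wv -dotC.
by move: huv; rewrite /gadj /graph /= => -> [w t] /= ->; rewrite TS.
Qed.

Lemma gcomp_graph S T : gcomp (graph S) (graph T) = graph (S \o T).
Proof.
apply/seteqP; split=> -[u v] /=; first by move=> [w]; rewrite /graph /= => ->.
by rewrite /graph /= => ->; exists (T u).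
Qed.

Lemma commutantP (M : set (H -> H)) T : commutant ip M T <->
  bounded_op ip T /\ forall S, M S -> forall u, T (S u) = S (T u).
Proof.
split=> -[bT cT]; split=> //.
  by move=> S MS u; have := cT S MS => /(congr1 (fun f => f u)).
by move=> S MS; apply/funext => u /=; rewrite cT.
Qed.

Lemma affiliated_graph (M : set (H -> H)) T : M T ->
  affiliated ip M (graph T).
Proof.
by move=> MT U /commutantP[_ cU] [u v]; rewrite /graph /= => ->; rewrite cU.
Qed.

(** The third commutant of a set is always its first one. *)
Lemma von_neumann_commutant (D : set (H -> H)) :
  (forall T, D T -> bounded_op ip T) ->
  (forall T, D T -> adjoint ip T T) ->
  (forall T, bounded_op ip T -> exists2 S, bounded_op ip S & adjoint ip T S) ->
  von_neumann ip (commutant ip D).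
Proof.
move=> bD sD adj; split; first by move=> T [].
- move=> T /commutantP[bT cT]; have [S bS TS] := adj T bT; exists S => //.
  apply/commutantP; split=> // P DP u; apply: ip_inj => w.
  have sw p q : ip (S p) q = ip p (T q) by rewrite dotC -TS -dotC.
  by rewrite sw !(sD _ DP) sw cT.
- apply/seteqP; split=> [T [bT cT]|T /commutantP[bT cT]].
    split=> // P DP; apply: cT; split; first exact: bD.
    by move=> Q [_ cQ]; rewrite cQ.
  apply/commutantP; split=> // Q /commutantP[bQ cQ] u.
  by rewrite cQ //; apply/commutantP.
Qed.

End InnerProduct.

(** * Uniqueness of spectral projections *)

Section SpectralProjection.
Local Open Scope complex_scope.
Variables (R : realType) (H : lmodType R[i]) (ip : {dot H for @conjc R}).
Variables (A : H -> H) (Pr : set R -> H -> H)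
  (m : H -> {measure set (measurableTypeR R) -> \bar R}).
Hypothesis linA : is_lin A.
Hypothesis symA : forall u v, ip (A u) v = ip u (A v).
Hypothesis posA : forall u, 0 <= ip (A u) u.
Hypothesis smA : spectral_measure ip (graph A) Pr m.
Implicit Types (u v w : H) (B C : set (measurableTypeR R)).

Let proj_lin B : measurable B -> is_lin (Pr B).
Proof. by move=> /(sm_projection smA)[[]]. Qed.

Let proj_sym B u v : measurable B -> ip (Pr B u) v = ip u (Pr B v).
Proof. by move=> /(sm_projection smA)[_ ->]. Qed.

Let projI B C u : measurable B -> measurable C ->
  Pr B (Pr C u) = Pr (B `&` C) u.
Proof. by move=> mB mC; rewrite (sm_setI smA). Qed.

Let proj_idem B u : measurable B -> Pr B (Pr B u) = Pr B u.
Proof. by move=> mB; rewrite projI // setIid. Qed.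

Let ip_proj B u : measurable B -> ip (Pr B u) u = (sqnorm ip (Pr B u))%:C.
Proof. by move=> mB; rewrite -ip_sqnorm -proj_sym // proj_idem. Qed.

Let scalarE u B : measurable B -> m u B = (sqnorm ip (Pr B u))%:E.
Proof. by move=> mB; rewrite (sm_scalar smA) // ip_proj. Qed.

Let massE u : m u setT = (sqnorm ip u)%:E.
Proof. by rewrite scalarE ?(sm_setT smA). Qed.

Let proj0 u : Pr set0 u = 0.
Proof.
apply: (@sqnorm_eq0 _ _ ip); have := scalarE u (measurable0).
by rewrite measure0 => /esym[].
Qed.

(** Additivity of the scalar spectral measure at u shows that both sides have
    the same norm and the same scalar product with u. *)
Let projC B u : measurable B -> Pr B u + Pr (~` B) u = u.
Proof.
move=> mB; have mCB := measurableC mB.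
have sq : sqnorm ip u = sqnorm ip (Pr B u) + sqnorm ip (Pr (~` B) u).
  have : m u setT = (m u B + m u (~` B))%E.
    by rewrite -measureU ?setUCr ?setICr.
  by rewrite massE !scalarE // => -[].
have orth : ip (Pr B u) (Pr (~` B) u) = 0.
  by rewrite proj_sym // projI // setICr proj0 ip0r.
set w := _ + _; apply/eqP; rewrite eq_sym -subr_eq0.
apply/eqP/(@sqnorm_eq0 _ _ ip); rewrite sqnormD sqnormN ipNr.
have -> : ip u w = (sqnorm ip u)%:C.
  by rewrite dotC ipDl !ip_proj // sq -rmorphD /= oppr0.
have -> : sqnorm ip w = sqnorm ip u by rewrite sqnormD orth sq /=; ring.
by rewrite /=; ring.
Qed.

Let m_proj B C u : measurable B -> measurable C ->
  m (Pr B u) C = m u (C `&` B).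
Proof. by move=> mB mC; rewrite !scalarE // ?projI //; exact: measurableI. Qed.

Let integrable_fin (k : R) u : (m u).-integrable setT (EFin \o cst k).
Proof.
apply/integrableP; split; first exact/measurable_EFinP.
rewrite (eq_integral (cst `|k|%:E)) // integral_cst //.
by rewrite [X in (_ * X)%E]massE -EFinM ltry.
Qed.

Let integrable_id u : (m u).-integrable setT (EFin \o (fun l : R => l)).
Proof.
have i2 : (m u).-integrable setT (EFin \o (fun l : R => l ^+ 2)).
  apply/integrableP; split.
    by apply/measurable_EFinP; exact: exprn_measurable.
  under eq_integral do rewrite /= ger0_norm ?sqr_ge0 //.
  by apply/(sm_domain smA); exists (A u).
have /(le_integrable measurableT) := integrableD measurableT (integrable_fin 1 u) i2.
apply=> [|l _]; first exact/measurable_EFinP.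
rewrite /= lee_fin [leRHS]ger0_norm ?addr_ge0 ?sqr_ge0 //.
by rewrite ler_norml; apply/andP; split; nra.
Qed.

Let form_sum B u : measurable B ->
  ip (A u) u = ip (A (Pr B u)) (Pr B u) + ip (A (Pr (~` B) u)) (Pr (~` B) u).
Proof.
move=> mB; have mCB := measurableC mB.
rewrite !(@sm_form _ _ _ _ _ _ smA _ (A _)) // -rmorphD; congr (_%:C).
have addE : (\int[m u]_l (l : R)%:E =
    \int[measure_add (m (Pr B u)) (m (Pr (~` B) u))]_l (l : R)%:E)%E.
  apply: eq_measure_integral => C mC _; rewrite [RHS]measure_addE.
  rewrite !m_proj // -measureU; first by rewrite -setIUr setUCr setIT.
  - exact: measurableI.
  - exact: measurableI.
  - by rewrite setIACA setICr setI0.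
rewrite /Rintegral addE integral_measure_add //; try exact: integrable_id.
by rewrite fineD //; apply: integrable_fin_num => //; exact: integrable_id.
Qed.

(** By [form_sum] the quadratic form of [A] has no cross terms between
    complementary spectral subspaces. *)
Let off_diag B u v : measurable B -> ip (A (Pr B u)) (Pr (~` B) v) = 0.
Proof.
move=> mB; have mCB := measurableC mB.
have re0 w : complex.Re (ip (A (Pr B w)) (Pr (~` B) w)) = 0.
  have := form_sum w mB; rewrite -{1 2}(projC w mB) (is_linD _ _ linA).
  rewrite ipDl !ipDr (symA (Pr (~` B) w) (Pr B w)) (dotC ip (A (Pr B w))).
  by case: (ip (A (Pr B w)) _) => x y; case: (ip _ _) => ? ?;
    case: (ip _ _) => ? ? [] /=; lra.
have cross c : complex.Re (ip (A (Pr B u)) (c *: Pr (~` B) v)) = 0.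
  have := re0 (Pr B u + c *: Pr (~` B) v).
  rewrite !(is_linD _ _ (proj_lin _)) // !(is_linZ _ _ (proj_lin _)) //.
  rewrite !proj_idem // !projI // setICr setIC setICr !proj0 scaler0.
  by rewrite addr0 add0r.
have := cross 1; have := cross 'i; rewrite !dotZr.
by case: (ip _ _) => x y /= ? ?; congr (_ +i* _); lra.
Qed.

Let proj_comm B u : measurable B -> Pr B (A u) = A (Pr B u).
Proof.
move=> mB; have mCB := measurableC mB.
rewrite -{1}(projC u mB) (is_linD _ _ linA) (is_linD _ _ (proj_lin mB)).
have -> : Pr B (A (Pr (~` B) u)) = 0.
  apply: (@ip_inj _ _ ip) => w; rewrite ip0l proj_sym //.
  by have := off_diag u w mCB; rewrite setCK.
rewrite addr0 -[RHS](projC _ mB).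
suff -> : Pr (~` B) (A (Pr B u)) = 0 by rewrite addr0.
by apply: (@ip_inj _ _ ip) => w; rewrite ip0l proj_sym // off_diag.
Qed.

Let ray (s : R) : set (measurableTypeR R) := [set` `]s, +oo[].

Let form_le (s : R) w : Pr (ray s) w = 0 ->
  complex.Re (ip (A w) w) <= s * sqnorm ip w.
Proof.
move=> Pw; have mB : measurable (ray s) by exact: measurable_itv.
rewrite (@sm_form _ _ _ _ _ _ smA _ (A _)) //=.
have mw0 : m w (ray s) = 0%E by rewrite scalarE // Pw sqnorm0.
rewrite /Rintegral (negligible_integral mB measurableT (integrable_id w) mw0).
have mD : measurable (setT `\` ray s) by exact: measurableD.
have i1 : (m w).-integrable (setT `\` ray s) (EFin \o (fun l : R => l)).
  exact: (integrableS measurableT mD (@subsetT _ _) (integrable_id w)).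
rewrite -lee_fin fineK; last exact: (integrable_fin_num).
have i2 : (m w).-integrable (setT `\` ray s) (EFin \o cst s).
  exact: (integrableS measurableT mD (@subsetT _ _) (integrable_fin s w)).
apply: le_trans (le_integral mD i1 i2 _) _.
  move=> l; rewrite inE /= => -[_]; rewrite lee_fin /ray /= in_itv /= andbT.
  by move=> /negP; rewrite -leNgt.
have mass : m w (setT `\` ray s) = (sqnorm ip w)%:E.
  by rewrite setTD scalarE; [have := projC w mB; rewrite Pw add0r => ->|exact: measurableC].
have -> : (\int[m w]_(x in setT `\` ray s) (EFin \o cst s) x =
    s%:E * m w (setT `\` ray s))%E by rewrite -(integral_cst _ mD).
by rewrite mass -EFinM.
Qed.

(** An eigenvector of [A ^ 2] for an eigenvalue above [s ^ 2] lies in the range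
    of the spectral projection of [A] for the interval above [s]. With v its
    component in the complementary range, w = A v + d v satisfies A w = d w;
    there the form of [A] is at most s, so w = 0. Then A v = - d v, and v = 0
    because [A] is positive. *)
Lemma spectral_proj_eigvec (s d : R) e : 0 <= s -> s < d ->
  A (A e) = (d ^+ 2)%:C *: e -> Pr [set` `]s, +oo[] e = e.
Proof.
move=> s0 sd Ae; have mB : measurable (ray s) by exact: measurable_itv.
have mCB := measurableC mB.
pose v := Pr (~` ray s) e.
have Pv : Pr (ray s) v = 0 by rewrite /v projI // setICr proj0.
have Av : A (A v) = (d ^+ 2)%:C *: v.
  by rewrite /v -!proj_comm // Ae is_linZ //; exact: proj_lin.
pose w := A v + d%:C *: v.
have Aw : A w = d%:C *: w.
  rewrite /w is_linD // is_linZ // Av scalerDr scalerA -rmorphM /= -expr2.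
  by rewrite addrC.
have Pw : Pr (ray s) w = 0.
  rewrite /w (is_linD _ _ (proj_lin mB)) (is_linZ _ _ (proj_lin mB)).
  by rewrite proj_comm // Pv (is_lin0 linA) scaler0 addr0.
have w0 : w = 0.
  apply: (@sqnorm_eq0 _ _ ip); have := form_le Pw.
  rewrite Aw ipZl ip_sqnorm -rmorphM /=; have := sqnorm_ge0 ip w; nra.
have {}Av : A v = (- d)%:C *: v.
  by rewrite rmorphN scaleNr; apply/eqP; rewrite -addr_eq0; apply/eqP.
have v0 : v = 0.
  apply: (@sqnorm_eq0 _ _ ip); have := posA v.
  rewrite Av ipZl ip_sqnorm -rmorphM lecR /=; have := sqnorm_ge0 ip v; nra.
by have := projC e mB; rewrite -/v -/(ray s) v0 addr0.
Qed.

End SpectralProjection.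

Section ComplexLemmas.
Local Open Scope complex_scope.
Variable R : realType.
Implicit Types z : R[i].

Lemma Re_sum (I : Type) (r : seq I) (P : pred I) (F : I -> R[i]) :
  complex.Re (\sum_(i <- r | P i) F i) = \sum_(i <- r | P i) complex.Re (F i).
Proof. by apply: big_morph => // -[a b] [c d]. Qed.

Definition sqabs z : R := complex.Re z ^+ 2 + complex.Im z ^+ 2.

Lemma sqabs_ge0 z : 0 <= sqabs z.
Proof. by rewrite addr_ge0 // sqr_ge0. Qed.

Lemma mul_conjc z : z * z^* = (sqabs z)%:C.
Proof. by case: z => a b; rewrite /sqabs /=; congr (_ +i* _); ring. Qed.

Lemma sqabs_eq0 z : sqabs z = 0 -> z = 0.
Proof.
case: z => a b /eqP; rewrite /sqabs paddr_eq0 ?sqr_ge0 //= !sqrf_eq0.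
by move=> /andP[/eqP -> /eqP ->].
Qed.

End ComplexLemmas.

(** * The Hilbert space of row vectors *)

Section RowSpace.
Local Open Scope complex_scope.
Variables (R : realType) (n : nat).
Local Notation H := 'rV[R[i]]_n.
Implicit Types (u v w : H) (T S : H -> H).

Definition rv_dot u v : R[i] := \sum_i u 0 i * (v 0 i)^*.

Lemma rv_dotC u v : rv_dot u v = (rv_dot v u)^*.
Proof.
rewrite /rv_dot rmorph_sum; apply: eq_bigr => i _.
by rewrite rmorphM /= conjcK mulrC.
Qed.

Lemma rv_dotBl v : zmod_morphism (rv_dot^~ v).
Proof.
move=> u w; rewrite /rv_dot -sumrB; apply: eq_bigr => i _.
by rewrite !mxE mulrBl.
Qed.

Lemma rv_dotZl v : scalable_for *%R (rv_dot^~ v).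
Proof.
move=> c u; rewrite /rv_dot mulr_sumr; apply: eq_bigr => i _.
by rewrite !mxE mulrA.
Qed.

Lemma rv_dotBr u : zmod_morphism (rv_dot u).
Proof.
move=> v w; rewrite (rv_dotC u (v - w)) (rv_dotBl u v w).
by rewrite (rv_dotC u v) (rv_dotC u w) -rmorphB.
Qed.

Lemma rv_dotZr u : scalable_for (@conjc R \; *%R) (rv_dot u).
Proof.
move=> c v; rewrite (rv_dotC u (c *: v)) (rv_dotZl u c v) /=.
by rewrite (rv_dotC u v) -rmorphM.
Qed.

Lemma rv_dot_hermitian u v : rv_dot u v = (-1) ^+ false * (rv_dot v u)^*.
Proof. by rewrite expr0 mul1r; exact: rv_dotC. Qed.

Lemma rv_dotE u : rv_dot u u = (\sum_i sqabs (u 0 i))%:C.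
Proof. by rewrite rmorph_sum; apply: eq_bigr => i _; rewrite mul_conjc. Qed.

Lemma rv_dot_gt0 u : u != 0 -> 0 < rv_dot u u.
Proof.
move=> u0; rewrite rv_dotE ltcR lt_def sumr_ge0 ?andbT; last first.
  by move=> i _; exact: sqabs_ge0.
apply: contra u0; rewrite psumr_eq0; last by move=> i _; exact: sqabs_ge0.
move=> /allP u0; apply/eqP/rowP => i; rewrite mxE; apply: sqabs_eq0.
by apply/eqP/u0; rewrite mem_index_enum.
Qed.

HB.instance Definition _ := @isBilinear.Build R[i] H H R[i]
  *%R (@conjc R \; *%R) rv_dot rv_dotBl rv_dotBr rv_dotZl rv_dotZr.
HB.instance Definition _ := @isHermitianSesquilinear.Build R[i] H false
  (@conjc R) rv_dot rv_dot_hermitian.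
HB.instance Definition _ := @isDotProduct.Build R[i] H rv_dot rv_dot_gt0.

Definition rv_ip : {dot H for @conjc R} := rv_dot.

Lemma rv_ipE u v : rv_ip u v = \sum_i u 0 i * (v 0 i)^*.
Proof. by []. Qed.

Lemma rv_sqnorm u : sqnorm rv_ip u = \sum_i sqabs (u 0 i).
Proof. by rewrite /sqnorm [rv_ip u u]rv_dotE. Qed.

Local Notation e_ i := (delta_mx 0 i : H).

Lemma rv_ip_delta u i : rv_ip u (e_ i) = u 0 i.
Proof.
rewrite rv_ipE (bigD1 i) //= !mxE !eqxx [X in _ * X]conjc1 mulr1.
rewrite big1 ?addr0 // => j /negPf ji.
by rewrite !mxE ji andbF [X in _ * X]conjc0 mulr0.
Qed.

Lemma sqnorm_comb_le (V : lmodType R[i]) (ip : {dot V for @conjc R})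
    (I : Type) (r : seq I) (w : I -> V) :
  exists2 K : R, 0 <= K & forall c : I -> R[i],
    sqnorm ip (\sum_(i <- r) c i *: w i) <= K * \sum_(i <- r) sqabs (c i).
Proof.
elim: r => [|i r [K K0 IH]].
  by exists 0 => // c; rewrite !big_nil sqnorm0 mul0r.
exists (2 * (sqnorm ip (w i) + K)); first by rewrite mulr_ge0 // addr_ge0 // sqnorm_ge0.
move=> c; rewrite !big_cons; apply: le_trans (sqnormD_le _ _ _) _.
rewrite -mulrA ler_wpM2l //; have := IH c.
rewrite sqnormZ -/(sqabs (c i)).
have := sqnorm_ge0 ip (w i); have := sqabs_ge0 (c i).
have : 0 <= \sum_(j <- r) sqabs (c j) by apply: sumr_ge0 => j _; exact: sqabs_ge0.
nra.
Qed.

Lemma is_lin_sum T u : is_lin T -> T u = \sum_i u 0 i *: T (e_ i).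
Proof.
move=> lT; rewrite {1}[u]row_sum_delta.
elim/big_rec2 : _ => [|i x y _ <-]; first exact: is_lin0.
by rewrite lT.
Qed.

Lemma bounded_rvP T : bounded_op rv_ip T <-> is_lin T.
Proof.
split=> [[]//|lT]; apply/bounded_opP; split=> //.
have [K K0 TK] := sqnorm_comb_le rv_ip (index_enum _) (fun i => T (e_ i)).
exists K; split=> // u; rewrite (is_lin_sum u lT) [in leRHS]rv_sqnorm.
exact: (TK (fun i => u 0 i)).
Qed.

Lemma rv_adjoint T : bounded_op rv_ip T ->
  exists2 S, bounded_op rv_ip S & adjoint rv_ip T S.
Proof.
move=> /bounded_rvP lT.
exists (fun v => \row_i rv_ip v (T (e_ i))).
  by apply/bounded_rvP => c u v; apply/rowP => i; rewrite !mxE ipDl ipZl.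
move=> u v; rewrite [T u]is_lin_sum // !rv_ipE.
transitivity (\sum_i u 0 i * rv_ip (T (e_ i)) v).
  under eq_bigr do rewrite summxE mulr_suml.
  rewrite exchange_big; apply: eq_bigr => i _; rewrite rv_ipE mulr_sumr.
  by apply: eq_bigr => j _; rewrite mxE mulrA.
by apply: eq_bigr => i _; rewrite mxE (dotC rv_ip v).
Qed.

Lemma rv_cauchy_coord (u : nat -> H) (f : R[i] -> R) :
  (forall y z, f (y - z) = f y - f z) ->
  (forall z, f z ^+ 2 <= sqabs z) ->
  (forall e, 0 < e -> exists N, forall p q, (N <= p)%N -> (N <= q)%N ->
    hnorm rv_ip (u p - u q) < e) ->
  forall i, cvgn (fun k => f (u k 0 i)).
Proof.
move=> fB f_le cu i; apply: cauchy_cvg; apply: cauchy_exP => e e0.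
have [N uN] := cu e e0; exists (f (u N 0 i)).
exists N => // k /= Nk; rewrite /ball /= -fB.
have := uN N k (leqnn N) Nk; rewrite hnorm_lt // => lte.
rewrite -ltr_sqr ?nnegrE ?(ltW e0) // real_normK ?num_real //.
apply: le_lt_trans lte; rewrite rv_sqnorm (bigD1 i) //= !mxE.
by apply: le_trans (f_le _) _; rewrite lerDl sumr_ge0 // => j _; exact: sqabs_ge0.
Qed.

Lemma cvg_rsum (I : Type) (r : seq I) (f : I -> nat -> R) (c : I -> R) :
  (forall i, f i @ \oo --> c i) ->
  (fun k => \sum_(i <- r) f i k) @ \oo --> \sum_(i <- r) c i.
Proof.
move=> fc; elim: r => [|i r IH].
  by under eq_fun do rewrite big_nil; rewrite big_nil; exact: cvg_cst.
by under eq_fun do rewrite big_cons; rewrite big_cons; exact: cvgD.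
Qed.

Lemma rv_hilbert : hilbert rv_ip.
Proof.
move=> u cu.
have cRe := rv_cauchy_coord (f := @complex.Re R) _ _ cu.
have cIm := rv_cauchy_coord (f := @complex.Im R) _ _ cu.
have {}cRe i : cvgn (fun k => complex.Re (u k 0 i)).
  by apply: cRe => [[? ?] [? ?]//|z]; rewrite lerDl sqr_ge0.
have {}cIm i : cvgn (fun k => complex.Im (u k 0 i)).
  by apply: cIm => [[? ?] [? ?]//|z]; rewrite lerDr sqr_ge0.
pose a i := limn (fun k => complex.Re (u k 0 i)).
pose b i := limn (fun k => complex.Im (u k 0 i)).
pose l : H := \row_i (a i +i* b i).
have sq0 : (fun k => sqnorm rv_ip (u k - l)) @ \oo --> (0 : R).
  have -> : (fun k => sqnorm rv_ip (u k - l)) =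
      fun k => \sum_i ((complex.Re (u k 0 i) - a i) ^+ 2 +
                       (complex.Im (u k 0 i) - b i) ^+ 2).
    apply/funext => k; rewrite rv_sqnorm; apply: eq_bigr => i _.
    by rewrite /l !mxE /sqabs; case: (u k 0 i).
  have sum0 : \sum_(i < n) ((a i - a i) ^+ 2 + (b i - b i) ^+ 2) = 0.
    by rewrite big1 // => i _; rewrite !subrr expr0n addr0.
  rewrite -[X in _ --> X]sum0.
  apply: cvg_rsum => i; apply: cvgD.
    apply: (cvg_comp _ (fun x => x ^+ 2)); last exact: exprn_continuous.
    by apply: cvgB; [exact: cRe|exact: cvg_cst].
  apply: (cvg_comp _ (fun x => x ^+ 2)); last exact: exprn_continuous.
  by apply: cvgB; [exact: cIm|exact: cvg_cst].
exists l; rewrite /hnorm -(sqrtr0 R).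
exact: (cvg_comp _ _ sq0 (@sqrt_continuous R 0)).
Qed.

(** * Coordinate projections and block-diagonal algebras *)

Definition mask (A : pred 'I_n) u : H := \row_i (if A i then u 0 i else 0).

Lemma maskE A u i : mask A u 0 i = if A i then u 0 i else 0.
Proof. by rewrite mxE. Qed.

Lemma is_lin_mask A : is_lin (mask A).
Proof.
move=> c u v; apply/rowP => i; rewrite !mxE.
by case: ifP; rewrite ?mulr0 ?addr0.
Qed.

Lemma bounded_mask A : bounded_op rv_ip (mask A).
Proof. by apply/bounded_rvP; exact: is_lin_mask. Qed.

Lemma maskK A B u : mask A (mask B u) = mask [pred i | A i && B i] u.
Proof. by apply/rowP => i; rewrite !mxE /=; case: (A i). Qed.

Lemma eq_mask A B u : A =1 B -> mask A u = mask B u.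
Proof. by move=> AB; apply/rowP => i; rewrite !mxE AB. Qed.

Lemma mask_delta (A : pred 'I_n) i : mask A (e_ i) = if A i then e_ i else 0.
Proof.
apply/rowP => j; rewrite !mxE /=; have [->|ji] := eqVneq j i.
  by case: ifP; rewrite !mxE ?eqxx.
by case: ifP; case: ifP; rewrite !mxE ?(negPf ji).
Qed.

Lemma mask_adjoint A : adjoint rv_ip (mask A) (mask A).
Proof.
move=> u v; rewrite !rv_ipE; apply: eq_bigr => i _; rewrite !mxE.
by case: (A i); rewrite // mul0r [X in _ * X]conjc0 mulr0.
Qed.

(** For an equivalence relation [r], these are the matrices that are block
    diagonal for the partition into classes. Presenting them as a commutant
    makes the bicommutant property automatic. *)
Definition block_alg (r : rel 'I_n) : set (H -> H) :=
  commutant rv_ip [set P | exists i, P = mask (r i)].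

Lemma block_alg_vn r : von_neumann rv_ip (block_alg r).
Proof.
apply: von_neumann_commutant; last exact: rv_adjoint.
  by move=> _ [i ->]; exact: bounded_mask.
by move=> _ [i ->]; exact: mask_adjoint.
Qed.

Section Blocks.
Variable r : rel 'I_n.
Hypothesis eqr : equivalence_rel r.

Let rxx : reflexive r. Proof. by move=> i; case: (eqr i i i). Qed.

Let r_class i j : r i j -> r i =1 r j.
Proof. by move=> rij k; case: (eqr i j k) => _ /(_ rij). Qed.

(** This coordinatewise form of commutation is the one used for inclusions
    between block algebras and for membership of concrete matrices. *)
Lemma block_algP T : block_alg r T <->
  is_lin T /\ forall u i, T u 0 i = T (mask (r i) u) 0 i.
Proof.
split=> [/commutantP[[lT _] cT]|[lT loc]].
  by split=> // u i; rewrite (cT (mask (r i))) ?maskE ?rxx //; exists i.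
apply/commutantP; split; first exact/bounded_rvP.
move=> _ [i ->] u; apply/rowP => j; rewrite maskE.
case: ifPn => rij; rewrite [LHS]loc maskK.
  rewrite [RHS]loc; congr (T _ 0 j); apply: eq_mask => k /=.
  by rewrite (r_class rij) andbb.
rewrite (_ : mask _ u = 0) ?is_lin0 ?mxE //.
apply/rowP => k; rewrite !mxE /=; case: andP => // -[rjk rik].
by move: rij; rewrite (r_class rik) -(r_class rjk) rxx.
Qed.

(** The trace preserving conditional expectation onto the block-diagonal
    matrices. *)
Definition pinch T u : H := \row_i T (mask (r i) u) 0 i.

Lemma pinch_comm T i u : mask (r i) (pinch T u) =
  mask (r i) (T (mask (r i) u)).
Proof.
apply/rowP => j; rewrite !mxE; case: ifP => // rij.
by congr (T _ 0 j); apply: eq_mask => k; rewrite (r_class rij).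
Qed.

Lemma is_lin_pinch T : is_lin T -> is_lin (pinch T).
Proof. by move=> lT c u v; apply/rowP => i; rewrite !mxE is_lin_mask lT !mxE. Qed.

Lemma pinch_in T : is_lin T -> block_alg r (pinch T).
Proof.
move=> lT; apply/block_algP; split; first exact: is_lin_pinch.
move=> u i; rewrite !mxE maskK; congr (T _ 0 i).
by apply: eq_mask => k /=; rewrite andbb.
Qed.

Lemma pinch_id T : block_alg r T -> pinch T = T.
Proof.
by move=> /block_algP[_ loc]; apply/funext => u; apply/rowP => i; rewrite mxE -loc.
Qed.

(** Pinching is an average of compressions: each row index is counted once by
    giving every member of a class the inverse of its size as weight. *)
Lemma pinch_form T u : rv_ip (pinch T u) u =
  \sum_k (#|r k|%:R)^-1 * rv_ip (T (mask (r k) u)) (mask (r k) u).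
Proof.
transitivity (\sum_k \sum_(i | r k i)
    (#|r k|%:R)^-1 * (T (mask (r i) u) 0 i * (u 0 i)^*)).
  rewrite (exchange_big_dep xpredT) //= rv_ipE; apply: eq_bigr => i _.
  have rC k : r k i = r i k.
    by apply/idP/idP => h; rewrite -(r_class h) rxx.
  under eq_bigl do rewrite rC.
  under eq_bigr => k rik.
    rewrite (_ : #|r k| = #|r i|); last first.
      by apply: eq_card => j; rewrite !unfold_in (r_class rik).
    over.
  rewrite sumr_const mxE -[RHS]mulr_natl mulrA divff ?mul1r // pnatr_eq0 -lt0n.
  by apply/card_gt0P; exists i; rewrite unfold_in rxx.
apply: eq_bigr => k _; rewrite rv_ipE mulr_sumr [RHS](bigID (r k)) /=.
rewrite [X in _ + X]big1 ?addr0 => [|i /negPf ki]; last first.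
  by rewrite maskE ki [X in _ * (_ * X)]conjc0 !mulr0.
apply: eq_bigr => i ki; rewrite maskE ki; congr (_ * (T _ 0 i * _)).
by apply: eq_mask => j; rewrite (r_class ki).
Qed.

Lemma pinch_pos T : op_pos rv_ip T -> op_pos rv_ip (pinch T).
Proof.
move=> pT u; rewrite pinch_form sumr_ge0 // => k _.
by rewrite mulr_ge0 // invr_ge0 ler0n.
Qed.

Lemma pinch_bimodule A T B : block_alg r A -> block_alg r B ->
  pinch (A \o T \o B) = A \o pinch T \o B.
Proof.
move=> /block_algP[lA locA] /commutantP[_ cB].
apply/funext => u; apply/rowP => i /=; rewrite mxE /= locA [RHS]locA.
by rewrite pinch_comm cB //; exists i.
Qed.

End Blocks.

End RowSpace.

(** The powers of the imaginary unit average out every term but one. *)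
Lemma polarization_sum (C : numClosedFieldType) (x y z t : C) :
  \sum_(k < 4) 'i ^+ k *
    (z + ('i ^+ k)^* * x + 'i ^+ k * y + 'i ^+ k * ('i ^+ k)^* * t) = 4%:R * x.
Proof.
have i2 := @sqrCi C; have i3 : 'i ^+ 3 = - 'i :> C by rewrite exprS i2 mulrN1.
rewrite !big_ord_recl big_ord0 /bump [LHS]/= !expr0 expr1 i2 i3 addr0.
rewrite !rmorphN [LHS]/= !rmorph1 !conjCi.
move: i2; move: ('i : C)%R => I; rewrite expr2 => I2.
transitivity (x * (2 - 2 * (I * I)) + y * (2 + 2 * (I * I))); first by ring.
by rewrite I2; ring.
Qed.

(** * The normalized trace on the full matrix algebra *)

Section MatrixTrace.
Local Open Scope complex_scope.
Variables (R : realType) (n : nat).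
Local Notation H := 'rV[R[i]]_n.+1.
Local Notation ip := (@rv_ip R n.+1).
Local Notation e_ i := (delta_mx 0 i : H).
Implicit Types (u v w : H) (T S U : H -> H).

Definition all_rel : rel 'I_n.+1 := fun _ _ => true.

Lemma all_rel_equiv : equivalence_rel all_rel.
Proof. by []. Qed.

Definition full_alg : set (H -> H) := block_alg all_rel.

Lemma full_algP T : full_alg T <-> is_lin T.
Proof.
split=> [/(block_algP all_rel_equiv)[]//|lT].
apply/(block_algP all_rel_equiv); split=> // u i; congr (T _ 0 i).
by apply/rowP => j; rewrite mxE.
Qed.

Definition ntrace T : R[i] := (\sum_i T (e_ i) 0 i) / n.+1%:R.

Lemma ntraceE T : ntrace T = (\sum_i ip (T (e_ i)) (e_ i)) / n.+1%:R.
Proof. by congr (_ / _); apply: eq_bigr => i _; rewrite rv_ip_delta. Qed.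

Lemma ReM_real (z : R[i]) (x : R) : complex.Re (z * x%:C) = complex.Re z * x.
Proof. by case: z => a b /=; ring. Qed.

Lemma inv_natC (k : nat) : (k%:R : R[i])^-1 = ((k%:R : R)^-1)%:C.
Proof. by rewrite fmorphV rmorph_nat. Qed.

Lemma Re_ntrace T :
  complex.Re (ntrace T) = (\sum_i complex.Re (T (e_ i) 0 i)) / n.+1%:R.
Proof. by rewrite /ntrace inv_natC ReM_real Re_sum. Qed.

Lemma ntrace_tracial S T : is_lin S -> is_lin T ->
  ntrace (S \o T) = ntrace (T \o S).
Proof.
move=> lS lT; congr (_ / _).
transitivity (\sum_i \sum_j T (e_ i) 0 j * S (e_ j) 0 i).
  apply: eq_bigr => i _; rewrite /= (is_lin_sum _ lS) summxE.
  by apply: eq_bigr => j _; rewrite mxE.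
rewrite exchange_big; apply: eq_bigr => i _; rewrite /= [in RHS](is_lin_sum _ lT).
by rewrite summxE; apply: eq_bigr => j _; rewrite mxE mulrC.
Qed.

Lemma ntrace_pos T : op_pos ip T -> 0 <= ntrace T.
Proof.
by move=> pT; rewrite ntraceE divr_ge0 ?ler0n // sumr_ge0 // => i _; exact: pT.
Qed.

Lemma ip_add_scaled T u v (c : R[i]) : is_lin T ->
  ip (T (u + c *: v)) (u + c *: v) = ip (T u) u + c^* * ip (T u) v +
    c * ip (T v) u + c * c^* * ip (T v) v.
Proof.
move=> lT; rewrite (is_linD _ _ lT) (is_linZ _ _ lT).
by rewrite ipDl !ipDr !ipZl !dotZr; ring.
Qed.

(** A positive form that vanishes at two basis vectors has no off-diagonal
    entry between them: test it on the combinations with the coefficients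
    1, -1, i and -i. *)
Lemma ntrace_faithful T : is_lin T -> op_pos ip T -> ntrace T = 0 ->
  T = (fun=> 0).
Proof.
move=> lT pT; rewrite ntraceE => /eqP; rewrite mulf_eq0 invr_eq0 pnatr_eq0 orbF.
rewrite psumr_eq0 => [/allP T0|i _]; last exact: pT.
have {}T0 i : ip (T (e_ i)) (e_ i) = 0 by apply/eqP/T0; rewrite mem_index_enum.
apply/funext => u; rewrite (is_lin_sum _ lT) big1 // => i _.
rewrite (_ : T (e_ i) = 0) ?scaler0 //; apply/rowP => j; rewrite mxE -rv_ip_delta.
have form c : 0 <= c^* * ip (T (e_ i)) (e_ j) + c * ip (T (e_ j)) (e_ i).
  have := pT (e_ i + c *: e_ j); rewrite ip_add_scaled // !T0.
  by rewrite mulr0 addr0 add0r.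
have := form 1; have := form (-1); have := form 'i; have := form (- 'i).
case: (ip _ _) => a b; case: (ip _ _) => c d; rewrite !lecE /=.
move=> /andP[/eqP ? ?] /andP[/eqP ? ?] /andP[/eqP ? ?] /andP[/eqP ? ?].
by congr (_ +i* _); lra.
Qed.

Lemma op_le_trans S T U : op_le ip S T -> op_le ip T U -> op_le ip S U.
Proof. by move=> ST TU u; exact: le_trans (ST u) (TU u). Qed.

Lemma lec_Re (x y : R[i]) : x <= y -> complex.Re x <= complex.Re y.
Proof. by rewrite lecE => /andP[]. Qed.

Lemma Re_ntrace_le S T : op_le ip S T ->
  complex.Re (ntrace S) <= complex.Re (ntrace T).
Proof.
move=> ST; apply: lec_Re; rewrite !ntraceE ler_wpM2r ?invr_ge0 ?ler0n //.
by apply: ler_sum => i _; exact: ST.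
Qed.

Lemma ReB (x y : R[i]) :
  complex.Re (x - y) = complex.Re x - complex.Re y.
Proof. by case: x y => [? ?] [? ?]. Qed.

Lemma ImB (x y : R[i]) :
  complex.Im (x - y) = complex.Im x - complex.Im y.
Proof. by case: x y => [? ?] [? ?]. Qed.

Lemma norm_Re_le (z : R[i]) (e : R) : `|z| <= e%:C -> `|complex.Re z| <= e.
Proof.
rewrite normc_def lecR; apply: le_trans.
by rewrite -sqrtr_sqr ler_sqrt ?lerDl ?addr_ge0 ?sqr_ge0.
Qed.

Lemma norm_Im_le (z : R[i]) (e : R) : `|z| <= e%:C -> `|complex.Im z| <= e.
Proof.
rewrite normc_def lecR; apply: le_trans.
by rewrite -sqrtr_sqr ler_sqrt ?lerDr ?addr_ge0 ?sqr_ge0.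
Qed.

Lemma lec_approx (a l : R[i]) :
  (forall e : R, 0 < e -> exists2 z, a <= z & `|z - l| <= e%:C) -> a <= l.
Proof.
move=> al; rewrite lecE; apply/andP; split.
  rewrite -subr_eq0 -normr_le0; apply/ler_addgt0Pl => e e0.
  rewrite addr0; have [z + /norm_Im_le] := al e e0.
  by rewrite lecE ImB distrC => /andP[/eqP <- _]; rewrite distrC.
apply/ler_addgt0Pr => e e0; have [z + /norm_Re_le] := al e e0.
rewrite lecE ReB => /andP[_ az] zl.
by have := ler_norm (complex.Re z - complex.Re l); lra.
Qed.

(** Matrix entries are recovered from the quadratic form at these four
    vectors, indexed by the powers of the imaginary unit. *)
Definition polar_vec (i j : 'I_n.+1) (k : 'I_4) : H := e_ j + 'i ^+ k *: e_ i.

Definition polar_entry (q : H -> R) (i j : 'I_n.+1) : R[i] :=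
  (\sum_(k < 4) 'i ^+ k * (q (polar_vec i j k))%:C) / 4%:R.

Lemma polar_entryE T (q : H -> R) i j : is_lin T ->
  (forall u, ip (T u) u = (q u)%:C) -> polar_entry q i j = T (e_ j) 0 i.
Proof.
move=> lT qE; rewrite /polar_entry.
have -> : T (e_ j) 0 i = (4%:R * T (e_ j) 0 i) / 4%:R.
  by rewrite mulrC mulKf // pnatr_eq0.
congr (_ / _).
under eq_bigr do rewrite -qE /polar_vec ip_add_scaled // !rv_ip_delta.
move: (T (e_ j) 0 i) (T (e_ i) 0 j) (T (e_ j) 0 j) (T (e_ i) 0 i) => x y z t.
exact: polarization_sum.
Qed.

Lemma polar_entry_close (q q' : H -> R) (e : R) i j :
  (forall k, `|q (polar_vec i j k) - q' (polar_vec i j k)| <= e) ->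
  `|polar_entry q i j - polar_entry q' i j| <= e%:C.
Proof.
move=> qe; rewrite /polar_entry -mulrBl -sumrB normrM normfV normr_nat.
rewrite ler_pdivrMr ?ltr0n //; apply: le_trans (ler_norm_sum _ _ _) _.
apply: (@le_trans _ _ (\sum_(k < 4) e%:C)); last first.
  by rewrite sumr_const card_ord mulr_natr.
apply: ler_sum => k _; rewrite -mulrBr normrM normrX normCi expr1n mul1r.
rewrite -rmorphB normc_def /= expr0n addr0 sqrtr_sqr lecR.
exact: qe.
Qed.

Lemma form_entries T v : is_lin T ->
  ip (T v) v = \sum_i \sum_j (v 0 i)^* * v 0 j * T (e_ j) 0 i.
Proof.
move=> lT; rewrite rv_ipE; apply: eq_bigr => i _.
rewrite (is_lin_sum v lT) summxE mulr_suml; apply: eq_bigr => j _.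
by rewrite mxE; ring.
Qed.

(** The supremum of a directed bounded family of positive matrices is given by
    the pointwise suprema of the quadratic forms; its trace is approximated
    within the family since all the finitely many entries are. *)
Lemma ntrace_normal (D : set (H -> H)) S : D `<=` pos_part ip full_alg ->
  directed ip D -> op_sup ip full_alg D S ->
  (complex.Re (ntrace S))%:E =
    ereal_sup [set (complex.Re (ntrace T))%:E | T in D].
Proof.
move=> DM [[T0 DT0] dirD] [[MS pS] ubS lubS]; apply/eqP; rewrite eq_le.
apply/andP; split; last first.
  by apply: ge_ereal_sup => _ [T DT <-]; rewrite lee_fin Re_ntrace_le //; exact: ubS.
have linD T : D T -> is_lin T by move=> /DM[/full_algP].
have posD T : D T -> op_pos ip T by move=> /DM[].
pose form T u := complex.Re (ip (T u) u).
have formE T u : D T -> ip (T u) u = (form T u)%:C.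
  move=> /posD/(_ u); rewrite lecE /form => /andP[/eqP /= im0 _].
  by move: im0; case: (ip (T u) u) => a b /= ->.
pose q u := sup [set form T u | T in D].
have q_ub u : has_ubound [set form T u | T in D].
  by exists (form S u) => _ [T DT <-]; apply: lec_Re; exact: ubS.
have form_le_q T u : D T -> form T u <= q u.
  by move=> DT; apply: ub_le_sup => //; exists T.
have approx1 u (e : R) : 0 < e -> exists2 T, D T & q u - e < form T u.
  move=> e0; have [|_ [T DT <-] ?] := @sup_adherent _ [set form T u | T in D] e e0.
    by split; [exists (form T0 u); exists T0|exact: q_ub].
  by exists T.
have approx (ws : seq H) (e : R) T : 0 < e -> D T -> exists U,
    [/\ D U, op_le ip T U & forall w, w \in ws -> q w - e < form U w].
  move=> e0 DT; elim: ws => [|w ws [U [DU TU Uws]]]; first by exists T; split.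
  have [T' DT' Tw] := approx1 w e e0; have [V [DV UV TV]] := dirD U T' DU DT'.
  exists V; split=> // [|w']; first exact: op_le_trans UV.
  rewrite inE => /predU1P[->|/Uws/lt_le_trans]; last by apply; exact/lec_Re/UV.
  by apply: (lt_le_trans Tw); exact/lec_Re/TV.
pose L u : H := \row_i \sum_j u 0 j * polar_entry q i j.
have LD i j : L (e_ j) 0 i = polar_entry q i j.
  rewrite mxE (bigD1 j) //= mxE !eqxx mul1r big1 ?addr0 // => k /negPf kj.
  by rewrite mxE kj andbF mul0r.
have linL : is_lin L.
  move=> c u v; apply/rowP => i; rewrite !mxE mulr_sumr -big_split.
  by apply: eq_bigr => j _; rewrite !mxE /=; ring.
pose ws := [seq polar_vec p.1.1 p.1.2 p.2 |
  p <- enum {: 'I_n.+1 * 'I_n.+1 * 'I_4}].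
have close T (e : R) : 0 < e -> D T -> exists U, [/\ D U, op_le ip T U &
    forall i j, `|U (e_ j) 0 i - L (e_ j) 0 i| <= e%:C].
  move=> e0 DT; have [U [DU TU Uq]] := approx ws e T e0 DT.
  exists U; split=> // i j; rewrite LD.
  rewrite -(@polar_entryE U (form U) i j (linD _ DU)); last by move=> u; exact: formE.
  apply: polar_entry_close => k.
  have : q (polar_vec i j k) - e < form U (polar_vec i j k).
    by apply/Uq/mapP; exists (i, j, k); rewrite // mem_enum.
  have := form_le_q U (polar_vec i j k) DU => ? ?.
  by rewrite ler_norml; apply/andP; split; lra.
have ubL T : D T -> op_le ip T L.
  move=> DT v; apply: lec_approx => e e0.
  pose C := \sum_i \sum_j Num.sqrt (sqabs (v 0 i)) * Num.sqrt (sqabs (v 0 j)).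
  have C0 : 0 <= C.
    by apply: sumr_ge0 => i _; apply: sumr_ge0 => j _; rewrite mulr_ge0 // sqrtr_ge0.
  have eC : 0 < e / (1 + C) by rewrite divr_gt0 // ltr_wpDr.
  have [U [DU TU Ue]] := close T (e / (1 + C)) eC DT.
  exists (ip (U v) v); first exact: TU.
  rewrite (form_entries _ linL) (form_entries _ (linD _ DU)) -sumrB.
  apply: (@le_trans _ _ (C * (e / (1 + C)))%:C); last first.
    rewrite lecR mulrA ler_pdivrMr ?ltr_wpDr // mulrC ler_wpM2l ?(ltW e0) //.
    by rewrite lerDr.
  apply: le_trans (ler_norm_sum _ _ _) _.
  rewrite /C mulr_suml rmorph_sum; apply: ler_sum => i _.
  rewrite -sumrB; apply: le_trans (ler_norm_sum _ _ _) _.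
  rewrite mulr_suml rmorph_sum; apply: ler_sum => j _.
  rewrite -mulrBr !normrM [leRHS]rmorphM ler_pM ?mulr_ge0 //.
  by rewrite norm_conjC !normc_def rmorphM.
have ML : pos_part ip full_alg L.
  split; first exact/full_algP.
  by move=> u; apply: le_trans (ubL T0 DT0 u); exact: posD.
apply: le_trans (_ : (complex.Re (ntrace L))%:E <= _)%E.
  by rewrite lee_fin; apply/Re_ntrace_le/lubS.
apply/lee_addgt0Pr => e e0.
have [U [DU _ Ue]] := close T0 e e0 DT0.
apply: (@le_trans _ _ ((complex.Re (ntrace U))%:E + e%:E)%E); last first.
  by rewrite leeD2r // ereal_sup_ubound //; exists U.
rewrite -EFinD lee_fin !Re_ntrace -lerBlDl -mulrBl -sumrB.
rewrite ler_pdivrMr ?ltr0n //.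
apply: (@le_trans _ _ (\sum_(i < n.+1) e)); last first.
  by rewrite sumr_const card_ord mulr_natr.
apply: ler_sum => i _; rewrite -ReB; apply: le_trans (ler_norm _) _.
by apply: norm_Re_le; rewrite distrC.
Qed.

Lemma ntrace_state : trace_state ip full_alg ntrace.
Proof.
split.
- move=> c S T _ _; rewrite /ntrace mulrA -mulrDl mulr_sumr -big_split.
  by congr (_ / _); apply: eq_bigr => i _; rewrite !mxE.
- by move=> T [_ pT]; exact: ntrace_pos.
- by move=> S T /full_algP lS /full_algP lT; exact: ntrace_tracial.
- by move=> T [/full_algP lT pT]; exact: ntrace_faithful.
- by move=> D S; exact: ntrace_normal.
- rewrite /ntrace (eq_bigr (fun=> 1)) => [|i _]; last by rewrite mxE !eqxx.
  by rewrite sumr_const card_ord divff // pnatr_eq0.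
Qed.

(** * The filtration *)

(** The block algebra of this relation is full on the first [k + 1] coordinates
    and diagonal on the others. *)
Definition corner (k : nat) : rel 'I_n.+1 :=
  fun i j => (i == j) || ((i <= k)%N && (j <= k)%N).

Lemma corner_equiv k : equivalence_rel (corner k).
Proof.
move=> i j l; rewrite /corner eqxx; split=> // /orP[/eqP ->//|/andP[ik jk]].
by rewrite ik jk /=; apply/orP/orP => -[/eqP <-|->]; rewrite ?ik ?jk /=; right.
Qed.

Lemma cornerS k i j : corner k i j -> corner k.+1 i j.
Proof.
by rewrite /corner => /orP[->//|/andP[ik jk]]; rewrite (leqW ik) (leqW jk) orbT.
Qed.

Lemma corner_full k i j : (n <= k)%N -> corner k i j.
Proof.
move=> nk; have le (l : 'I_n.+1) : (l <= k)%N.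
  by apply: leq_trans nk; rewrite -ltnS.
by rewrite /corner !le orbT.
Qed.

Lemma block_alg_sub (r s : rel 'I_n.+1) : equivalence_rel r ->
  equivalence_rel s -> (forall i j, r i j -> s i j) ->
  @block_alg R n.+1 r `<=` @block_alg R n.+1 s.
Proof.
move=> eqr eqs rs T /(block_algP eqr)[lT loc]; apply/(block_algP eqs).
split=> // u i; rewrite loc [RHS]loc maskK; congr (T _ 0 i).
apply: eq_mask => j /=; case rij: (r i j) => //=; exact/esym/rs.
Qed.

Lemma corner_filtration :
  filtration ip full_alg (fun k => block_alg (corner k)).
Proof.
split.
- by move=> k; exact: block_alg_vn.
- by move=> k; apply: block_alg_sub => //; exact: corner_equiv.
- by move=> k; apply: block_alg_sub; [exact: corner_equiv..|exact: cornerS].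
- move=> S MS m xi eta e e0; exists S.
    exists n => //; move: MS; apply: block_alg_sub => //; first exact: corner_equiv.
    by move=> i j _; exact: corner_full.
  move=> j; rewrite (_ : series_dot _ _ _ = 0) ?normr0 ?ltcR //.
  rewrite /series_dot; under [X in series X]eq_fun do rewrite subrr ip0l.
  under [X in _ +i* limn (series X)]eq_fun do rewrite subrr ip0l.
  have -> : series (fun=> 0 : R) = (fun=> 0).
    by apply/funext => k; rewrite /series /= big1.
  by rewrite lim_cst.
Qed.

Lemma corner_cond_exp k :
  cond_exp ip full_alg ntrace (block_alg (corner k)) (pinch (corner k)).
Proof.
have eqr := corner_equiv k; split.
- by move=> T /full_algP lT; exact: pinch_in.
- by move=> c S T _ _; apply/funext => u; apply/rowP => i; rewrite !mxE.
- by move=> T [_ pT]; exact: pinch_pos.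
- by move=> T; exact: pinch_id.
- by move=> A T B MA _ MB; exact: pinch_bimodule.
- move=> T _; congr (_ / _); apply: eq_bigr => i _; rewrite mxE mask_delta.
  by rewrite /corner eqxx.
Qed.

End MatrixTrace.

(** * Singular values of weighted composition operators *)

Section WeightedComposition.
Local Open Scope complex_scope.
Variables (R : realType) (n : nat).
Local Notation H := 'rV[R[i]]_n.+1.
Local Notation ip := (@rv_ip R n.+1).
Local Notation e_ i := (delta_mx 0 i : H).
Local Notation nu := (trace_weight (@ntrace R n)).
Implicit Types (u v w xi : H) (a d : 'I_n.+1 -> R) (c : 'I_n.+1 -> 'I_n.+1).

(** A weighted composition operator: row i of its matrix has the single entry
    [a i], in column [c i]. The martingale differences, their sums and the
    absolute values of these are all of this form. *)
Definition wcomp a c u : H := \row_i ((a i)%:C * u 0 (c i)).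

Lemma is_lin_wcomp a c : is_lin (wcomp a c).
Proof. by move=> x u v; apply/rowP => i; rewrite !mxE; ring. Qed.

Lemma bounded_wcomp a c : bounded_op ip (wcomp a c).
Proof. by apply/bounded_rvP; exact: is_lin_wcomp. Qed.

Lemma wcompD a b c u : wcomp (fun i => a i + b i) c u = wcomp a c u + wcomp b c u.
Proof. by apply/rowP => i; rewrite !mxE rmorphD mulrDl. Qed.

Lemma wcomp0 c : wcomp (fun=> 0) c = (fun=> 0).
Proof. by apply/funext => u; apply/rowP => i; rewrite !mxE mul0r. Qed.

Definition wadj a c v : H := \row_j \sum_(i | c i == j) (a i)%:C * v 0 i.

Lemma wadjP a c : adjoint ip (wcomp a c) (wadj a c).
Proof.
move=> u v; rewrite !rv_ipE.
rewrite (partition_big c xpredT) //=; apply: eq_bigr => j _.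
rewrite mxE rmorph_sum mulr_sumr; apply: eq_bigr => i /eqP cij.
by rewrite mxE rmorphM /= cij [((a i)%:C)^*%R]conjc_real; ring.
Qed.

Lemma wadj_id d : wadj d id = wcomp d id.
Proof. by apply/funext => u; apply/rowP => i; rewrite !mxE big_pred1_eq. Qed.

(** Distinct columns of the matrix are orthogonal, so the absolute value is
    diagonal and its entries are the norms of the columns. *)
Definition col_norm a c j : R := Num.sqrt (\sum_(i | c i == j) a i ^+ 2).

Lemma col_norm_ge0 a c j : 0 <= col_norm a c j.
Proof. exact: sqrtr_ge0. Qed.

Lemma wadj_wcomp a c :
  wadj a c \o wcomp a c = wcomp (col_norm a c) id \o wcomp (col_norm a c) id.
Proof.
apply/funext => u; apply/rowP => j; rewrite /= !mxE mulrA -rmorphM -expr2.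
rewrite sqr_sqrtr; last by apply: sumr_ge0 => i _; exact: sqr_ge0.
rewrite rmorph_sum mulr_suml; apply: eq_bigr => i /eqP cij.
by rewrite mxE cij mulrA -rmorphM -expr2.
Qed.

Lemma wcomp_diag_form d u :
  ip (wcomp d id u) u = (\sum_i d i * sqabs (u 0 i))%:C.
Proof.
rewrite rv_ipE rmorph_sum; apply: eq_bigr => i _.
by rewrite mxE -mulrA rmorphM /= -mul_conjc.
Qed.

Lemma wcomp_abs a c : is_abs ip (graph (wcomp a c)) (graph (wcomp (col_norm a c) id)).
Proof.
split.
- exact/cdd_graph/bounded_wcomp.
- by rewrite (gadj_graph (wadjP _ _)) wadj_id.
- move=> [u v]; rewrite /graph /= => ->; rewrite wcomp_diag_form ler0c.
  by apply: sumr_ge0 => i _; rewrite mulr_ge0 // ?col_norm_ge0 // sqabs_ge0.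
- by rewrite (gadj_graph (wadjP _ _)) !gcomp_graph wadj_wcomp.
Qed.

Section DiagonalSpectralMeasure.
Variable d : 'I_n.+1 -> R.
Hypothesis d0 : forall i, 0 <= d i.

Definition diag_proj (A : set R) : H -> H := mask (fun i => `[< A (d i) >]).

(** Indexed by natural numbers, as [msum] requires. *)
Definition diag_atom xi (k : nat) : {measure set (measurableTypeR R) -> \bar R} :=
  mscale (NngNum (sqabs_ge0 (xi 0 (inord k : 'I_n.+1)))) (dirac (d (inord k) : measurableTypeR R)).

Definition diag_measure xi : {measure set (measurableTypeR R) -> \bar R} :=
  msum (diag_atom xi) n.+1.

Lemma diag_measureE xi (A : set (measurableTypeR R)) : diag_measure xi A =
  (\sum_i (if `[< A (d i) >] then sqabs (xi 0 i) else 0))%:E.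
Proof.
rewrite /diag_measure /= /msum -sumEFin; apply: eq_bigr => k _.
rewrite /= /mscale /= inord_val diracE; case: asboolP => Ad.
  by rewrite mem_set // mule1.
by rewrite memNset // mule0.
Qed.

Lemma ge0_integral_diag_measure xi (f : R -> \bar R) :
  (forall l, (0 <= f l)%E) -> measurable_fun setT f ->
  (\int[diag_measure xi]_l f l = \sum_i (sqabs (xi 0 i))%:E * f (d i))%E.
Proof.
move=> f0 mf; rewrite /diag_measure ge0_integral_measure_sum //.
apply: eq_bigr => k _; rewrite /diag_atom ge0_integral_mscale //=.
by rewrite integral_dirac // diracT mul1e inord_val.
Qed.

Lemma diag_spectral_measure :
  spectral_measure ip (graph (wcomp d id)) diag_proj diag_measure.
Proof.
split.
- move=> A _; split; [exact: bounded_mask|exact: mask_adjoint|].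
  by apply/funext => u /=; rewrite /diag_proj maskK; apply: eq_mask => i /=; rewrite andbb.
- by apply/funext => u; apply/rowP => i; rewrite mxE asboolT.
- move=> A B _ _; apply/funext => u; rewrite /diag_proj /= maskK.
  by apply: eq_mask => i /=; rewrite asbool_and.
- move=> xi A _; rewrite diag_measureE; congr EFin.
  rewrite rv_ipE Re_sum; apply: eq_bigr => i _; rewrite mxE; case: ifP => _.
    by rewrite [_ * _]mul_conjc.
  by rewrite mul0r.
- move=> xi; split=> _; last by exists (wcomp d id xi).
  rewrite (ge0_integral_diag_measure xi (f := fun l => (l ^+ 2)%:E)).
  + under eq_bigr do rewrite -EFinM.
    by rewrite sumEFin ltry.
  + by move=> l; rewrite lee_fin sqr_ge0.
  + by apply/measurable_EFinP; exact: exprn_measurable.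
- move=> xi eta; rewrite /graph /= => ->; rewrite wcomp_diag_form; congr (_%:C).
  have mid : measurable_fun setT (EFin \o (fun l : R => l)) by exact/measurable_EFinP.
  rewrite /Rintegral integralE.
  rewrite !ge0_integral_diag_measure //; last 2 first.
  + exact: measurable_funeneg.
  + exact: measurable_funepos.
  rewrite [X in (_ - X)%E]big1 ?sube0 => [|i _]; last first.
    by rewrite funenegE /= max_r ?mule0 // lee_fin oppr_le0.
  rewrite (eq_bigr (fun i => (d i * sqabs (xi 0 i))%:E)) ?sumEFin // => i _.
  by rewrite funeposE /= max_l ?lee_fin // -EFinM mulrC.
Qed.

End DiagonalSpectralMeasure.

Definition count_above d (s : R) : nat := #|[pred i | s < d i]|.

Lemma nu_diag_proj d (s : R) :
  nu (diag_proj d [set` `]s, +oo[]) = ((count_above d s)%:R / n.+1%:R)%:E.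
Proof.
rewrite /trace_weight Re_ntrace; congr ((_ / _)%:E).
rewrite /count_above -sum1_card natr_sum [RHS]big_mkcond /=.
apply: eq_bigr => i _; rewrite /diag_proj maskE mxE !eqxx /= in_itv /= andbT.
by rewrite asboolb inE; case: ifP.
Qed.

Lemma wcomp_spectral_proj a c (s : R) : abs_spectral_proj ip (graph (wcomp a c)) s
  (diag_proj (col_norm a c) [set` `]s, +oo[]).
Proof.
exists (graph (wcomp (col_norm a c) id)), (diag_proj (col_norm a c)),
  (diag_measure (col_norm a c)); split=> //; first exact: wcomp_abs.
by apply: diag_spectral_measure => i; exact: col_norm_ge0.
Qed.

(** The square of an absolute value of a bounded operator is everywhere
    defined, hence so is the absolute value. *)
Lemma total_absP a c (b : set (H * H)) : is_abs ip (graph (wcomp a c)) b ->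
  exists A, [/\ b = graph A, is_lin A, forall u v, ip (A u) v = ip u (A v),
    forall u, 0 <= ip (A u) u &
    A \o A = wcomp (col_norm a c) id \o wcomp (col_norm a c) id].
Proof.
move=> [cdd adj pos]; rewrite (gadj_graph (wadjP _ _)) gcomp_graph wadj_wcomp.
set D := _ \o _ => bD.
have tot u : exists v, b (u, v).
  have : graph D (u, D u) by [].
  by rewrite -bD => -[v /= buv _]; exists v.
have [A bA] := choice tot.
have AP u v : b (u, v) -> v = A u.
  move=> buv; have := cdd_lin cdd (-1) (bA u) buv.
  rewrite /= scaleN1r addNr scaleN1r => /(cdd_functional cdd)/eqP.
  by rewrite addrC subr_eq0 => /eqP.
have bE : b = graph A.
  by apply/seteqP; split=> -[u v]; [move/AP|rewrite /graph /= => ->; exact: bA].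
exists A; split=> //.
- by move=> x u v; apply/esym/AP; exact: (cdd_lin cdd x (bA u) (bA v)).
- move=> u v; have : gadj ip b (v, A v) by rewrite adj; exact: bA.
  by move=> /(_ _ (bA u)).
- by move=> u; exact: (pos _ (bA u)).
- apply/funext => u; have : gcomp b b (u, A (A u)) by exists (A u); exact: bA.
  by rewrite bD.
Qed.

(** Every spectral projection for the interval above [s] fixes the coordinate
    vectors with singular value above [s], so its trace is at least the
    normalized number of these. *)
Lemma nu_spectral_proj_ge a c (s : R) P : 0 < s ->
  abs_spectral_proj ip (graph (wcomp a c)) s P ->
  (((count_above (col_norm a c) s)%:R / n.+1%:R)%:E <= nu P)%E.
Proof.
move=> s0 [b [Pr [m [/total_absP[A [-> lA sA pA A2]] sm ->]]]].
rewrite -nu_diag_proj /trace_weight lee_fin !Re_ntrace ler_wpM2r ?invr_ge0 ?ler0n //.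
apply: ler_sum => i _; rewrite /diag_proj maskE; case: ifPn => [|_].
  move=> /asboolP; rewrite /= in_itv /= andbT => sd.
  rewrite (spectral_proj_eigvec lA sA pA sm (ltW s0) sd) //.
  have := congr1 (fun f => f (e_ i)) A2; rewrite /= => ->.
  apply/rowP => j; rewrite !mxE; have [->|ji] := eqVneq j i.
    by rewrite expr2 rmorphM mulrA.
  by rewrite andbF !mulr0.
have [_ sP PP] := sm_projection sm (measurable_itv `]s, +oo[).
have /= PPe := congr1 (fun f => f (e_ i)) PP.
by rewrite -rv_ip_delta -PPe sP; exact: sqnorm_ge0.
Qed.

Lemma sing_val_wcomp a c (t : R) : sing_val ip nu (graph (wcomp a c)) t =
  ereal_inf [set s%:E | s in [set s : R | 0 < s /\
    (((count_above (col_norm a c) s)%:R / n.+1%:R)%:E <= t%:E)%E]].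
Proof.
congr (ereal_inf _); apply/seteqP; split=> _ [s [s0 h] <-]; exists s => //; split=> //.
  by have [P pP /(le_trans (nu_spectral_proj_ge s0 pP))] := h.
exists (diag_proj (col_norm a c) [set` `]s, +oo[]); first exact: wcomp_spectral_proj.
by rewrite nu_diag_proj.
Qed.

Lemma wcomp_L0 (N : set (H -> H)) a c : N (wcomp a c) ->
  L0_op ip N nu (graph (wcomp a c)).
Proof.
move=> Na; split; first exact/cdd_graph/bounded_wcomp.
  exact: affiliated_graph.
exists 1, (diag_proj (col_norm a c) [set` `]1, +oo[]); split=> //.
  exact: wcomp_spectral_proj.
by rewrite nu_diag_proj ltry.
Qed.

End WeightedComposition.

(** * Invariance of operator norms under self-adjoint unitaries *)

Section UnitaryInvariance.
Local Open Scope complex_scope.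
Variables (R : realType) (H : lmodType R[i]) (ip : {dot H for @conjc R}).
Variable W : H -> H.
Hypothesis linW : is_lin W.
Hypothesis symW : forall u v, ip (W u) v = ip u (W v).
Hypothesis WK : involutive W.
Implicit Types (u v w : H) (x a : set (H * H)) (P : H -> H).

Definition rmulW x : set (H * H) := [set p | x (W p.1, p.2)].
Definition conjW a : set (H * H) := [set p | a (W p.1, W p.2)].

Lemma rmulWK : involutive rmulW.
Proof. by move=> x; apply/seteqP; split=> -[u v]; rewrite /rmulW /= WK. Qed.

Lemma sqnormW u : sqnorm ip (W u) = sqnorm ip u.
Proof. by rewrite /sqnorm symW WK. Qed.

Lemma hnormW u : hnorm ip (W u) = hnorm ip u.
Proof. by rewrite /hnorm sqnormW. Qed.

Lemma hnormWB u v : hnorm ip (W u - v) = hnorm ip (u - W v).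
Proof. by rewrite -hnormW is_linB // WK. Qed.

Lemma bounded_sym_unitary : bounded_op ip W.
Proof. by split=> //; exists 1 => u; rewrite hnormW mul1r. Qed.

Lemma cdd_rmulW x : closed_densely_defined ip x ->
  closed_densely_defined ip (rmulW x).
Proof.
move=> [x0 xl xf xc xd]; split.
- by rewrite /rmulW /= is_lin0.
- by move=> c [u v] [u' v']; rewrite /rmulW /= linW => xu; exact: xl xu.
- by move=> v; rewrite /rmulW /= is_lin0 // => /xf.
- move=> [u v] cl; apply: xc => e e0; have [[u' v'] [xq /= lu lv]] := cl e e0.
  by exists (W u', v'); split=> //=; rewrite -is_linB // hnormW.
- move=> u e e0; have [v [t xv] uv] := xd (W u) e e0.
  exists (W v); last by rewrite -hnormWB.
  by exists t; rewrite /rmulW /= WK.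
Qed.

Lemma cdd_conjW a : closed_densely_defined ip a ->
  closed_densely_defined ip (conjW a).
Proof.
move=> [x0 xl xf xc xd]; split.
- by rewrite /conjW /= is_lin0.
- by move=> c [u v] [u' v']; rewrite /conjW /= !linW => xu; exact: xl xu.
- by move=> v; rewrite /conjW /= (is_lin0 linW) => /xf Wv; rewrite -(WK v) Wv is_lin0.
- move=> [u v] cl; apply: xc => e e0; have [[u' v'] [xq /= lu lv]] := cl e e0.
  by exists (W u', W v'); split=> //=; rewrite -is_linB // hnormW.
- move=> u e e0; have [v [t xv] uv] := xd (W u) e e0.
  exists (W v); last by rewrite -hnormWB.
  by exists (W t); rewrite /conjW /= !WK.
Qed.

Lemma gadj_rmulW x : gadj ip (rmulW x) = [set p | gadj ip x (p.1, W p.2)].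
Proof.
apply/seteqP; split=> -[u v] /= huv [s t] /= xq.
  by have := huv (W s, t); rewrite /rmulW /= WK symW; exact.
by have := huv (W s, t) xq; rewrite /= symW WK.
Qed.

Lemma gadj_conjW a : gadj ip (conjW a) = conjW (gadj ip a).
Proof.
apply/seteqP; split=> -[u v] /= huv [s t] /= xq.
  by have := huv (W s, W t); rewrite /conjW /= !WK !symW; exact.
by have := huv (W s, W t) xq; rewrite /= !symW !WK.
Qed.

Lemma gcomp_rmulW x :
  gcomp (gadj ip (rmulW x)) (rmulW x) = conjW (gcomp (gadj ip x) x).
Proof. by rewrite gadj_rmulW. Qed.

Lemma gcomp_conjW a : gcomp (conjW a) (conjW a) = conjW (gcomp a a).
Proof.
apply/seteqP; split=> -[u v] [w aw wv]; first by exists (W w).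
by exists (W w); rewrite /conjW /= WK.
Qed.

Lemma is_abs_rmulW x a : is_abs ip x a -> is_abs ip (rmulW x) (conjW a).
Proof.
move=> [ca sa pa aa]; split; first exact: cdd_conjW.
- by rewrite gadj_conjW sa.
- by move=> [u v] /= /pa /=; rewrite symW WK.
- by rewrite gcomp_conjW gcomp_rmulW aa.
Qed.

Lemma spectral_measure_conjW a Pr m : spectral_measure ip a Pr m ->
  spectral_measure ip (conjW a) (fun A => W \o Pr A \o W) (fun xi => m (W xi)).
Proof.
move=> sm; split.
- move=> A mA; have [bP sP PP] := sm_projection sm mA; split.
  + have bW := bounded_sym_unitary.
    exact: (bounded_comp (bounded_comp bW bP) bW).
  + by move=> u v /=; rewrite symW sP symW.
  + by apply/funext => u /=; rewrite WK -[in RHS]PP.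
- by apply/funext => u /=; rewrite (sm_setT sm) WK.
- by move=> A B mA mB; apply/funext => u /=; rewrite WK (sm_setI sm).
- by move=> xi A mA; rewrite (sm_scalar sm) //= symW.
- move=> xi; rewrite -(sm_domain sm); split=> -[v].
    by rewrite /conjW /= => av; exists (W v).
  by move=> av; exists (W v); rewrite /conjW /= WK.
- move=> xi eta axe; rewrite -(sm_form sm axe) /=.
  by rewrite symW WK.
Qed.

Lemma abs_spectral_proj_rmulW x (s : R) P : abs_spectral_proj ip x s P ->
  abs_spectral_proj ip (rmulW x) s (W \o P \o W).
Proof.
move=> [a [Pr [m [ax sm ->]]]].
exists (conjW a), (fun A => W \o Pr A \o W), (fun xi => m (W xi)); split=> //.
  exact: is_abs_rmulW.
exact: spectral_measure_conjW.
Qed.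

Lemma abs_spectral_proj_bounded x (s : R) P : abs_spectral_proj ip x s P ->
  bounded_op ip P.
Proof.
by move=> [a [Pr [m [_ sm ->]]]]; have [] := sm_projection sm (measurable_itv `]s, +oo[).
Qed.

Variables (N : set (H -> H)) (nu : (H -> H) -> \bar R).
Hypothesis NW : N W.
Hypothesis nuW : forall P, bounded_op ip P -> nu (W \o P \o W) = nu P.

Lemma L0_op_rmulW x : L0_op ip N nu x -> L0_op ip N nu (rmulW x).
Proof.
move=> [cx ax [s [P [s0 pP nP]]]]; split; first exact: cdd_rmulW.
  move=> U cU [u v]; rewrite /rmulW /=; have /commutantP[_ UW] := cU.
  by rewrite -UW // => xuv; exact: (ax _ cU _ xuv).
exists s, (W \o P \o W); split=> //; first exact: abs_spectral_proj_rmulW.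
by rewrite nuW //; exact: abs_spectral_proj_bounded pP.
Qed.

Lemma sing_val_set_rmulW x (t s : R) :
  (exists2 P, abs_spectral_proj ip x s P & (nu P <= t%:E)%E) ->
  exists2 P, abs_spectral_proj ip (rmulW x) s P & (nu P <= t%:E)%E.
Proof.
move=> [P pP nP]; exists (W \o P \o W); first exact: abs_spectral_proj_rmulW.
by rewrite nuW //; exact: abs_spectral_proj_bounded pP.
Qed.

(** Right multiplication by W conjugates the absolute value, and with it the
    spectral projections, by W; this leaves their weights unchanged. *)
Lemma op_norm_rmulW (nF : (R -> R) -> \bar R) x :
  op_norm ip N nu nF (rmulW x) = op_norm ip N nu nF x.
Proof.
have svE : sing_val ip nu (rmulW x) = sing_val ip nu x.
  apply/funext => t; congr (ereal_inf _); apply/seteqP.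
  split=> _ [s [s0 h] <-]; exists s => //; split=> //.
    by rewrite -(rmulWK x); exact: sing_val_set_rmulW.
  exact: sing_val_set_rmulW.
rewrite /op_norm svE; congr (if _ then _ else _); apply: asbool_equiv_eq.
by split=> /L0_op_rmulW //; rewrite rmulWK.
Qed.

End UnitaryInvariance.

(** * Two families with the same Z-norm *)

Section TensorSwap.
Local Open Scope complex_scope.
Variables (R : realType) (n : nat).
Local Notation H := 'rV[R[i]]_n.+1.
Local Notation ip := (@rv_ip R n.+1).
Implicit Types (u v : H) (a : 'I_n.+1 -> R) (c : 'I_n.+1 -> 'I_n.+1).

Definition row_op a c (k : nat) : H -> H :=
  wcomp (fun i => if (i : nat) == k then a i else 0) c.

Definition swap (i j : 'I_n.+1) u : H := \row_k u 0 (tperm i j k).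

Lemma is_lin_swap i j : is_lin (swap i j).
Proof. by move=> x u v; apply/rowP => k; rewrite !mxE. Qed.

Lemma swapK i j : involutive (swap i j).
Proof. by move=> u; apply/rowP => k; rewrite !mxE tpermK. Qed.

Lemma swap_sym i j u v : ip (swap i j u) v = ip u (swap i j v).
Proof.
rewrite !rv_ipE (reindex_inj (@perm_inj _ (tperm i j))).
by apply: eq_bigr => k _; rewrite !mxE tpermK.
Qed.

Variables c c' : 'I_n.+1 -> 'I_n.+1.

Let sw (k : nat) : H -> H := swap (c (inord k)) (c' (inord k)).

Lemma row_op_swap a k u : row_op a c' k u = row_op a c k (sw k u).
Proof.
apply/rowP => i; rewrite !mxE; case: eqVneq => [<-|_]; last by rewrite !mul0r.
by rewrite inord_val tpermL.
Qed.

Lemma sqsum_swap (f : l2sum ip) : (fun k => sw k (f k)) \in sqsum ip.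
Proof.
case: f => f /= /asboolP sf; apply/asboolP.
rewrite (_ : (fun k => _) = fun k => sqnorm ip (f k)) //.
by apply/funext => k; apply: sqnormW; [exact: swap_sym|exact: swapK].
Qed.

Definition l2_swap (f : l2sum ip) : l2sum ip := L2sum (sqsum_swap f).

Lemma is_lin_l2_swap : is_lin l2_swap.
Proof. by move=> x f g; apply/val_inj/funext => k; exact: is_lin_swap. Qed.

Lemma l2_swapK : involutive l2_swap.
Proof. by move=> f; apply/val_inj/funext => k; exact: swapK. Qed.

Lemma l2_swap_sym f g : l2_ip ip (l2_swap f) g = l2_ip ip f (l2_swap g).
Proof.
rewrite /l2_ip /= /l2_dot /series_dot; congr (_ +i* _);
  by congr (limn (series _)); apply/funext => k /=; rewrite swap_sym.
Qed.

Lemma l2_swap_tensor : tensor_linf ip (@full_alg R n) l2_swap.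
Proof.
split; first exact: (bounded_sym_unitary is_lin_l2_swap l2_swap_sym l2_swapK).
by exists sw => // k; apply/full_algP; exact: is_lin_swap.
Qed.

Lemma l2_swap_single k u : l2_swap (l2_single ip k u) = l2_single ip k (sw k u).
Proof.
apply/val_inj/funext => j /=; case: eqP => [->//|_].
exact: is_lin0 (is_lin_swap _ _).
Qed.

Lemma l2_single_lin k (x : R[i]) u v : l2_single ip k (x *: u + v) =
  x *: l2_single ip k u + l2_single ip k v.
Proof.
apply/val_inj/funext => j.
rewrite -[RHS]/(x *: l2_single ip k u j + l2_single ip k v j) /=.
by case: eqP => // _; rewrite scaler0 addr0.
Qed.

(** The diagonal blocks of P are conjugated one by one, and the trace is
    invariant under conjugation. *)
Lemma tensor_weight_swap (P : l2sum ip -> l2sum ip) : is_lin P ->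
  tensor_weight ip (@ntrace R n) (l2_swap \o P \o l2_swap) =
  tensor_weight ip (@ntrace R n) P.
Proof.
move=> lP; rewrite /tensor_weight; apply: eq_eseriesr => k _.
rewrite /trace_weight; congr ((complex.Re _)%:E).
pose B u : H := P (l2_single ip k u) k.
have lB : is_lin B by move=> x u v; rewrite /B l2_single_lin lP.
transitivity (ntrace (sw k \o (B \o sw k))).
  by congr ntrace; apply/funext => u; rewrite /= l2_swap_single.
have lsw : is_lin (sw k) by exact: is_lin_swap.
rewrite ntrace_tracial //; last by move=> x u v /=; rewrite lsw lB.
by congr ntrace; apply/funext => u; rewrite /= [sw k _]swapK.
Qed.

(** Exchanging the coordinates [c k] and [c' k] in the k-th summand is a
    self-adjoint unitary of the tensor product algebra that turns one direct sum
    into the other. *)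
Lemma op_norm_direct_sum (nF : (R -> R) -> \bar R) a :
  op_norm (l2_ip ip) (tensor_linf ip (@full_alg R n))
    (tensor_weight ip (@ntrace R n)) nF
    (direct_sum_op ip (fun k => graph (row_op a c' k))) =
  op_norm (l2_ip ip) (tensor_linf ip (@full_alg R n))
    (tensor_weight ip (@ntrace R n)) nF
    (direct_sum_op ip (fun k => graph (row_op a c k))).
Proof.
rewrite -[RHS](op_norm_rmulW is_lin_l2_swap l2_swap_sym l2_swapK l2_swap_tensor);
  last by move=> P [lP _]; exact: tensor_weight_swap.
congr op_norm; apply/seteqP.
split=> -[f g] /= h k; have := h k; rewrite /graph /= => ->.
  by rewrite row_op_swap.
by rewrite row_op_swap.
Qed.

End TensorSwap.

(** * Rearrangements *)

Section Rearrangement.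
Variable R : realType.
Local Notation leb := (@lebesgue_measure R).
Local Notation I := (@unit_itv R).
Implicit Types (f g h : R -> R) (s t : R).

Definition above f s : set R := I `&` [set u | s < `|f u|].
Definition dist f s : \bar R := leb (above f s).

Lemma measurable_unit : measurable I.
Proof. exact: measurable_itv. Qed.

Lemma leb_unit : leb I = 1%E.
Proof. by rewrite /unit_itv lebesgue_measure_itv /= lte_fin ltr01 sube0. Qed.

Lemma measurable_above f s : measurable_fun I f -> measurable (above f s).
Proof.
move=> mf; have mn : measurable_fun I (fun u => `|f u|).
  exact: (measurableT_comp (@normr_measurable _ setT)).
have := mn measurable_unit _ (measurable_itv `]s, +oo[).
congr measurable; apply/seteqP.
by split=> u /= [Iu]; rewrite in_itv /= andbT.
Qed.

Lemma dist_le1 f s : measurable_fun I f -> (dist f s <= 1)%E.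
Proof.
move=> mf; rewrite -leb_unit; apply: le_measure; rewrite ?inE.
- exact: measurable_above.
- exact: measurable_unit.
- by move=> u [].
Qed.

Lemma dist_ge0 f s : (0 <= dist f s)%E.
Proof. exact: measure_ge0. Qed.

Lemma dist_fin f s : measurable_fun I f -> dist f s \is a fin_num.
Proof.
move=> mf; rewrite ge0_fin_numE ?dist_ge0 //.
by apply: le_lt_trans (dist_le1 _ mf) _; rewrite ltry.
Qed.

Lemma dist_anti f s t : measurable_fun I f -> s <= t -> (dist f t <= dist f s)%E.
Proof.
move=> mf st; apply: le_measure; rewrite ?inE; try exact: measurable_above.
by move=> u [Iu /= tu]; split=> //=; exact: le_lt_trans tu.
Qed.

Lemma dist_le f g s : measurable_fun I f -> measurable_fun I g ->
  (forall u, I u -> `|f u| <= `|g u|) -> (dist f s <= dist g s)%E.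
Proof.
move=> mf mg fg; apply: le_measure; rewrite ?inE; try exact: measurable_above.
by move=> u [Iu /= fu]; split=> //=; exact: lt_le_trans (fg u Iu).
Qed.

Lemma rearr_le f g t : (forall s, 0 < s -> (dist f s <= dist g s)%E) ->
  (rearr I f t <= rearr I g t)%E.
Proof.
move=> fg; apply: le_ereal_inf => _ [s [s0 gs] <-]; exists s => //; split=> //.
exact: le_trans (fg s s0) gs.
Qed.

Lemma rearr_ge0 f t : (0 <= rearr I f t)%E.
Proof. by apply: le_ereal_inf_tmp => _ [s [s0 _] <-]; rewrite lee_fin ltW. Qed.

Lemma rearr_bounded f t (B : R) : 0 <= B -> 0 <= t -> (forall u, I u -> `|f u| <= B) ->
  (rearr I f t <= B%:E)%E.
Proof.
move=> B0 t0 fB; apply/lee_addgt0Pr => e e0.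
apply: ereal_inf_lbound; exists (B + e); rewrite ?EFinD //; split.
  by rewrite ltr_wpDl.
rewrite (_ : _ `&` _ = set0) ?measure0 //.
apply/seteqP; split=> u // -[Iu /=]; have := fB u Iu => fu; rewrite ltNge.
by rewrite (le_trans fu) // lerDl ltW.
Qed.

Lemma dist_right_cont f s t : measurable_fun I f -> (t%:E < dist f s)%E ->
  exists2 s', s < s' & (t%:E < dist f s')%E.
Proof.
move=> mf; apply: contraPP => /forall2NP h; apply/negP; rewrite -leNgt.
pose F (n : nat) : set R := above f (s + n.+1%:R^-1).
have mF n : measurable (F n) by exact: measurable_above.
have FU : \bigcup_n F n = above f s.
  apply/seteqP; split=> [u [n _ [Iu /= fu]]|u [Iu /= fu]].
    by split=> //=; apply: lt_trans fu; rewrite ltrDl invr_gt0.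
  have [n /=] := ltr_add_invr fu => nu; by exists n.
have := @nondecreasing_cvg_mu _ _ _ leb F mF; rewrite FU.
move=> /(_ (measurable_above _ mf)) cv.
have {}cv : (leb \o F) n @[n --> \oo] --> dist f s.
  apply: cv => n m nm; apply/subsetPset => u [Iu /= fu]; split=> //=.
  apply: le_lt_trans fu; rewrite lerD2l lef_pV2 ?posrE // ler_nat ltnS.
  exact: nm.
rewrite -(cvg_lim _ cv) //; apply: lime_le; first by apply/cvg_ex; exists (dist f s).
apply: nearW => n /=; have [] := h (s + n.+1%:R^-1).
  by rewrite ltrDl invr_gt0 ltr0n.
by move=> /negP; rewrite -leNgt.
Qed.

(** Right continuity of the distribution function makes the rearrangement its
    exact generalized inverse, with strict inequalities. *)
Lemma rearr_gt f s t : measurable_fun I f -> 0 <= s ->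
  (s%:E < rearr I f t)%E = (t%:E < dist f s)%E.
Proof.
move=> mf s0; apply/idP/idP.
  apply: contraTT; rewrite -!leNgt => ft; apply/lee_addgt0Pr => e e0.
  apply: ereal_inf_lbound; exists (s + e); rewrite ?EFinD //; split.
    by rewrite ltr_wpDl.
  by apply: le_trans ft; apply: dist_anti => //; rewrite lerDl ltW.
move=> /(dist_right_cont mf)[s' ss' ts'].
apply: (@lt_le_trans _ _ s'%:E); first by rewrite lte_fin.
apply: le_ereal_inf_tmp => _ [r [r0 fr] <-]; rewrite lee_fin leNgt; apply/negP => rs'.
have := lt_le_trans ts' (dist_anti mf (ltW rs')).
by rewrite ltNge fr.
Qed.

Section Bounded.
Variables (f : R -> R) (B : R).
Hypothesis mf : measurable_fun I f.
Hypothesis fB : forall u, I u -> `|f u| <= B.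

Let B0 : 0 <= B.
Proof.
apply: le_trans (fB (u := 2^-1) _); first exact: normr_ge0.
by rewrite /unit_itv /= in_itv /=; apply/andP; split; lra.
Qed.

Let fs := fine \o rearr I f.

Let fs_fin u : 0 <= u -> (rearr I f u = (fs u)%:E)%E.
Proof.
move=> u0; rewrite /fs /= fineK // ge0_fin_numE ?rearr_ge0 //.
by apply: le_lt_trans (rearr_bounded B0 u0 fB) _; rewrite ltry.
Qed.

Let fs_above s : 0 <= s -> I `&` [set u | s < fs u] = [set` `]0, fine (dist f s)[].
Proof.
move=> s0; have dE := fineK (dist_fin s mf).
have d1 : fine (dist f s) <= 1 by rewrite -lee_fin dE dist_le1.
apply/seteqP; split=> u.
  move=> [/=]; rewrite /unit_itv /= !in_itv /= => /andP[u0 u1].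
  by rewrite -lte_fin -fs_fin ?(ltW u0) // rearr_gt // -dE lte_fin u0.
rewrite /unit_itv /= !in_itv /= => /andP[u0 ud]; rewrite u0 (lt_le_trans ud) //.
by split=> //; rewrite -lte_fin -fs_fin ?(ltW u0) // rearr_gt // -dE lte_fin.
Qed.

Lemma measurable_rearr : measurable_fun I (fine \o rearr I f).
Proof.
apply: (measurability (@RGenOInfty.G R)) => [|_ [_ [s ->] <-]].
  exact: RGenOInfty.measurableE.
have [s0|s0] := leP 0 s.
  have := fs_above s0; rewrite [X in measurable X](_ : _ = I `&` [set u | s < fs u]).
    by move=> ->; exact: measurable_itv.
  by apply/seteqP; split=> u /= [Iu]; rewrite in_itv /= andbT.
rewrite (_ : _ `&` _ = I); first exact: measurable_unit.
apply/seteqP; split=> [u []//|u Iu]; split=> //=; rewrite in_itv /= andbT.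
by apply: (lt_le_trans s0); rewrite fine_ge0 // rearr_ge0.
Qed.

(** By [rearr_gt] the rearrangement exceeds s exactly on an initial interval of
    length [dist f s]. *)
Lemma dist_rearr s : 0 <= s -> dist (fine \o rearr I f) s = dist f s.
Proof.
move=> s0; rewrite /dist (_ : above _ _ = I `&` [set u | s < fs u]).
  rewrite fs_above // lebesgue_measure_itv /= -/(dist f s).
  have := dist_ge0 f s; have := fineK (dist_fin s mf).
  case: (dist f s) => //= r _; rewrite lee_fin lte_fin sube0.
  by case: ltP => // r0 r0'; congr EFin; apply/le_anti/andP.
have absE u : `|(fine \o rearr I f) u| = fs u.
  by rewrite ger0_norm // fine_ge0 // rearr_ge0.
by apply/seteqP; split=> u [Iu su]; split=> //; move: su; rewrite /= absE.
Qed.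

End Bounded.

(** * Step functions *)

Section Step.
Variable n : nat.
Implicit Type d : 'I_n.+1 -> R.

Definition cell (i : 'I_n.+1) : set R := `](i%:R / n.+1%:R), (i.+1%:R / n.+1%:R)[.

Definition step d (u : R) : R := \sum_i d i * \1_(cell i) u.

Lemma measurable_cell i : measurable (cell i).
Proof. exact: measurable_itv. Qed.

Lemma leb_cell i : leb (cell i) = (n.+1%:R^-1)%:E.
Proof.
rewrite /cell lebesgue_measure_itv /= lte_fin ltr_pM2r ?invr_gt0 ?ltr0n //.
rewrite ltr_nat ltnSn -EFinB; congr EFin.
by rewrite -mulrBl -natr1 addrAC subrr add0r mul1r.
Qed.

Lemma cell_unit i : cell i `<=` I.
Proof.
move=> u; rewrite /cell /unit_itv /= !in_itv /= => /andP[lu ul].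
apply/andP; split; first by apply: le_lt_trans lu; rewrite divr_ge0.
apply: (lt_le_trans ul); rewrite ler_pdivrMr ?ltr0n // mul1r ler_nat.
exact: ltn_ord.
Qed.

Lemma cell_inj i j u : cell i u -> cell j u -> i = j.
Proof.
rewrite /cell /= !in_itv /= => /andP[iu ui] /andP[ju uj].
have h (k l : 'I_n.+1) : k%:R / n.+1%:R < u -> u < l.+1%:R / n.+1%:R -> (k <= l)%N.
  move=> ku ul; have := lt_trans ku ul.
  by rewrite ltr_pM2r ?invr_gt0 ?ltr0n // ltr_nat ltnS.
by apply/val_inj/eqP; rewrite eqn_leq h // h.
Qed.

Lemma step_cell d i u : cell i u -> step d u = d i.
Proof.
move=> iu; rewrite /step (bigD1 i) //= indicE mem_set // mulr1 big1 ?addr0 //.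
move=> j ji; rewrite indicE memNset ?mulr0 //.
by move=> /(cell_inj iu) ij; rewrite ij eqxx in ji.
Qed.

Lemma step_out d u : (forall i, ~ cell i u) -> step d u = 0.
Proof.
by move=> h; rewrite /step big1 // => i _; rewrite indicE memNset ?mulr0.
Qed.

Lemma measurable_step d : measurable_fun I (step d).
Proof.
apply: measurable_funTS; rewrite /step; apply: measurable_sum => i.
by apply: measurable_funM => //; apply: measurable_indic; exact: measurable_cell.
Qed.

Lemma step_bounded d u : `|step d u| <= \sum_i `|d i|.
Proof.
apply: le_trans (ler_norm_sum _ _ _) _; apply: ler_sum => i _.
rewrite normrM ler_piMr // indicE.
by case: (_ \in _); rewrite ?normr1 ?normr0.
Qed.

Lemma dist_step d s : 0 <= s ->
  dist (step d) s = (#|[pred i | s < `|d i|]|%:R / n.+1%:R)%:E.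
Proof.
move=> s0; rewrite /dist.
rewrite (_ : above _ _ = \big[setU/set0]_(i < n.+1 | s < `|d i|) cell i).
  rewrite measure_bigsetU_ord_cond.
  - rewrite (eq_bigr (fun=> (n.+1%:R^-1)%:E)) => [|i _]; last exact: leb_cell.
    by rewrite sumEFin sumr_const mulr_natl.
  - by move=> i _; exact: measurable_cell.
  - by move=> i j _ _ [u [iu ju]]; exact: (cell_inj iu ju).
rewrite -bigcup_seq_cond; apply/seteqP; split=> u.
  move=> [Iu /= su]; have [[i iu]|/forallNP iu] := pselect (exists i, cell i u).
    by exists i => //=; rewrite mem_index_enum /= -(step_cell d iu).
  by move: su; rewrite (step_out d iu) normr0 ltNge s0.
move=> [i /= /andP[_ si] iu]; split; first exact: (cell_unit iu).
by rewrite /= (step_cell d iu).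
Qed.

End Step.

End Rearrangement.

Section RearrangementIntegral.
Variable R : realType.
Local Notation leb := (@lebesgue_measure R).
Local Notation I := (@unit_itv R).

Lemma rearr_eq0 (f : R -> R) t : measurable_fun I f -> 1 <= t ->
  rearr I f t = 0%E.
Proof.
move=> mf t1; apply/eqP; rewrite eq_le rearr_ge0 andbT.
apply/lee_addgt0Pr => e e0; rewrite add0e; apply: ereal_inf_lbound.
by exists e => //; split=> //; apply: le_trans (dist_le1 e mf) _; rewrite lee_fin.
Qed.

Lemma integral_rearr_lty (f : R -> R) B : measurable_fun I f ->
  (forall u, I u -> `|f u| <= B) ->
  (\int[leb]_(t in `]0%R, +oo[) rearr I f t < +oo)%E.
Proof.
move=> mf fB; have B0 : 0 <= B.
  apply: le_trans (fB (2^-1) _); first exact: normr_ge0.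
  by rewrite /unit_itv /= in_itv /=; apply/andP; split; lra.
pose fs := fine \o rearr I f.
have fsE t : 0 <= t -> rearr I f t = (fs t)%:E.
  move=> t0; rewrite /fs /= fineK // ge0_fin_numE ?rearr_ge0 //.
  by apply: le_lt_trans (rearr_bounded B0 t0 fB) _; rewrite ltry.
have -> : (\int[leb]_(t in `]0%R, +oo[) rearr I f t =
    \int[leb]_(t in `]0%R, +oo[) ((EFin \o fs) \_ I) t)%E.
  apply: eq_integral => t; rewrite inE /= in_itv /= andbT => t0; rewrite patchE.
  case: ifPn => [|]; first by rewrite (fsE _ (ltW t0)).
  rewrite notin_setE /unit_itv /= in_itv /= t0 /= => /negP; rewrite -leNgt => t1.
  exact: rearr_eq0.
rewrite -integral_mkcondr (_ : _ `&` _ = I); last first.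
  apply/seteqP; split=> [t []//|t It]; split=> //; move: It.
  by rewrite /unit_itv /= !in_itv /= => /andP[->].
have mI := @measurable_unit R.
apply: (@le_lt_trans _ _ (\int[leb]_(t in I) (cst B%:E) t)%E).
  apply: ge0_le_integral => //.
  - by move=> t _; rewrite lee_fin fine_ge0 // rearr_ge0.
  - by apply/measurable_EFinP; exact: measurable_rearr fB.
  - move=> t; rewrite /unit_itv /= in_itv /= => /andP[t0 _].
    by rewrite /= -(fsE _ (ltW t0)); exact: (rearr_bounded B0 (ltW t0) fB).
by rewrite integral_cst // [X in (_ * X)%E]leb_unit mule1 ltry.
Qed.

End RearrangementIntegral.

(** * Symmetric spaces *)

Section SymmetricSpace.
Variables (R : realType) (E : set (R -> R)) (nE : (R -> R) -> R).
Hypothesis E_sym : symmetric_banach E nE.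
Local Notation I := (@unit_itv R).
Implicit Types f g : R -> R.

Lemma sb_dist f g : E g -> measurable_fun I f ->
  (forall s, 0 < s -> (dist f s <= dist g s)%E) -> E f /\ nE f <= nE g.
Proof.
by move=> Eg mf fg; apply: (sb_symmetric E_sym) => // t _; exact: rearr_le.
Qed.

Lemma sb_le f g : E g -> measurable_fun I f ->
  (forall u, I u -> `|f u| <= `|g u|) -> E f /\ nE f <= nE g.
Proof.
move=> Eg mf fg; apply: sb_dist => // s _; apply: dist_le => //.
exact: (sb_measurable E_sym).
Qed.

Lemma sb_norm0 : nE (fun=> 0) = 0.
Proof.
by have := sb_scale E_sym 0 (sb_zero E_sym); rewrite normr0 !mul0r.
Qed.

Lemma sb_scaleE a f : E f -> E (fun u => a * f u).
Proof.
move=> Ef; have := sb_lin E_sym a Ef (sb_zero E_sym); congr E.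
by apply/funext => u; rewrite addr0.
Qed.

Lemma sb_addE f g : E f -> E g -> E (fun u => f u + g u).
Proof.
move=> Ef Eg; have := sb_lin E_sym 1 Ef Eg; congr E.
by apply/funext => u; rewrite mul1r.
Qed.

(** A nonzero element of E exceeds some d > 0 on a set of positive measure, so
    d times the indicator of any shorter interval is below it in
    distribution. *)
Lemma sb_some_cell : exists n, forall i : 'I_n.+1, E \1_(cell i).
Proof.
have [f Ef f0] := sb_nonzero E_sym; have mf := sb_measurable E_sym Ef.
have [d d0 fd] : exists2 d, 0 < d & (0 < dist f d)%E.
  apply: contrapT => /forall2NP h; move/negP: f0; apply; apply/eqP.
  apply/le_anti; rewrite (sb_ge0 E_sym Ef) andbT -sb_norm0.
  apply: (sb_dist (sb_zero E_sym) mf _).2 => s s0; apply: le_trans (dist_ge0 _ _).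
  by have [//|/negP] := h s; rewrite leNgt.
have fin := dist_fin d mf.
have fd' : 0 < fine (dist f d) by rewrite fine_gt0 // fd ltey_eq fin.
have [n] := ltr_add_invr fd'; rewrite add0r => nd; exists n => i.
pose x j : R := if j == i then d else 0.
suff : E (step x).
  move=> /(sb_scaleE d^-1); congr E; apply/funext => u.
  rewrite /step (bigD1 i) //= big1 => [|j /negPf ji]; last by rewrite /x ji mul0r.
  by rewrite /x eqxx addr0 mulrA mulVf ?gt_eqF // mul1r.
apply: (sb_dist Ef (measurable_step _) _).1 => s s0; rewrite dist_step ?(ltW s0) //.
have [sd|ds] := ltP s d.
  apply: (@le_trans _ _ (dist f d)); last by apply: dist_anti => //; exact: ltW.
  rewrite -(fineK fin) lee_fin; apply: le_trans (ltW nd).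
  rewrite ler_piMl ?invr_ge0 // -[leRHS]/(1%:R) ler_nat.
  apply: (@leq_trans #|pred1 i|); last by rewrite card1.
  apply: subset_leq_card; apply/fintype.subsetP => j; rewrite !inE /x; case: eqP => //= _.
  by rewrite normr0 ltNge (ltW s0).
rewrite (@eq_card0 _ [pred j | s < `|x j|]) ?mul0r ?dist_ge0 // => j; rewrite !inE /x.
by case: eqP => _; rewrite ?normr0 ltNge ?(ltW s0) // gtr0_norm // ds.
Qed.

(** Finitely many cells exhaust the interval up to their endpoints, so E contains
    a function with the same distribution as a large constant. *)
Lemma sb_bounded f B : measurable_fun I f -> (forall u, I u -> `|f u| <= B) -> E f.
Proof.
move=> mf fB; have [n En] := sb_some_cell.
have B0 : 0 <= B.
  apply: le_trans (fB (2^-1) _); first exact: normr_ge0.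
  by rewrite /unit_itv /= in_itv /=; apply/andP; split; lra.
pose g := step (fun _ : 'I_n.+1 => B + 1).
have Eg : E g.
  rewrite /g /step; elim: (index_enum _) => [|i r IH].
    by have := sb_zero E_sym; congr E; apply/funext => u; rewrite big_nil.
  have := sb_lin E_sym (B + 1) (En i) IH; congr E.
  by apply/funext => u; rewrite big_cons.
apply: (sb_dist Eg mf _).1 => s s0; have [sB|Bs] := ltP s (B + 1).
  apply: le_trans (dist_le1 _ mf) _; rewrite dist_step ?(ltW s0) //.
  rewrite (@eq_card _ _ 'I_n.+1) => [|i]; last first.
    by rewrite !inE ger0_norm ?sB // addr_ge0.
  by rewrite card_ord divff // pnatr_eq0.
rewrite (_ : dist f s = 0%E) ?dist_ge0 // /dist (_ : above _ _ = set0) ?measure0 //.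
apply/seteqP; split=> u // -[Iu /=]; rewrite ltNge (le_trans (fB u Iu)) //.
by apply: le_trans Bs; rewrite lerDl.
Qed.

Lemma sb_step n (d : 'I_n.+1 -> R) : E (step d).
Proof.
apply: (sb_bounded (measurable_step d)) => u _; exact: step_bounded.
Qed.

Lemma ext_norm_rearr_step n (d : 'I_n.+1 -> R) :
  ext_norm E nE (fine \o rearr I (step d)) = (nE (step d))%:E.
Proof.
have mf := measurable_step d; have fB u (_ : I u) := step_bounded d u.
have dE s (s0 : 0 < s) := dist_rearr mf fB (ltW s0).
have [Er le1] : E (fine \o rearr I (step d)) /\
    nE (fine \o rearr I (step d)) <= nE (step d).
  apply: sb_dist; [exact: sb_step|exact: measurable_rearr fB|].
  by move=> s s0; rewrite dE.
have [_ le2] : E (step d) /\ nE (step d) <= nE (fine \o rearr I (step d)).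
  by apply: sb_dist => // s s0; rewrite dE.
rewrite /ext_norm asboolT //; congr EFin; exact/le_anti/andP.
Qed.

End SymmetricSpace.

(** * From the martingale inequality to step functions *)

Section ColumnExchange.
Local Open Scope complex_scope.
Variables (R : realType) (E : set (R -> R)) (nE : (R -> R) -> R).

Definition martingale_equivalence (C C' : R) : Prop :=
  forall (H : lmodType R[i]) (ip : {dot H for @conjc R})
    (M : set (H -> H)) (tau : (H -> H) -> R[i]),
  hilbert ip -> von_neumann ip M -> trace_state ip M tau ->
  forall (Mk : nat -> set (H -> H)) (Ex : nat -> (H -> H) -> H -> H),
  filtration ip M Mk ->
  (forall k, cond_exp ip M tau (Mk k) (Ex k)) ->
  forall x : nat -> set (H * H),
  (forall k, (op_norm ip M (trace_weight tau) (ext_norm E nE) (x k)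
              < +oo)%E) ->
  martingale_differences ip M tau Mk Ex x ->
  forall S : set (H * H), is_L1_sum ip M tau x S ->
  let norm_sum := op_norm ip M (trace_weight tau) (ext_norm E nE) S in
  let norm_tensor := op_norm (l2_ip ip) (tensor_linf ip M)
    (tensor_weight ip tau) (Z2_norm E nE) (direct_sum_op ip x) in
  (norm_sum <= C%:E * norm_tensor)%E /\
  (norm_tensor <= C'%:E * norm_sum)%E.

Hypothesis E_sym : symmetric_banach E nE.
Variable n : nat.
Local Notation H := 'rV[R[i]]_n.+1.
Local Notation ip := (@rv_ip R n.+1).
Local Notation nu := (trace_weight (@ntrace R n)).
Implicit Types (a : 'I_n.+1 -> R) (c : 'I_n.+1 -> 'I_n.+1).

Lemma sing_val_step a c : sing_val ip nu (graph (wcomp a c)) =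
  rearr (@unit_itv R) (step (col_norm a c)).
Proof.
apply/funext => t; rewrite sing_val_wcomp; congr (ereal_inf _); apply/seteqP.
have cE (s : R) : count_above (col_norm a c) s =
    #|[pred i | s < `|col_norm a c i|]|.
  by apply: eq_card => i; rewrite !inE ger0_norm // col_norm_ge0.
split=> _ [s [s0 h] <-]; exists s => //; split=> //; move: h;
  by rewrite cE -/(dist _ s) dist_step // (ltW s0).
Qed.

Lemma op_norm_wcomp a c : op_norm ip (@full_alg R n) nu (ext_norm E nE)
  (graph (wcomp a c)) = (nE (step (col_norm a c)))%:E.
Proof.
rewrite /op_norm asboolT; last by apply/wcomp_L0/full_algP; exact: is_lin_wcomp.
by rewrite sing_val_step ext_norm_rearr_step.
Qed.

Lemma wcomp_L1 (N : set (H -> H)) a c : N (wcomp a c) ->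
  L1_op ip N nu (graph (wcomp a c)).
Proof.
move=> Na; split; first exact: wcomp_L0.
rewrite /L1_opnorm sing_val_step.
apply: integral_rearr_lty (measurable_step _) _ => u _; exact: step_bounded.
Qed.

Lemma L1_opnorm0 : L1_opnorm ip nu (graph (fun=> 0 : H)) = 0%E.
Proof.
rewrite -(wcomp0 R (n := n) id) /L1_opnorm sing_val_step.
apply: integral0_eq => t; rewrite /= in_itv /= andbT => t0.
apply/eqP; rewrite eq_le rearr_ge0 andbT.
apply: rearr_bounded => //; first exact: ltW.
move=> u _; rewrite /step big1 ?normr0 // => i _.
by rewrite /col_norm big1 ?sqrtr0 ?mul0r // => j _; rewrite expr0n.
Qed.

Lemma gsub_self (T : H -> H) : is_lin T ->
  L1_opnorm ip nu (gsub ip (graph T) (graph T)) = 0%E.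
Proof.
move=> /bounded_rvP bT; rewrite gsub_graph // -L1_opnorm0.
by congr (L1_opnorm _ _ (graph _)); apply/funext => u; rewrite subrr.
Qed.

Lemma partial_sum_row_op a c m :
  partial_sum ip (fun k => graph (row_op a c k)) m =
  graph (wcomp (fun i => if (i < m)%N then a i else 0) c).
Proof.
elim: m => [|m IH] /=; first by rewrite -(wcomp0 _ c).
rewrite IH gadd_graph; try exact: bounded_wcomp.
congr graph; apply/funext => u; rewrite -wcompD; congr (wcomp _ _ _).
apply/funext => i; rewrite [in RHS]ltnS [in RHS]leq_eqVlt; case: eqVneq => [->|_] /=.
  by rewrite ltnn add0r.
by case: ifP; rewrite addr0.
Qed.

Section Columns.
Variables (a : 'I_n.+1 -> R) (c : 'I_n.+1 -> 'I_n.+1).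
Hypothesis c_lt : forall i, a i != 0 -> (c i < i)%N.

(** Row [k] of the matrix has its entry strictly left of the diagonal, hence in
    the corner of size [k + 1] but off the blocks of the previous algebra. *)
Lemma row_op_in k : block_alg (corner k) (row_op a c k).
Proof.
apply/(block_algP (@corner_equiv n k)); split; first exact: is_lin_wcomp.
move=> u i; rewrite !mxE; case: eqVneq => [ik|]; last by rewrite !mul0r.
have [->|/c_lt ci] := eqVneq (a i) 0; first by rewrite !mul0r.
by rewrite /corner -ik leqnn (ltnW ci) orbT.
Qed.

Lemma pinch_row_op k : pinch (corner k) (row_op a c k.+1) = (fun=> 0).
Proof.
apply/funext => u; apply/rowP => i; rewrite !mxE.
case: eqVneq => [ik|]; last by rewrite mul0r.
have [->|/c_lt ci] := eqVneq (a i) 0; first by rewrite mul0r.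
rewrite /corner ik ltnn /= orbF; case: eqP => [ic|]; last by rewrite mulr0.
by rewrite -ic ltnn in ci.
Qed.

Lemma row_op_martingale : martingale_differences ip (@full_alg R n) (@ntrace R n)
  (fun k => block_alg (corner k)) (fun k => pinch (corner k))
  (fun k => graph (row_op a c k)).
Proof.
split=> k; first by apply: wcomp_L1; exact: row_op_in.
exists (fun=> row_op a c k.+1); split.
- by move=> _; apply/full_algP; exact: is_lin_wcomp.
- by rewrite /L1_cvg gsub_self; [exact: cvg_cst|exact: is_lin_wcomp].
- rewrite /L1_cvg pinch_row_op gsub_self; first exact: cvg_cst.
  by move=> x u v; rewrite scaler0 addr0.
Qed.

Lemma row_op_sum : is_L1_sum ip (@full_alg R n) (@ntrace R n)
  (fun k => graph (row_op a c k)) (graph (wcomp a c)).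
Proof.
split; first by apply: wcomp_L1; apply/full_algP; exact: is_lin_wcomp.
apply: cvg_near_cst; near=> m; rewrite partial_sum_row_op.
rewrite (_ : (fun i : 'I_n.+1 => _) = a) ?gsub_self //; first exact: is_lin_wcomp.
apply/funext => i; rewrite ifT //; apply: (leq_trans (ltn_ord i)).
by near: m; exact: nbhs_infty_ge.
Unshelve. all: by end_near. Qed.

End Columns.

(** Both sums are compared with the norm of the direct sum, which is the same
    for c and for c'. *)
Lemma column_exchange C C' a c c' : 0 < C -> martingale_equivalence C C' ->
  (forall i, a i != 0 -> (c i < i)%N) -> (forall i, a i != 0 -> (c' i < i)%N) ->
  nE (step (col_norm a c)) <= C * C' * nE (step (col_norm a c')).
Proof.
move=> C0 eqv hc hc'.
have fin b k : (op_norm ip (@full_alg R n) nu (ext_norm E nE)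
    (graph (row_op a b k)) < +oo)%E by rewrite op_norm_wcomp ltry.
have bounds (b : 'I_n.+1 -> 'I_n.+1) (hb : forall i, a i != 0 -> (b i < i)%N) :=
  eqv H ip (@full_alg R n) (@ntrace R n) (@rv_hilbert R n.+1)
    (block_alg_vn _ _) (@ntrace_state R n) _ _ (@corner_filtration R n)
    (@corner_cond_exp R n) _ (fin b) (row_op_martingale hb) _ (row_op_sum a b).
have [leS _] := bounds c hc; have [_ leT] := bounds c' hc'.
rewrite -lee_fin EFinM -!op_norm_wcomp EFinM -muleA.
apply: le_trans leS _; rewrite lee_pmul2l ?lte_fin //.
by rewrite (op_norm_direct_sum c' c).
Qed.

End ColumnExchange.

(** * Step functions have comparable E-norm and L2-norm *)

Section StepL2.
Variables (R : realType) (E : set (R -> R)) (nE : (R -> R) -> R).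
Hypothesis E_sym : symmetric_banach E nE.
Variables C C' : R.
Hypotheses (C0 : 0 < C) (C'0 : 0 < C').
Hypothesis eqv : martingale_equivalence E nE C C'.
Local Notation I := (@unit_itv R).
Implicit Types x : nat -> R.

Definition first_col n : 'I_n.+1 -> 'I_n.+1 := fun=> ord0.
Definition prev_col n : 'I_n.+1 -> 'I_n.+1 := fun i => inord i.-1.

(** Row 0 is left empty, since no column precedes it strictly. *)
Definition row_weight n x (i : 'I_n.+1) : R := if i : nat is k.+1 then x k else 0.

(** The singular values of the sum for [prev_col]; the last coordinate has no row
    below it and gets 0. *)
Definition trunc n x (i : 'I_n.+1) : R := if (i < n)%N then `|x i| else 0.
Definition unit_col n r (i : 'I_n.+1) : R := if i == ord0 then r else 0.

Lemma row_weight_neq0 n x (i : 'I_n.+1) : row_weight x i != 0 -> (0 < i)%N.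
Proof. by rewrite /row_weight; case: (i : nat); rewrite ?eqxx. Qed.

Lemma sum_row_weight n x (P : pred 'I_n.+1) :
  \sum_(i < n.+1 | P i) row_weight x i ^+ 2 =
  \sum_(k < n | P (lift ord0 k)) x k ^+ 2.
Proof.
rewrite big_mkcond big_ord_recl [RHS]big_mkcond /=.
rewrite [X in X + _](_ : _ = 0) ?add0r; last by case: ifP; rewrite // expr0n.
by apply: eq_bigr.
Qed.

Lemma col_norm_first n x : col_norm (row_weight x) (@first_col n) =
  unit_col (Num.sqrt (\sum_(k < n) x k ^+ 2)).
Proof.
apply/funext => j; rewrite /col_norm sum_row_weight /unit_col /first_col.
have [//|j0] := eqVneq j ord0.
by rewrite big_pred0 ?sqrtr0.
Qed.

Lemma col_norm_prev n x : col_norm (row_weight x) (@prev_col n) = trunc x.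
Proof.
apply/funext => j; rewrite /col_norm sum_row_weight /trunc /prev_col.
have prevE (k : 'I_n) : (inord (lift ord0 k).-1 == j) = ((k : nat) == j).
  by rewrite -val_eqE /= add0n inordK // ltnS ltnW.
under eq_bigl do rewrite prevE.
case: ifPn => [jn|]; last first.
  rewrite -leqNgt => nj; rewrite big_pred0 ?sqrtr0 // => k.
  by apply/negbTE; rewrite neq_ltn (leq_trans (ltn_ord k) nj).
by rewrite (big_pred1 (Ordinal jn)) ?sqrtr_sqr // => k; rewrite -val_eqE.
Qed.

Lemma prev_col_lt n x (i : 'I_n.+1) : row_weight x i != 0 -> (prev_col i < i)%N.
Proof.
move=> /row_weight_neq0 i0; rewrite inordK ?prednK ?leqnn //.
exact: leq_trans (leq_pred _) (ltn_ord i).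
Qed.

Lemma step_scale n (d : 'I_n.+1 -> R) r :
  step (fun i => r * d i) = (fun u => r * step d u).
Proof.
apply/funext => u; rewrite /step mulr_sumr; apply: eq_bigr => i _.
by rewrite mulrA.
Qed.

Lemma nE_unit_col n r : 0 <= r ->
  nE (step (@unit_col n r)) = r * nE (step (@unit_col n 1)).
Proof.
move=> r0; rewrite (_ : unit_col r = fun i => r * @unit_col n 1 i).
  by rewrite step_scale (sb_scale E_sym _ (sb_step E_sym _)) ger0_norm.
by apply/funext => i; rewrite /unit_col; case: ifP; rewrite ?mulr1 ?mulr0.
Qed.

Let K := C * C'.
Let phi n := nE (step (@unit_col n 1)).

Lemma trunc_le n x : nE (step (@trunc n x)) <=
  K * (Num.sqrt (\sum_(k < n) x k ^+ 2) * phi n).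
Proof.
rewrite -col_norm_prev -nE_unit_col ?sqrtr_ge0 // -col_norm_first.
apply: (column_exchange E_sym C0 eqv) => i; first exact: prev_col_lt.
exact: row_weight_neq0.
Qed.

Lemma trunc_ge n x : Num.sqrt (\sum_(k < n) x k ^+ 2) * phi n <=
  K * nE (step (@trunc n x)).
Proof.
rewrite -col_norm_prev -nE_unit_col ?sqrtr_ge0 // -col_norm_first.
apply: (column_exchange E_sym C0 eqv) => i; last exact: prev_col_lt.
exact: row_weight_neq0.
Qed.

Lemma dist_trunc n x s : 0 <= s -> dist (step (@trunc n x)) s =
  ((\sum_(k < n) (s < `|x k|)%R%:R) / n.+1%:R)%:E.
Proof.
move=> s0; rewrite dist_step //; congr ((_ / _)%:E).
rewrite -sum1_card natr_sum big_mkcond big_ord_recr /= inE /trunc ltnn normr0.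
rewrite [s < 0]ltNge s0 addr0; apply: eq_bigr => k _.
by rewrite inE /= ltn_ord normr_id; case: ifP.
Qed.

(** For the constant weights 1 the step function [trunc] equals 1 on a set of
    measure n / (n + 1), at least 1/2, so its norm is at least this one. *)
Lemma nE_half_gt0 : 0 < nE (step (@unit_col 1 1)).
Proof.
rewrite lt_def (sb_ge0 E_sym (sb_step E_sym _)) andbT; apply/eqP => nE0.
have := sb_definite E_sym (sb_step E_sym _) nE0.
move=> [Z [mZ Z0 sZ]].
have : (lebesgue_measure (cell (ord0 : 'I_2) : set R) <= lebesgue_measure Z)%E.
  apply: le_measure; rewrite ?inE //; first exact: measurable_cell.
  move=> u cu; apply: sZ => /= /(_ (cell_unit cu)).
  by rewrite (step_cell _ cu) /unit_col eqxx => /eqP; rewrite oner_eq0.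
by rewrite Z0 leb_cell lee_fin leNgt invr_gt0 ltr0n.
Qed.

(** Applied to the constant weights, the two previous bounds show that
    [phi n] is comparable with the inverse of the square root of [n]. *)
Lemma step_L2 : exists2 A : R, 0 < A & forall n x, (0 < n)%N ->
  nE (step (@trunc n x)) <= A * Num.sqrt ((\sum_(k < n) x k ^+ 2) / n%:R) /\
  Num.sqrt ((\sum_(k < n) x k ^+ 2) / n%:R) <= A * nE (step (@trunc n x)).
Proof.
pose k0 := nE (step (@unit_col 1 1)); have k0_gt0 : 0 < k0 := nE_half_gt0.
have E1 : E (fun=> 1).
  by apply: (@sb_bounded _ _ _ E_sym _ 1) => // u _; rewrite normr1.
pose k1 := nE (fun=> 1); have k1_ge0 : 0 <= k1 := sb_ge0 E_sym E1.
have K0 : 0 < K by exact: mulr_gt0.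
(* Up to the factor [sqrt n], [phi n] lies between [k0 / K] and [K * k1]; the
   last summand only makes [A] positive. *)
pose A := K ^+ 2 * k1 + K ^+ 2 / k0 + 1.
have K2 : 0 < K ^+ 2 by rewrite exprn_gt0.
have A1 : 0 <= K ^+ 2 * k1 by rewrite mulr_ge0 // ltW.
have A2 : 0 <= K ^+ 2 / k0 by rewrite divr_ge0 ?ltW.
exists A => [|n x n0]; first by rewrite /A; lra.
pose S := Num.sqrt (\sum_(k < n) x k ^+ 2).
have S0 : 0 <= S by exact: sqrtr_ge0.
pose q := Num.sqrt n%:R : R.
have q0 : 0 < q by rewrite sqrtr_gt0 ltr0n.
have -> : Num.sqrt ((\sum_(k < n) x k ^+ 2) / n%:R) = S / q.
  rewrite sqrtrM ?sqrtrV ?ler0n //; last by apply: sumr_ge0 => k _; exact: sqr_ge0.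
have sum1 : Num.sqrt (\sum_(k < n) ((fun=> 1 : R) k) ^+ 2) = q.
  by under eq_bigr do rewrite expr1n; rewrite sumr_const card_ord.
have phi_le : q * phi n <= K * k1.
  have := trunc_ge n (fun=> 1); rewrite sum1 => /le_trans; apply.
  rewrite ler_wpM2l ?(ltW K0) //; apply: (sb_le E_sym E1 (measurable_step _) _).2.
  move=> u _; rewrite normr1; have [[i iu]|/forallNP iu] := pselect (exists i, @cell R n i u).
    by rewrite (step_cell _ iu) /trunc; case: ifP; rewrite ?normr0 ?normr1.
  by rewrite (step_out _ iu) normr0.
have phi_ge : k0 <= K * (q * phi n).
  have := trunc_le n (fun=> 1); rewrite sum1; apply: le_trans.
  apply: (sb_dist E_sym (sb_step E_sym _) (measurable_step _) _).2 => s s0.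
  rewrite dist_trunc ?(ltW s0) // dist_step ?(ltW s0) // normr1 lee_fin.
  rewrite -sum1_card natr_sum big_mkcond !big_ord_recl big_ord0 !inE /=.
  rewrite /unit_col eqxx normr1 normr0 [s < 0]ltNge (ltW s0) !addr0.
  rewrite sumr_const card_ord; case: (s < 1); last by rewrite mul0r mul0rn mul0r.
  rewrite ler_pdivrMr ?ltr0n // mulrAC ler_pdivlMr ?ltr0n // mul1r -natrM ler_nat.
  by rewrite muln2 -addnn -addn1 leq_add.
have phi0 : 0 <= phi n by exact: sb_ge0 (sb_step E_sym _).
have phiE : phi n = q * phi n / q by rewrite mulrAC divff ?mul1r // gt_eqF.
have Sq : 0 <= S / q by rewrite divr_ge0 // ltW.
split.
  apply: le_trans (trunc_le n x) _; rewrite -/S.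
  have -> : K * (S * phi n) = K * (q * phi n) * (S / q).
    by rewrite phiE; field; rewrite gt_eqF.
  rewrite ler_wpM2r //; have : K * (q * phi n) <= K * (K * k1) by rewrite ler_wpM2l // ltW.
  by rewrite [K * (K * k1)]mulrA -expr2 /A; lra.
have h := trunc_ge n x; rewrite -/S in h.
set N := nE _ in h *; have N0 : 0 <= N by exact: sb_ge0 (sb_step E_sym _).
have hk : (S / q) * k0 <= K ^+ 2 * N.
  apply: (@le_trans _ _ ((S / q) * (K * (q * phi n)))); first by rewrite ler_wpM2l.
  have -> : S / q * (K * (q * phi n)) = K * (S * phi n).
    by field; rewrite gt_eqF.
  by rewrite expr2 -mulrA ler_wpM2l // ltW.
have : S / q <= K ^+ 2 / k0 * N.
  by rewrite mulrAC ler_pdivlMr.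
move=> /le_trans; apply; rewrite ler_wpM2r // /A; lra.
Qed.

End StepL2.

(** * Simple functions *)

Section SimpleFunctions.
Variable R : realType.
Local Notation leb := (@lebesgue_measure R).
Local Notation I := (@unit_itv R).
Implicit Types (g : R -> R) (r : seq R).

Definition level g (y : R) : set R := I `&` g @^-1` [set y].
Definition mass g (y : R) : R := fine (leb (level g y)).

Record simple_values g r : Prop := {
  sv_measurable : measurable_fun I g ;
  sv_uniq : uniq r ;
  sv_pos : forall y, y \in r -> 0 < y ;
  sv_values : forall u, I u -> g u = 0 \/ g u \in r }.

Lemma measurable_level g y : measurable_fun I g -> measurable (level g y).
Proof. by move=> mg; apply: mg => //; exact: measurable_unit. Qed.

Lemma leb_level g y : measurable_fun I g -> leb (level g y) = (mass g y)%:E.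
Proof.
move=> mg; rewrite /mass fineK // ge0_fin_numE //.
have le1 : (leb (level g y) <= leb I)%E.
  apply: le_measure; rewrite ?inE; [exact: measurable_level|exact: measurable_unit|].
  by move=> u [].
by apply: le_lt_trans le1 _; rewrite leb_unit ltry.
Qed.

Lemma mass_ge0 g y : 0 <= mass g y.
Proof. exact: fine_ge0. Qed.

(** With f the modulus this is the integral of g, with f the indicator of a ray
    the distribution function of its square root. *)
Lemma integral_simple g r (f : R -> R) : simple_values g r ->
  f 0 = 0 -> (forall y, 0 <= f y) ->
  (\int[leb]_(u in I) (f (g u))%:E = (\sum_(y <- r) f y * mass g y)%:E)%E.
Proof.
move=> sg f0 fpos; have mg := sv_measurable sg; have mI := @measurable_unit R.
transitivity (\int[leb]_(u in I) \sum_(y <- r) (f y)%:E * (\1_(level g y) u)%:E)%E.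
  apply: eq_integral => u; rewrite inE => Iu; under eq_bigr do rewrite -EFinM.
  rewrite sumEFin; congr EFin.
  have [g0|gr] := sv_values sg Iu.
    rewrite g0 f0 big_seq big1 // => y yr; rewrite indicE memNset ?mulr0 //.
    by move=> [_ /= gy]; have := sv_pos sg yr; rewrite -gy g0 ltxx.
  rewrite (bigD1_seq (g u)) ?(sv_uniq sg) //= indicE mem_set //= mulr1 big1 ?addr0 //.
  move=> y /eqP yg; rewrite indicE memNset ?mulr0 // => -[_ /= gy].
  by apply: yg.
rewrite ge0_integral_sum //.
- rewrite -sumEFin; apply: eq_bigr => y _.
  have ml : measurable (level g y) by exact: measurable_level.
  rewrite ge0_integralZl //.
  + rewrite integral_indic // (_ : _ `&` _ = level g y) ?EFinM -?leb_level //.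
    by apply/seteqP; split=> [u []//|u lu]; split=> //; case: lu.
  + by apply/measurable_EFinP; apply: measurable_indic.
  + by rewrite lee_fin.
- move=> y; apply: measurable_funeM; apply/measurable_EFinP.
  by apply: measurable_indic; exact: measurable_level.
- by move=> y u _; rewrite mule_ge0 // lee_fin.
Qed.

Lemma dist_simple g r s : simple_values g r -> 0 <= s ->
  dist (fun u => Num.sqrt (g u)) s =
  (\sum_(y <- r) (s < Num.sqrt y)%R%:R * mass g y)%:E.
Proof.
move=> sg s0; rewrite -(integral_simple (f := fun y => (s < Num.sqrt y)%R%:R) sg).
- have mf : measurable_fun I (fun u => Num.sqrt (g u)).
    apply: (measurableT_comp _ (sv_measurable sg)).
    exact: continuous_measurable_fun (@sqrt_continuous R).
  have ma := measurable_above s mf.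
  have mI := @measurable_unit R.
  transitivity (\int[leb]_(u in I) (\1_(above (fun u => Num.sqrt (g u)) s) u)%:E)%E.
    rewrite integral_indic //.
    by congr (leb _); apply/seteqP; split=> [u ab|u []//]; split=> //; case: ab.
  apply: eq_integral => u; rewrite inE => Iu; congr EFin; rewrite indicE.
  congr ((nat_of_bool _)%:R); apply/idP/idP; first by rewrite inE => -[_ /=]; rewrite ger0_norm ?sqrtr_ge0.
  by move=> su; rewrite inE; split=> //=; rewrite ger0_norm ?sqrtr_ge0.
- by rewrite sqrtr0 ltNge s0.
- by move=> y; rewrite ler0n.
Qed.

Lemma sum_nth (l : seq R) n (F : R -> R) : F 0 = 0 -> (size l <= n)%N ->
  \sum_(k < n) F (nth 0 l k) = \sum_(y <- l) F y.
Proof.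
move=> F0 ln; rewrite (big_nth 0) big_mkord (big_ord_widen _ (fun k => F (nth 0 l k)) ln).
rewrite [RHS]big_mkcond /=; apply: eq_bigr => k _.
by case: ltnP => // lk; rewrite nth_default.
Qed.

(** The simple function g plays the role of a square, hence the square roots. *)
Definition replicate (m : R -> nat) r : seq R :=
  flatten [seq nseq (m y) (Num.sqrt y) | y <- r].

Lemma size_replicate m r : size (replicate m r) = (\sum_(y <- r) m y)%N.
Proof.
rewrite size_flatten sumnE /shape -map_comp big_map.
by apply: eq_bigr => y _; rewrite /= size_nseq.
Qed.

Lemma sum_replicate m r (F : R -> R) :
  \sum_(z <- replicate m r) F z = \sum_(y <- r) (m y)%:R * F (Num.sqrt y).
Proof.
rewrite big_flatten big_map; apply: eq_bigr => y _.
by rewrite big_nseq; elim: (m y) => [|k IH]; rewrite ?mul0r //= IH -natr1; ring.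
Qed.

End SimpleFunctions.

Section SimpleL2.
Variables (R : realType) (E : set (R -> R)) (nE : (R -> R) -> R).
Hypothesis E_sym : symmetric_banach E nE.
Variable A : R.
Hypothesis A0 : 0 < A.
Hypothesis stepA : forall n x, (0 < n)%N ->
  nE (step (@trunc R n x)) <= A * Num.sqrt ((\sum_(k < n) x k ^+ 2) / n%:R) /\
  Num.sqrt ((\sum_(k < n) x k ^+ 2) / n%:R) <= A * nE (step (@trunc R n x)).
Local Notation leb := (@lebesgue_measure R).
Local Notation I := (@unit_itv R).
Implicit Types (g : R -> R) (r : seq R).

Lemma measurable_sqrt g : measurable_fun I g ->
  measurable_fun I (fun u => Num.sqrt (g u)).
Proof.
move=> mg; apply: (measurableT_comp _ mg).
exact: continuous_measurable_fun (@sqrt_continuous R).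
Qed.

Lemma sum_replicate_sqr (m : R -> nat) r : (forall y, y \in r -> 0 < y) ->
  \sum_(z <- replicate m r) z ^+ 2 = \sum_(y <- r) (m y)%:R * y.
Proof.
move=> rpos; rewrite sum_replicate big_seq [RHS]big_seq; apply: eq_bigr => y yr.
by rewrite sqr_sqrtr // ltW // rpos.
Qed.

Lemma dist_replicate m r n s : 0 <= s -> (size (replicate m r) <= n)%N ->
  dist (step (@trunc R n (nth 0 (replicate m r)))) s =
  ((\sum_(y <- r) (m y)%:R * (s < Num.sqrt y)%R%:R) / n.+1%:R)%:E.
Proof.
move=> s0 ln; rewrite dist_trunc //; congr ((_ / _)%:E).
rewrite (@sum_nth _ _ _ (fun z => (s < `|z|)%R%:R)) //; last by rewrite normr0 ltNge s0.
by rewrite sum_replicate; apply: eq_bigr => y _; rewrite ger0_norm ?sqrtr_ge0.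
Qed.

Lemma sqrt_simple_bounded g r : simple_values g r ->
  forall u, I u -> `|Num.sqrt (g u)| <= \sum_(y <- r) Num.sqrt y.
Proof.
move=> sg u Iu; rewrite ger0_norm ?sqrtr_ge0 //.
have [->|gr] := sv_values sg Iu.
  by rewrite sqrtr0 sumr_ge0 // => y _; exact: sqrtr_ge0.
by rewrite (bigD1_seq _ gr (sv_uniq sg)) /= lerDl sumr_ge0.
Qed.

Lemma sb_sqrt_simple g r : simple_values g r -> E (fun u => Num.sqrt (g u)).
Proof.
move=> sg; apply: (sb_bounded E_sym _ (sqrt_simple_bounded sg)).
exact: measurable_sqrt (sv_measurable sg).
Qed.

Lemma sum_mass g r : simple_values g r ->
  (\sum_(y <- r) mass g y)%:E = dist (fun u => Num.sqrt (g u)) 0.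
Proof.
move=> sg; rewrite (dist_simple sg) // big_seq [in RHS]big_seq; congr EFin.
by apply: eq_bigr => y yr; rewrite sqrtr_gt0 (sv_pos sg yr) mul1r.
Qed.

Lemma le_of_inv_nat (a b c : R) (n0 : nat) : 0 <= c ->
  (forall n, (n0 < n)%N -> a <= b + c / n%:R) -> a <= b.
Proof.
move=> c0 h; apply/ler_addgt0Pr => e e0.
have ce : 0 <= c / e by rewrite divr_ge0 // ltW.
pose n := (Num.truncn (c / e) + n0).+1.
have n_gt : (0 : R) < n%:R by rewrite ltr0n.
apply: le_trans (h n _) _; first by rewrite ltnS leq_addl.
rewrite lerD2l ler_pdivrMr // mulrC -ler_pdivrMr //.
apply: (le_trans (ltW (truncnS_gt (c / e)))); rewrite ler_nat ltnS leq_addr //.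
Qed.

(** If the multiplicities [n * mass g y] are rounded down, the step function is
    below the square root of g in distribution. The rounding costs at most
    y / n for each value y, which disappears as n grows. *)
Lemma simple_lower g r : simple_values g r ->
  \sum_(y <- r) y * mass g y <= A ^+ 2 * nE (fun u => Num.sqrt (g u)) ^+ 2.
Proof.
move=> sg; set f := fun u => Num.sqrt (g u).
have mf : measurable_fun I f by exact: measurable_sqrt (sv_measurable sg).
have ry0 : 0 <= \sum_(y <- r) y.
  by rewrite big_seq sumr_ge0 // => y /(sv_pos sg)/ltW.
apply: (@le_of_inv_nat _ _ _ 0 ry0) => n n0.
have n_gt : (0 : R) < n%:R by rewrite ltr0n.
pose m y := Num.truncn (n%:R * mass g y).
have m_le y : (m y)%:R <= n%:R * mass g y.
  by rewrite truncn_le // mulr_ge0 // ?ler0n // mass_ge0.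
have m_ge y : n%:R * mass g y <= (m y)%:R + 1.
  by rewrite natr1 ltW // truncnS_gt.
have sz : (size (replicate m r) <= n)%N.
  rewrite size_replicate -(ler_nat R) natr_sum.
  apply: (@le_trans _ _ (\sum_(y <- r) n%:R * mass g y)); first exact: ler_sum.
  rewrite -mulr_sumr ler_piMr ?ler0n // -lee_fin (sum_mass sg).
  exact: dist_le1.
have [_ up] := stepA (nth 0 (replicate m r)) n0.
rewrite (@sum_nth _ _ _ (fun z => z ^+ 2)) ?expr0n // in up.
rewrite (sum_replicate_sqr _ (sv_pos sg)) in up.
have le_nE : nE (step (@trunc R n (nth 0 (replicate m r)))) <= nE f.
  apply: (sb_dist E_sym (sb_sqrt_simple sg) (measurable_step _) _).2 => s s0.
  rewrite (dist_replicate (ltW s0) sz) (dist_simple sg (ltW s0)) lee_fin.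
  rewrite ler_pdivrMr ?ltr0n // mulr_suml; apply: ler_sum => y _.
  rewrite mulrC -mulrA ler_wpM2l ?ler0n //; apply: le_trans (m_le y) _.
  by rewrite mulrC ler_wpM2l ?mass_ge0 // ler_nat.
have nf0 : 0 <= nE f := sb_ge0 E_sym (sb_sqrt_simple sg).
have {up le_nE} : Num.sqrt ((\sum_(y <- r) (m y)%:R * y) / n%:R) <= A * nE f.
  by apply: le_trans up _; rewrite ler_wpM2l // ltW.
have q0 : 0 <= (\sum_(y <- r) (m y)%:R * y) / n%:R.
  rewrite divr_ge0 ?ler0n // big_seq sumr_ge0 // => y /(sv_pos sg)/ltW y0.
  by rewrite mulr_ge0.
rewrite -ler_sqr ?nnegrE ?sqrtr_ge0 ?mulr_ge0 ?(ltW A0) // sqr_sqrtr // exprMn => up.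
apply: le_trans (lerD up (lexx _)); rewrite -mulrDl ler_pdivlMr // -big_split.
rewrite mulr_suml big_seq [leRHS]big_seq; apply: ler_sum => y /(sv_pos sg)/ltW y0 /=.
have := ler_wpM2l y0 (m_ge y); nra.
Qed.

(** With multiplicities rounded up, the step function is above the square root
    of g in distribution. At most n values can be placed, which for large n is
    enough when the values of g that are not 0 occupy at most half of the
    interval. *)
Lemma simple_upper_half g r : simple_values g r ->
  \sum_(y <- r) mass g y <= 2^-1 ->
  nE (fun u => Num.sqrt (g u)) ^+ 2 <= A ^+ 2 * \sum_(y <- r) y * mass g y.
Proof.
move=> sg half; set f := fun u => Num.sqrt (g u).
have ry0 : 0 <= \sum_(y <- r) y.
  by rewrite big_seq sumr_ge0 // => y /(sv_pos sg)/ltW.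
have c0 : 0 <= A ^+ 2 * (2 * \sum_(y <- r) y) by rewrite mulr_ge0 ?sqr_ge0 // mulr_ge0.
apply: (@le_of_inv_nat _ _ _ (2 * size r) c0) => n nr.
have n0 : (0 < n)%N by exact: leq_ltn_trans nr.
have n_gt : (0 : R) < n%:R by rewrite ltr0n.
pose m y := (Num.truncn (n.+1%:R * mass g y)).+1.
have m_ge y : n.+1%:R * mass g y <= (m y)%:R by rewrite ltW // truncnS_gt.
have m_le y : (m y)%:R <= n.+1%:R * mass g y + 1.
  by rewrite /m -natr1 lerD2r truncn_le // mulr_ge0 // mass_ge0.
have sz : (size (replicate m r) <= n)%N.
  rewrite size_replicate -(ler_nat R) natr_sum.
  apply: (@le_trans _ _ (\sum_(y <- r) (n.+1%:R * mass g y + 1))); first exact: ler_sum.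
  rewrite big_split /= -mulr_sumr big_const_seq count_predT iter_addr_0.
  have : (2 * size r)%:R + 1 <= n%:R :> R by rewrite natr1 ler_nat.
  have : n.+1%:R * (\sum_(y <- r) mass g y) <= n.+1%:R * 2^-1 by rewrite ler_wpM2l.
  rewrite natrM -natr1; lra.
have [up _] := stepA (nth 0 (replicate m r)) n0.
rewrite (@sum_nth _ _ _ (fun z => z ^+ 2)) ?expr0n // in up.
rewrite (sum_replicate_sqr _ (sv_pos sg)) in up.
have le_nE : nE f <= nE (step (@trunc R n (nth 0 (replicate m r)))).
  apply: (sb_dist E_sym (sb_step E_sym _) _ _).2 => [|s s0].
    exact: measurable_sqrt (sv_measurable sg).
  rewrite (dist_replicate (ltW s0) sz) (dist_simple sg (ltW s0)) lee_fin.
  rewrite ler_pdivlMr ?ltr0n // mulr_suml; apply: ler_sum => y _.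
  by rewrite mulrC mulrCA [leRHS]mulrC ler_wpM2l ?ler0n.
have nf0 : 0 <= nE f := sb_ge0 E_sym (sb_sqrt_simple sg).
have q0 : 0 <= (\sum_(y <- r) (m y)%:R * y) / n%:R.
  rewrite divr_ge0 ?ler0n // big_seq sumr_ge0 // => y /(sv_pos sg)/ltW y0.
  by rewrite mulr_ge0.
have {up le_nE} := le_trans le_nE up.
rewrite -ler_sqr ?nnegrE ?mulr_ge0 ?sqrtr_ge0 ?(ltW A0) // exprMn sqr_sqrtr // => up.
apply: le_trans up _; rewrite -mulrA -mulrDr ler_wpM2l ?sqr_ge0 //.
rewrite ler_pdivrMr // mulrDl divfK ?gt_eqF // mulr_suml mulr_sumr -big_split.
rewrite big_seq [leRHS]big_seq; apply: ler_sum => y yr /=.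
have y0 := ltW (sv_pos sg yr).
have mass1 : mass g y <= 1.
  rewrite -lee_fin -(leb_level _ (sv_measurable sg)).
  apply: (@le_trans _ _ (leb I)); last by rewrite leb_unit.
  apply: le_measure; rewrite ?inE; [|exact: measurable_unit|by move=> u []].
  exact: measurable_level (sv_measurable sg).
have := ler_wpM2l y0 (m_le y); have := ler_wpM2l y0 mass1.
rewrite -natr1; nra.
Qed.

End SimpleL2.

Import HBNNSimple.

Section SimpleRestriction.
Variable R : realType.
Local Notation leb := (@lebesgue_measure R).
Local Notation I := (@unit_itv R).
Implicit Types (g : R -> R) (r s : seq R).

Definition pos_values s : seq R := [seq y <- undup s | 0 < y].

Lemma simple_valuesP g s : measurable_fun I g -> (forall u, I u -> 0 <= g u) ->
  (forall u, I u -> g u \in s) -> simple_values g (pos_values s).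
Proof.
move=> mg g0 gs; split=> //; first by rewrite filter_uniq // undup_uniq.
  by move=> y; rewrite mem_filter => /andP[].
move=> u Iu; have := g0 u Iu; rewrite le_eqVlt => /predU1P[->|gu]; first by left.
by right; rewrite mem_filter gu mem_undup gs.
Qed.

Lemma sv_ge0 g r u : simple_values g r -> I u -> 0 <= g u.
Proof. by move=> sg /(sv_values sg)[->//|/(sv_pos sg)/ltW]. Qed.

Lemma integral_simple_values g r : simple_values g r ->
  (\int[leb]_(u in I) (g u)%:E = (\sum_(y <- r) y * mass g y)%:E)%E.
Proof.
move=> sg; transitivity (\int[leb]_(u in I) (`|g u|)%:E)%E.
  by apply: eq_integral => u; rewrite inE => Iu; rewrite ger0_norm // (sv_ge0 sg).
rewrite (integral_simple sg (f := fun y => `|y|)) ?normr0 //.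
congr EFin; rewrite big_seq [RHS]big_seq; apply: eq_bigr => y yr.
by rewrite gtr0_norm // (sv_pos sg).
Qed.

Lemma simple_restrict g r (J : set R) : measurable J -> simple_values g r ->
  simple_values (fun u => g u * \1_J u) r.
Proof.
move=> mJ sg; split; [|exact: sv_uniq sg|exact: sv_pos sg|].
  apply: measurable_funM; first exact: sv_measurable sg.
  by apply: measurable_funTS; exact: measurable_indic.
move=> u Iu; rewrite indicE; case: (u \in J); last by left; rewrite mulr0.
by rewrite mulr1; exact: sv_values sg u Iu.
Qed.

Lemma mass_restrict_le g r (J : set R) y : measurable J -> simple_values g r ->
  y \in r -> mass (fun u => g u * \1_J u) y <= mass g y.
Proof.
move=> mJ sg yr; have mg := sv_measurable sg.
have mg' := sv_measurable (simple_restrict mJ sg).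
rewrite -lee_fin -!leb_level //; apply: le_measure; rewrite ?inE;
  try exact: measurable_level.
move=> u [Iu /= gy]; split=> //=; move: gy; rewrite indicE.
case: (u \in J); first by rewrite mulr1.
by rewrite mulr0 => y0; have := sv_pos sg yr; rewrite -y0 ltxx.
Qed.

End SimpleRestriction.

(** * The two inclusions *)

Section Comparison.
Variables (R : realType) (E : set (R -> R)) (nE : (R -> R) -> R).
Hypothesis E_sym : symmetric_banach E nE.
Variable A : R.
Hypothesis A0 : 0 < A.
Hypothesis stepA : forall n x, (0 < n)%N ->
  nE (step (@trunc R n x)) <= A * Num.sqrt ((\sum_(k < n) x k ^+ 2) / n%:R) /\
  Num.sqrt ((\sum_(k < n) x k ^+ 2) / n%:R) <= A * nE (step (@trunc R n x)).
Local Notation leb := (@lebesgue_measure R).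
Local Notation I := (@unit_itv R).
Implicit Types (f g : R -> R) (r : seq R).

(** The two halves of g, cut at 1/2, satisfy the support condition of
    [simple_upper_half]. *)
Lemma simple_upper g r : simple_values g r ->
  nE (fun u => Num.sqrt (g u)) ^+ 2 <= 4 * A ^+ 2 * \sum_(y <- r) y * mass g y.
Proof.
move=> sg; pose J : set R := [set` `]0, 2^-1[]; pose J' : set R := ~` J.
have mJ : measurable J by exact: measurable_itv.
have mJ' : measurable J' by exact: measurableC.
have piece (L : set R) : measurable L -> (leb (I `&` L) <= (2^-1)%:E)%E ->
    nE (fun u => Num.sqrt (g u * \1_L u)) ^+ 2 <= A ^+ 2 * \sum_(y <- r) y * mass g y.
  move=> mL L2; have sL := simple_restrict mL sg.
  apply: le_trans (simple_upper_half E_sym A0 stepA sL _) _; last first.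
    rewrite ler_wpM2l ?sqr_ge0 // big_seq [leRHS]big_seq; apply: ler_sum => y yr.
    by rewrite ler_wpM2l ?(ltW (sv_pos sg yr)) // (mass_restrict_le mL sg).
  rewrite -lee_fin (sum_mass sL); apply: le_trans L2.
  apply: le_measure; rewrite ?inE.
  - apply: measurable_above; exact: measurable_sqrt (sv_measurable sL).
  - exact: measurableI (@measurable_unit R) mL.
  - move=> u [Iu /=]; rewrite indicE; case uL: (u \in L).
      by move=> _; split=> //; exact: set_mem.
    by rewrite mulr0 sqrtr0 normr0 ltxx.
have J1 : (leb (I `&` J) <= (2^-1)%:E)%E.
  rewrite (_ : I `&` J = J).
    rewrite /J lebesgue_measure_itv /= lte_fin invr_gt0 ltr0n sube0.
    exact: lexx.
  apply/seteqP; split=> [u []//|u Ju]; split=> //; move: Ju.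
  rewrite /J /unit_itv /= !in_itv /= => /andP[-> u2] /=; lra.
have J2 : (leb (I `&` J') <= (2^-1)%:E)%E.
  have -> : (2^-1)%:E = leb [set` `[2^-1, 1[].
    rewrite lebesgue_measure_itv /= lte_fin ifT; last by lra.
    by rewrite -EFinB; congr EFin; lra.
  apply: le_measure; rewrite ?inE.
  - exact: measurableI (@measurable_unit R) mJ'.
  - exact: measurable_itv.
  - move=> u []; rewrite /J' /J /unit_itv /= !in_itv /= => /andP[u0 u1] /negP.
    by rewrite u0 /= -leNgt u1 => ->.
have p1 := piece J mJ J1; have p2 := piece J' mJ' J2.
pose g1 u := Num.sqrt (g u * \1_J u); pose g2 u := Num.sqrt (g u * \1_J' u).
have E1 : E g1 by exact: (sb_sqrt_simple E_sym (simple_restrict mJ sg)).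
have E2 : E g2 by exact: (sb_sqrt_simple E_sym (simple_restrict mJ' sg)).
have -> : (fun u => Num.sqrt (g u)) = fun u => g1 u + g2 u.
  apply/funext => u; rewrite /g1 /g2 /J' !indicE in_setC.
  by case: (u \in J); rewrite ?mulr1 ?mulr0 sqrtr0 ?addr0 ?add0r.
have tri := sb_triangle E_sym E1 E2.
have n1 := sb_ge0 E_sym E1; have n2 := sb_ge0 E_sym E2.
have n12 := sb_ge0 E_sym (sb_addE E_sym E1 E2).
rewrite -/g1 -/g2 in p1 p2.
set N := nE (fun u => _) in tri n12 *; set S := \sum_(y <- r) _ in p1 p2 *.
have : N ^+ 2 <= (nE g1 + nE g2) ^+ 2 by rewrite ler_sqr // nnegrE // addr_ge0.
have := sqr_ge0 (nE g1 - nE g2); rewrite sqrrB sqrrD; nra.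
Qed.

(** The integral is the supremum of those of the simple functions below the
    square of f, and the square roots of these have norm at most [nE f]. *)
Lemma square_integral_le f : E f ->
  (\int[leb]_(u in I) (f u ^+ 2)%:E <= (A ^+ 2 * nE f ^+ 2)%:E)%E.
Proof.
move=> Ef; have mI := @measurable_unit R.
rewrite ge0_integralE //; last by move=> u _; rewrite lee_fin sqr_ge0.
apply: ge_ereal_sup => _ [h /= hf <-].
have h_out u : ~ I u -> h u = 0.
  move=> Iu; have := hf u; rewrite patchE memNset // lee_fin => h0.
  by apply/le_anti; rewrite h0 fun_ge0.
have h_in u : I u -> h u <= f u ^+ 2.
  by move=> Iu; have := hf u; rewrite patchE mem_set // lee_fin.
have sh : simple_values h (pos_values (finmap.enum_fset (fset_set (range h)))).
  apply: simple_valuesP.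
  - by apply: measurable_funTS; exact: measurable_funP h.
  - by move=> u _; exact: fun_ge0.
  - move=> u _; have := in_fset_set (fimfunP h) (h u).
    by rewrite [RHS]mem_set //; exists u.
rewrite -integralT_nnsfun.
have -> : (\int[leb]_u (h u)%:E = \int[leb]_(u in I) (h u)%:E)%E.
  rewrite [RHS]integral_mkcond; apply: eq_integral => u _.
  by rewrite patchE; case: ifPn => //; rewrite notin_setE => /h_out ->.
rewrite (integral_simple_values sh) lee_fin.
apply: le_trans (simple_lower E_sym A0 stepA sh) _.
rewrite ler_wpM2l ?sqr_ge0 //.
have [Eh le_nE] : E (fun u => Num.sqrt (h u)) /\
    nE (fun u => Num.sqrt (h u)) <= nE f.
  apply: (sb_le E_sym Ef); first exact: measurable_sqrt (sv_measurable sh).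
  move=> u Iu; rewrite ger0_norm ?sqrtr_ge0 // -sqrtr_sqr.
  by rewrite ler_sqrt ?sqr_ge0 // h_in.
by rewrite ler_sqr ?nnegrE // (sb_ge0 E_sym).
Qed.

Lemma sqrt_diff_sqr_le (a b : R) : 0 <= a -> a <= b ->
  (Num.sqrt b - Num.sqrt a) ^+ 2 <= b - a.
Proof.
move=> a0 ab; have b0 := le_trans a0 ab.
have := sqr_sqrtr a0; have := sqr_sqrtr b0.
have : Num.sqrt a <= Num.sqrt b by rewrite ler_sqrt.
have := sqrtr_ge0 a; have := sqrtr_ge0 b.
move: (Num.sqrt a) (Num.sqrt b) => s t *; nra.
Qed.

Section Approximation.
Variable f : R -> R.
Hypothesis mf : measurable_fun I f.

Let mI := @measurable_unit R.

Let mf2 : measurable_fun I (fun u => (f u ^+ 2)%:E).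
Proof. by apply/measurable_EFinP; exact: measurable_funX. Qed.

Let g n : R -> R := nnsfun_approx mI mf2 n.

Let g_ge0 n u : 0 <= g n u.
Proof. exact: fun_ge0. Qed.

Let g_nd u n m : (n <= m)%N -> g n u <= g m u.
Proof. by move=> nm; have /lefP := nd_nnsfun_approx mI mf2 nm; exact. Qed.

Let g_cvg u : I u -> (EFin \o g ^~ u) @ \oo --> (f u ^+ 2)%:E.
Proof.
by move=> Iu; apply: cvg_nnsfun_approx => // v _; rewrite lee_fin sqr_ge0.
Qed.

Let g_le n u : I u -> g n u <= f u ^+ 2.
Proof.
move=> Iu; rewrite -lee_fin; have cv := g_cvg Iu.
rewrite -(cvg_lim _ cv) //; apply: lime_ge; first by apply/cvg_ex; exists (f u ^+ 2)%:E.
by exists n => // m nm; rewrite /= lee_fin g_nd.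
Qed.

Let g_measurable n : measurable_fun I (g n).
Proof. by apply: measurable_funTS; exact: measurable_funP (nnsfun_approx _ _ n). Qed.

Let values n : seq R := finmap.enum_fset (fset_set (range (g n))).

Let g_values n u : g n u \in values n.
Proof.
have := in_fset_set (fimfunP (nnsfun_approx mI mf2 n)) (g n u).
by rewrite [RHS]mem_set //; exists u.
Qed.

Let g_simple n : simple_values (g n) (pos_values (values n)).
Proof. by apply: simple_valuesP. Qed.

Let v n : R := \sum_(y <- pos_values (values n)) y * mass (g n) y.

Let vE n : (\int[leb]_(u in I) (g n u)%:E = (v n)%:E)%E.
Proof. exact: integral_simple_values (g_simple n). Qed.

Let F n u : R := Num.sqrt (g n u).

Let E_F n : E (F n).
Proof. exact: (sb_sqrt_simple E_sym (g_simple n)). Qed.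

Let v_le (l : R) : (\int[leb]_(u in I) (f u ^+ 2)%:E = l%:E)%E -> forall n, v n <= l.
Proof.
move=> fl n; rewrite -lee_fin -vE -fl; apply: ge0_le_integral => //.
- by move=> u _; rewrite lee_fin.
- by apply/measurable_EFinP; exact: g_measurable.
- by move=> u Iu; rewrite lee_fin g_le.
Qed.

(** By [sqrt_diff_sqr_le] the difference of the square roots is dominated by the
    square root of the simple function [g m - g n]. *)
Let diff_sqr n m : (n <= m)%N -> nE (fun u => F m u - F n u) ^+ 2 <=
  4 * A ^+ 2 * (v m - v n).
Proof.
move=> nm; pose d u := g m u - g n u.
have d0 u : 0 <= d u by rewrite subr_ge0 g_nd.
have md : measurable_fun I d by exact: measurable_funB.
have sd : simple_values d (pos_values [seq y - z | y <- values m, z <- values n]).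
  by apply: simple_valuesP => // u _; apply: allpairs_f.
have -> : v m - v n =
    \sum_(y <- pos_values [seq y - z | y <- values m, z <- values n]) y * mass d y.
  apply/eqP; rewrite subr_eq addrC; apply/eqP/EFin_inj.
  rewrite EFinD -(integral_simple_values sd) -!vE -ge0_integralD //.
  - by apply: eq_integral => u _; rewrite -EFinD addrC subrK.
  - by move=> u _; rewrite lee_fin.
  - by apply/measurable_EFinP; exact: g_measurable.
  - by move=> u _; rewrite lee_fin.
  - by apply/measurable_EFinP; exact: md.
apply: le_trans (simple_upper sd).
have [_ le_nE] : E (fun u => F m u - F n u) /\
    nE (fun u => F m u - F n u) <= nE (fun u => Num.sqrt (d u)).
  apply: (sb_le E_sym (sb_sqrt_simple E_sym sd)).
    by apply: measurable_funB; exact: measurable_sqrt.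
  move=> u Iu; rewrite [leRHS]ger0_norm ?sqrtr_ge0 // -sqrtr_sqr ler_sqrt //.
  by apply: sqrt_diff_sqr_le; [exact: g_ge0|exact: g_nd].
have EB : E (fun u => F m u - F n u).
  have := sb_lin E_sym (-1) (E_F n) (E_F m); congr E.
  by apply/funext => u; rewrite mulN1r addrC.
by rewrite ler_sqr ?nnegrE ?(sb_ge0 E_sym) //; exact: (sb_sqrt_simple E_sym sd).
Qed.

Let nE_diffC n m : nE (fun u => F m u - F n u) = nE (fun u => F n u - F m u).
Proof.
have EB : E (fun u => F n u - F m u).
  have := sb_lin E_sym (-1) (E_F m) (E_F n); congr E.
  by apply/funext => u; rewrite mulN1r addrC.
have := sb_scale E_sym (-1) EB; rewrite normrN1 mul1r => <-.
by congr nE; apply/funext => u; rewrite mulN1r opprB.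
Qed.

(** The integrals of the [g n] converge, so [diff_sqr] makes the [F n] a Cauchy
    sequence in E. They tend to |f| pointwise, and to their limit h in E also in
    L_2 by [square_integral_le]; Fatou's lemma gives |f| = h almost
    everywhere. *)
Lemma square_integrable_in_E (l : R) : 0 <= l ->
  (\int[leb]_(u in I) (f u ^+ 2)%:E = (l ^+ 2)%:E)%E ->
  E f /\ nE f <= 2 * A * l.
Proof.
move=> l0 fl; have vl := v_le fl.
have v_nd : {homo v : n m / (n <= m)%N >-> n <= m}.
  move=> n m nm; rewrite -lee_fin -!vE; apply: ge0_le_integral => //.
  - by move=> u _; rewrite lee_fin.
  - by apply/measurable_EFinP; exact: g_measurable.
  - by apply/measurable_EFinP; exact: g_measurable.
  - by move=> u Iu; rewrite lee_fin g_nd.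
have v_cvg : cvgn v.
  by apply: nondecreasing_is_cvgn => //; exists (l ^+ 2) => _ [n _ <-].
have B0 : 0 < 4 * A ^+ 2 by rewrite mulr_gt0 // exprn_gt0.
have cauchyF e : 0 < e -> exists N, forall m n, (N <= m)%N -> (N <= n)%N ->
    nE (fun u => F m u - F n u) < e.
  move=> e0; pose d := e ^+ 2 / (4 * A ^+ 2).
  have d0 : 0 < d by rewrite divr_gt0 // exprn_gt0.
  have [N _ vN] : \forall n \near \oo, `|limn v - v n| < d by exact: cvgr_dist_lt.
  exists N => m n Nm Nn.
  have wlog_le p q : (N <= p)%N -> (p <= q)%N -> nE (fun u => F q u - F p u) < e.
    move=> Np pq; have := diff_sqr pq.
    have EB : E (fun u => F q u - F p u).
      have := sb_lin E_sym (-1) (E_F p) (E_F q); congr E.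
      by apply/funext => u; rewrite mulN1r addrC.
    have vq : v q <= limn v by exact: nondecreasing_cvgn_le.
    have vp : limn v - v p < d by have := vN p Np; apply: le_lt_trans; exact: ler_norm.
    move=> h; rewrite -ltr_sqr ?nnegrE ?(ltW e0) ?(sb_ge0 E_sym) //.
    apply: le_lt_trans h _; rewrite -ltr_pdivlMl // mulrC.
    by apply: le_lt_trans vp; rewrite lerB.
  have [mn|nm] := leqP m n; last by apply: wlog_le => //; exact: ltnW.
  by rewrite nE_diffC; exact: wlog_le.
have [h Eh Fh] := sb_complete E_sym E_F cauchyF.
have mh := sb_measurable E_sym Eh.
have E_Fh n : E (fun u => F n u - h u).
  have := sb_lin E_sym (-1) Eh (E_F n); congr E.
  by apply/funext => u; rewrite mulN1r addrC.
have m_F n : measurable_fun I (F n) by exact: measurable_sqrt.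
have m_abs : measurable_fun I (fun u => `|f u|).
  exact: (measurableT_comp (@normr_measurable _ setT)).
have int0 : (\int[leb]_(u in I) ((`|f u| - h u) ^+ 2)%:E = 0)%E.
  apply/eqP; rewrite eq_le; apply/andP; split; last first.
    by apply: integral_ge0 => u _; rewrite lee_fin sqr_ge0.
  have lim_u u : I u -> ((fun n => ((F n u - h u) ^+ 2)%:E) @ \oo -->
      ((`|f u| - h u) ^+ 2)%:E).
    move=> Iu; apply: cvg_EFin; first by near=> n.
    have gu : g ^~ u @ \oo --> f u ^+ 2.
      by have /fine_cvgP[_] := g_cvg Iu.
    have Fu : (fun n => F n u) @ \oo --> `|f u|.
      by rewrite -sqrtr_sqr; exact: (cvg_comp _ _ gu (@sqrt_continuous R _)).
    apply: (cvg_comp _ (fun x => x ^+ 2)); last exact: exprn_continuous.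
    by apply: cvgB; [exact: Fu|exact: cvg_cst].
  have fat := @fatou _ _ _ leb I mI (fun n u => ((F n u - h u) ^+ 2)%:E).
  have lhs : (\int[leb]_(u in I) ((`|f u| - h u) ^+ 2)%:E =
      \int[leb]_(u in I) limn_einf (fun n => ((F n u - h u) ^+ 2)%:E))%E.
    apply: eq_integral => u; rewrite inE => Iu.
    by rewrite (cvg_limn_einf_sup (lim_u u Iu)).1.
  have mFh n : measurable_fun I (fun u => ((F n u - h u) ^+ 2)%:E).
    apply/measurable_EFinP; apply: measurable_funX.
    by apply: measurable_funB; [exact: m_F|exact: mh].
  have Fh0 n u : I u -> (0 <= ((F n u - h u) ^+ 2)%:E)%E.
    by move=> _; rewrite lee_fin sqr_ge0.
  rewrite lhs; apply: le_trans (fat mFh Fh0) _.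
  have cv : (fun n => \int[leb]_(u in I) ((F n u - h u) ^+ 2)%:E)%E @ \oo --> 0%E.
    apply: (@squeeze_cvge _ _ _ _ (fun=> 0%E) _
      (fun n => (A ^+ 2 * nE (fun u => F n u - h u) ^+ 2)%:E)).
    - apply: nearW => n; rewrite square_integral_le // andbT.
      by apply: integral_ge0 => u _; rewrite lee_fin sqr_ge0.
    - exact: cvg_cst.
    - apply: cvg_EFin; first by apply: nearW.
      rewrite (_ : 0 = A ^+ 2 * 0 ^+ 2 :> R); last by rewrite expr0n mulr0.
      apply: cvgMr; apply: (cvg_comp _ (fun x => x ^+ 2) Fh).
      exact: exprn_continuous.
  by rewrite (cvg_limn_einf_sup cv).1.
have m_d : measurable_fun I (fun u => ((`|f u| - h u) ^+ 2)%:E).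
  by apply/measurable_EFinP; apply: measurable_funX; exact: measurable_funB.
have [Z [mZ Z0 sZ]] : ae_eq leb I (fun u => ((`|f u| - h u) ^+ 2)%:E) (cst 0%E).
  apply/(ae_eq_integral_abs leb mI m_d); rewrite -[RHS]int0.
  by apply: eq_integral => u _; rewrite gee0_abs // lee_fin sqr_ge0.
have fh u : I u -> ~ Z u -> `|f u| = h u.
  move=> Iu; apply: contra_notP => fhu; apply: sZ => /= /(_ Iu)[] /eqP.
  by rewrite sqrf_eq0 subr_eq0 => /eqP.
have [Ef le_h] : E f /\ nE f <= nE h.
  apply: (sb_dist E_sym Eh mf) => s s0.
  have mU : measurable (above h s `|` Z).
    by apply: measurableU => //; exact: measurable_above.
  apply: (@le_trans _ _ (leb (above h s `|` Z))).
    apply: le_measure; rewrite ?inE //; first exact: measurable_above.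
    move=> u [Iu /= fu]; have [Zu|nZ] := pselect (Z u); first by right.
    by left; split=> //=; rewrite -fh // ger0_norm.
  by rewrite measureU0 //; exact: measurable_above.
split=> //; apply: le_trans le_h _; apply/ler_addgt0Pr => e e0.
have [N _ hN] : \forall n \near \oo, `|0 - nE (fun u => F n u - h u)| < e.
  exact: (@cvgr_dist_lt _ _ _ _ _ _ _ Fh e e0).
have {}hN := hN N (leqnn N).
have hE : h = fun u => F N u + (-1) * (F N u - h u).
  by apply/funext => u; ring.
have n1 := sb_scale E_sym (-1) (E_Fh N).
have n2 := sb_triangle E_sym (E_F N) (sb_scaleE E_sym (-1) (E_Fh N)).
rewrite -hE n1 normrN1 mul1r in n2.
apply: le_trans n2 _; apply: lerD; last first.
  by move: hN; rewrite sub0r normrN ger0_norm ?(sb_ge0 E_sym) // => /ltW.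
rewrite -ler_sqr ?nnegrE ?(sb_ge0 E_sym) ?mulr_ge0 ?(ltW A0) //.
apply: le_trans (simple_upper (g_simple N)) _.
have -> : (2 * A * l) ^+ 2 = 4 * A ^+ 2 * l ^+ 2 by ring.
by rewrite ler_pM2l //; exact: vl.
Unshelve. all: by end_near. Qed.

End Approximation.

Lemma Lp_norm_sqr f : (Lp_norm I 2%:E f `^ 2 = \int[leb]_(u in I) (f u ^+ 2)%:E)%E.
Proof.
rewrite /Lp_norm poweR_Lnorm ?pnatr_eq0 // [RHS]integral_mkcond.
apply: eq_integral => u _; rewrite /= !patchE; case: ifPn => _.
  by rewrite powR_mulrn // real_normK ?num_real.
by rewrite normr0 powR0 // pnatr_eq0.
Qed.

Lemma Lp_norm_val f (l : R) : 0 <= l -> Lp_norm I 2%:E f = l%:E ->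
  (\int[leb]_(u in I) (f u ^+ 2)%:E = (l ^+ 2)%:E)%E.
Proof. by move=> l0 fl; rewrite -Lp_norm_sqr fl /= powR_mulrn. Qed.

Lemma in_L2_E f : L2_unit f -> E f.
Proof.
move=> [mf fin]; have l0 := Lnorm_ge0 leb 2%:E (EFin \o (f \_ I)).
have : Lp_norm I 2%:E f \is a fin_num by rewrite ge0_fin_numE.
move: l0 fin; rewrite -/(Lp_norm I 2%:E f).
case fl : (Lp_norm I 2%:E f) => [l| |] //; rewrite lee_fin => l0 _ _.
have int_f := Lp_norm_val l0 fl.
by have [] := square_integrable_in_E mf l0 int_f.
Qed.

Lemma E_Lp_norm f : E f -> exists l, [/\ 0 <= l, Lp_norm I 2%:E f = l%:E,
  nE f <= 2 * A * l & l <= A * nE f].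
Proof.
move=> Ef; have mf := sb_measurable E_sym Ef.
have le_f := square_integral_le Ef.
have lt_f : (\int[leb]_(u in I) (f u ^+ 2)%:E < +oo)%E.
  by apply: le_lt_trans le_f _; rewrite ltry.
have := Lp_norm_sqr f; have := Lnorm_ge0 leb 2%:E (EFin \o (f \_ I)).
rewrite -/(Lp_norm I 2%:E f).
case fl : (Lp_norm I 2%:E f) => [l| |] //; last first.
  by move=> _ h; move: lt_f; rewrite -h /= pnatr_eq0.
rewrite lee_fin => l0 _; have int_f := Lp_norm_val l0 fl.
exists l; split=> //; first by have [] := square_integrable_in_E mf l0 int_f.
move: le_f; rewrite int_f lee_fin -exprMn ler_sqr // nnegrE.
by rewrite mulr_ge0 ?(ltW A0) // (sb_ge0 E_sym).
Qed.

End Comparison.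

Theorem theorem1p2 (R : realType) (E : set (R -> R)) (nE : (R -> R) -> R)
  (E_sym : symmetric_banach E nE) (E_sep : separable_space E nE)
  (E_equiv : exists C C' : R, 0 < C /\ 0 < C' /\
    forall (H : lmodType R[i]) (ip : {dot H for @conjc R})
      (M : set (H -> H)) (tau : (H -> H) -> R[i]),
    hilbert ip -> von_neumann ip M -> trace_state ip M tau ->
    forall (Mk : nat -> set (H -> H)) (Ex : nat -> (H -> H) -> H -> H),
    filtration ip M Mk ->
    (forall k, cond_exp ip M tau (Mk k) (Ex k)) ->
    forall x : nat -> set (H * H),
    (forall k, (op_norm ip M (trace_weight tau) (ext_norm E nE) (x k)
                < +oo)%E) ->
    martingale_differences ip M tau Mk Ex x ->
    forall S : set (H * H), is_L1_sum ip M tau x S ->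
    let norm_sum := op_norm ip M (trace_weight tau) (ext_norm E nE) S in
    let norm_tensor := op_norm (l2_ip ip) (tensor_linf ip M)
      (tensor_weight ip tau) (Z2_norm E nE) (direct_sum_op ip x) in
    (norm_sum <= C%:E * norm_tensor)%E /\
    (norm_tensor <= C'%:E * norm_sum)%E) :
  E = @L2_unit R /\
  exists c c' : R, [/\ 0 < c, 0 < c' & forall f, E f ->
    ((nE f)%:E <= c%:E * Lp_norm (@unit_itv R) 2%:E f)%E /\
    (Lp_norm (@unit_itv R) 2%:E f <= c'%:E * (nE f)%:E)%E].
Proof.
have [C [C' [C0 [C'0 eqv]]]] := E_equiv.
have [A A0 stepA] := step_L2 E_sym C0 C'0 eqv; split.
  apply/seteqP; split=> f; last exact: (in_L2_E E_sym A0 stepA).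
  move=> Ef; split; first exact: (sb_measurable E_sym Ef).
  by have [l [_ -> _ _]] := E_Lp_norm E_sym A0 stepA Ef; rewrite ltry.
exists (2 * A), A; split=> // [|f Ef]; first by rewrite mulr_gt0.
have [l [l0 -> up low]] := E_Lp_norm E_sym A0 stepA Ef.
by rewrite -!EFinM !lee_fin.
Qed.
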